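(* Let $p>5$ be a prime. Then $$\sum_{k=0}^{p-1}\frac{k\binom{2k}k^2\binom{3k}k}{(-192)^k}\equiv\begin{cases}\frac35p-\frac15x^2\pmod{p^2}&\text{if } p\equiv1\pmod 3\text{ and } 4p=x^2+27y^2 \text{ with } x,y\in\mathbb Z,\\ -\frac p5\pmod{p^2}&\text{if } p\equiv 2\pmod 3,\end{cases}$$ $$\sum_{k=0}^{p-2}\frac{\binom{2k}k^2\binom{3k}k}{(-192)^k(k+1)}\equiv\begin{cases}\frac32x^2-4p\pmod{p^2}&\text{if } p\equiv1\pmod 3\text{ and } 4p=x^2+27y^2 \text{ with } x,y\in\mathbb Z,\\ 2(2p+1)\binom{[2p/3]}{[p/3]}^2+p\pmod{p^2}&\text{if } p\equiv 2\pmod 3.\end{cases}$$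
   Context: $[u]$ denotes the greatest integer not exceeding $u$. Congruences modulo $p^r$ between rational numbers with denominators prime to $p$ mean that the difference is $p^r$ times such a rational number. *)

(* Defs.v *)
From mathcomp Require Import all_boot all_order all_algebra.
Set Implicit Arguments. Unset Strict Implicit. Unset Printing Implicit Defensive.
Import Order.TTheory GRing.Theory Num.Theory.
Local Open Scope ring_scope.

Definition rat_cong (p r : nat) (a b : rat) : Prop :=
  exists c : rat, ~~ (p %| `|denq c|)%N /\ a - b = (p ^ r)%:R * c.

(* Main.v *)
(* Everything is computed in R = Z/p^2.  By Clausen's formula the series with coefficients
   C(2k,k)^2 C(3k,k) at x (1 - 27 x) is, modulo p^2, the square of the series with coefficients
   C(2k,k) C(3k,k) at x.  With x = -1/216 one has x (1 - 27 x) = -1/192, and the differential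
   equations express both sums of the theorem through the value g of the second series at x and
   its derivative g1 = x g': 5 S1 = 9 g g1 and 2 S2 = 81 g1^2 + 2 g^2.

   The second series is the member c = 1/3 of the family
   sum_k (c)_k (c+1/3)_k / (((3c+5)/6)_k k!) (-1/8)^k.  Modulo p^2 each term is affine in the
   displacement of c by multiples of p/3, so the values at c = 1/3 follow from those at
   c = 1/3 - p/3 and c = 1/3 - 2p/3, where the series terminates and satisfies a first-order
   recurrence in c (step 2), hence is a product.  This gives g = C(2N,N) for p = 3N + 1, and
   3 h = 2 (1 + p) C(2n+1,n) for p = 3n + 2, where h = 3 g1 + g/3; also 3 g h = p, resp. -p.

   For p = 3N + 1 it remains to see C(2N,N)^2 = x^2 - 2p when 4p = x^2 + 27 y^2.  The cubic
   Jacobi sums J1, J2 in R satisfy J2 = -C(2N,N), J1 J2 = p and J1^2 = 0, and J1 + J2 is an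
   integer A with 4p = A^2 + 27 B^2; such a representation is unique up to signs. *)
Require Import Defs.
From mathcomp Require Import all_boot all_order all_algebra.
From mathcomp Require Import ring lra zify.
Set Implicit Arguments. Unset Strict Implicit. Unset Printing Implicit Defensive.
Import Order.TTheory GRing.Theory Num.Theory.
Local Open Scope ring_scope.

(** * Terminating hypergeometric sums *)

(** The closed forms at the two terminating parameters contain powers of [27/8] and Pochhammer
    symbols with no simple residue modulo [p^2]. They disappear because the two values [V1], [V2]
    agree modulo [p]: then [(V1 - V2)^2 = 0], so the extrapolated value [2 V1 - V2] is [V1^2 / V2],
    where the awkward factors cancel exactly. This settles [g] or [h], according to the residue of
    [p] modulo 3. The other one vanishes at the first terminating parameter, hence is a multiple of
    [p], and [g h] then calls only for residues modulo [p], within reach of Fermat and Wilson.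

    The recurrence in [c] is run over the rationals, where no denominator vanishes. Modulo [p] the
    intermediate parameters can meet denominators divisible by [p], so only the two end values are
    reduced.

    The cubic characters take their values in [R] itself, through Teichmueller lifts; [p = 1] modulo
    3 supplies the cube roots of unity. The factor 27 in [4 p = A^2 + 27 B^2], instead of the 3 of
    the norm form, comes from a symmetry of order three. *)

Definition poch (R : pzRingType) (a : R) (k : nat) : R := \prod_(i < k) (a + i%:R).

Lemma poch0 (R : pzRingType) (a : R) : poch a 0 = 1.
Proof. by rewrite /poch big_ord0. Qed.

Lemma pochS (R : pzRingType) (a : R) k : poch a k.+1 = poch a k * (a + k%:R).
Proof. by rewrite /poch big_ord_recr. Qed.

Lemma poch_shift (R : comPzRingType) (a : R) k : a * poch (a + 1) k = poch a k * (a + k%:R).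
Proof.
elim: k => [|k IH]; first by rewrite !poch0; ring.
by rewrite !pochS mulrA IH; ring.
Qed.

Lemma poch_neq0 (R : idomainType) (a : R) k :
  (forall i, (i < k)%N -> a + i%:R != 0) -> poch a k != 0.
Proof. by move=> h; rewrite /poch; apply/prodf_neq0 => i _; apply: h. Qed.

(* At [c = 1 / 3] this is the term of [2F1(1/3, 2/3; 1; -1/8)]; at the negative parameters used
   below the series terminates and has a closed form. *)
Definition hyp_term (F : comUnitRingType) (c : F) (k : nat) : F :=
  poch c k * poch (c + 1 / 3) k / (poch ((3 * c + 5) / 6) k * (k`!)%:R) * (- (1 / 8)) ^+ k.

(* Keeps every denominator of [hyp_term c], [hyp_term (c - 2)] and of the telescoping certificates
   away from zero. *)
Definition regular (F : realFieldType) (c : F) : Prop :=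
  c <= 0 /\ forall k : nat, (3 * c - 1) / 6 + k%:R != 0.

Lemma hyp_term0 (F : realFieldType) (c : F) : hyp_term c 0 = 1.
Proof. by rewrite /hyp_term !poch0 fact0 expr0; field. Qed.

Lemma hyp_termS (F : realFieldType) (c : F) k : (3 * c + 5) / 6 + k%:R != 0 ->
  hyp_term c k.+1 =
  hyp_term c k * ((c + k%:R) * (c + 1 / 3 + k%:R) / (((3 * c + 5) / 6 + k%:R) * k.+1%:R) * - (1 / 8)).
Proof.
move=> h; rewrite /hyp_term !pochS factS natrM exprSr !invfM.
by ring.
Qed.

(** Passing from [c - 2] to [c] raises the numerator parameters by two and the denominator parameter
    by one, so the quotient of the terms is rational in [k]. The telescoping proofs can thus work
    with terms at [c - 2] alone. *)
Lemma hyp_term_shift (F : realFieldType) (c : F) k : regular c ->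
  hyp_term c k = hyp_term (c - 2) k *
   ((c + k%:R - 2) * (c + k%:R - 1) * (c + k%:R - 5 / 3) * (c + k%:R - 2 / 3)
     * ((3 * c - 1) / 6)
     / ((c - 2) * (c - 1) * (c - 5 / 3) * (c - 2 / 3) * ((3 * c - 1) / 6 + k%:R))).
Proof.
move=> [c0 hreg].
have nz (d : F) : d > 0 -> c - d != 0 by move=> d0; rewrite lt_eqF //; lra.
have n2 : c - 2 != 0 by apply: nz; lra.
have n1 : c - 1 != 0 by apply: nz; lra.
have n53 : c - 5 / 3 != 0 by apply: nz; lra.
have n23 : c - 2 / 3 != 0 by apply: nz; lra.
have e0 : (3 * c - 1) / 6 != 0 by have := hreg 0%N; rewrite addr0.
have two (a : F) : a * (a + 1) * poch (a + 1 + 1) k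
    = poch a k * ((a + k%:R) * (a + 1 + k%:R)).
  by rewrite -mulrA poch_shift mulrA poch_shift; ring.
have h1 := two (c - 2). have h2 := two (c - 5 / 3).
have h3 := poch_shift ((3 * c - 1) / 6) k.
rewrite (_ : c - 2 + 1 + 1 = c) in h1; last by ring.
rewrite (_ : c - 5 / 3 + 1 + 1 = c + 1 / 3) in h2; last by field.
rewrite (_ : (3 * c - 1) / 6 + 1 = (3 * c + 5) / 6) in h3; last by field.
have fk : (k`!)%:R != 0 :> F by rewrite pnatr_eq0 -lt0n fact_gt0.
have pe : poch ((3 * c - 1) / 6) k != 0 by apply: poch_neq0.
have ek := hreg k.
have h1' : poch c k = poch (c - 2) k * ((c - 2 + k%:R) * (c - 2 + 1 + k%:R)) / ((c - 2) * (c - 1)).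
  by rewrite -h1 (_ : c - 2 + 1 = c - 1); [field; rewrite n1 n2|ring].
have h2' : poch (c + 1 / 3) k = poch (c - 5 / 3) k *
     ((c - 5 / 3 + k%:R) * (c - 5 / 3 + 1 + k%:R)) / ((c - 5 / 3) * (c - 2 / 3)).
  rewrite -h2 (_ : c - 5 / 3 + 1 = c - 2 / 3); last by field.
  by rewrite -[LHS]mul1r -[X in X * _](@divff _ ((c - 5/3) * (c - 2/3))) ?mulf_neq0 //; ring.
have h3' : poch ((3 * c + 5) / 6) k
   = poch ((3 * c - 1) / 6) k * ((3 * c - 1) / 6 + k%:R) / ((3 * c - 1) / 6).
  by rewrite -h3 mulrAC divff ?mul1r.
rewrite /hyp_term h1' h2' h3'.
rewrite (_ : c - 2 + 1 / 3 = c - 5 / 3); last by field.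
rewrite (_ : (3 * (c - 2) + 5) / 6 = (3 * c - 1) / 6); last by field.
move: (poch _ k) (poch (c - 5/3) k) (poch ((3 * c - 1) / 6) k) pe (k`!%:R) fk => a b d pd f fk.
move: n53 n23 e0 ek; set x := c - 5/3; set y := c - 2/3; set z := (3 * c - 1) / 6; set w := z + k%:R => nx ny nz' nw.
rewrite (_ : c - 2 + 1 = c - 1); last by ring.
have -> : x + 1 + k%:R = c + k%:R - 2/3 by rewrite /x; field.
have -> : x + k%:R = c + k%:R - 5/3 by rewrite /x; ring.
by field; rewrite n1 n2 nx ny nz' nw fk pd.
Qed.

Definition hyp_sum (F : comUnitRingType) (c : F) (K : nat) : F := \sum_(k < K) hyp_term c k.
(** The step from [c - 2] to [c] acts on a two-dimensional space of value and derivative; this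
    weight makes it diagonal, with [hyp_sum] as the other eigendirection. At [c = 1/3] it yields
    [h = 3 g1 + g/3]. *)
Definition hyp_wsum (F : comUnitRingType) (c : F) (K : nat) : F := \sum_(k < K) (3 * k%:R + c) * hyp_term c k.

Lemma sum_telescope (V : zmodType) (f : nat -> V) K :
  \sum_(k < K) (f k.+1 - f k) = f K - f 0%N.
Proof. by rewrite -(big_mkord xpredT (fun k => f k.+1 - f k)) telescope_sumr. Qed.

(* The rational function [y] in the proof is a creative-telescoping (Gosper) certificate. *)
Lemma hyp_sum_step (F : realFieldType) (c : F) K : regular c -> hyp_term (c - 2) K = 0 ->
  16 * (3 * c - 1) * hyp_sum (c - 2) K = 27 * (3 * c - 2) * hyp_sum c K.
Proof.
move=> hc hK; have [c0 hreg] := hc.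
have nz (d : F) : d > 0 -> c - d != 0 by move=> d0; rewrite lt_eqF //; lra.
have n2 : c - 2 != 0 by apply: nz; lra.
have n1 : c - 1 != 0 by apply: nz; lra.
have n53' : 3 * c - 5 != 0 by rewrite lt_eqF //; lra.
have n23' : 3 * c - 2 != 0 by rewrite lt_eqF //; lra.
pose y k : F := ((- (592 / 9) + 1696 / 9 * c - 164 * c ^+ 2 + 44 * c ^+ 3)
   + (40 - 260 / 3 * c + 40 * c ^+ 2) * k + (12 * c - 8) * k ^+ 2)
   * (3 * c - 1) / ((c - 2) * (c - 1) * (c - 5 / 3) * (c - 2 / 3)).
(* The factor [k%:R] kills [G] at 0 and the termination hypothesis kills it at [K], so no boundary
   term survives. *)
pose G k := k%:R * y k%:R * hyp_term (c - 2) k.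
have := sum_telescope G K.
have GK : G K = 0 by rewrite /G hK mulr0.
have G0 : G 0%N = 0 by rewrite /G !mul0r.
rewrite GK G0 subr0 => tel.
apply: subr0_eq; rewrite /hyp_sum !mulr_sumr -sumrB.
rewrite -[RHS]tel; clear tel GK G0.
apply: eq_bigr => k _; rewrite /G hyp_termS; last first.
  have := hreg k; rewrite (_ : (3 * (c - 2) + 5) / 6 = (3 * c - 1) / 6) //.
  by field.
rewrite (hyp_term_shift k hc) (_ : (3 * (c - 2) + 5) / 6 = (3 * c - 1) / 6); last by field.
have k1 : k.+1%:R = 1 + k%:R :> F by rewrite -addn1 natrD addrC.
have k10 : 1 + k%:R != 0 :> F by rewrite -k1 pnatr_eq0.
rewrite k1 /y.
have ek := hreg k.
have ek' : 3 * c - 1 + 6 * k%:R != 0.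
  apply: contra ek => /eqP h; apply/eqP; transitivity ((3 * c - 1 + 6 * k%:R) / 6); last by rewrite h mul0r.
  by move: (k%:R) => x; field.
move: (k%:R) (hyp_term _ _) k10 ek ek' => x t k10 ek ek'.
field.
by rewrite ?(mulrC c 3) ?(mulrC x 6) ?n2 ?n1 ?n53' ?n23' ?k10 ?ek'.
Qed.

Lemma hyp_wsum_step (F : realFieldType) (c : F) K : regular c -> hyp_term (c - 2) K = 0 ->
  16 * (3 * c - 1) * hyp_wsum (c - 2) K = 27 * (3 * c - 6) * hyp_wsum c K.
Proof.
move=> hc hK; have [c0 hreg] := hc.
have nz (d : F) : d > 0 -> c - d != 0 by move=> d0; rewrite lt_eqF //; lra.
have n2 : c - 2 != 0 by apply: nz; lra.
have n1 : c - 1 != 0 by apply: nz; lra.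
have n53' : 3 * c - 5 != 0 by rewrite lt_eqF //; lra.
have n23' : 3 * c - 2 != 0 by rewrite lt_eqF //; lra.
(* A Gosper certificate again, of one degree more in [k] to match the linear weight. *)
pose y k : F := ((2864 / 9 - 848 * c + 7132 / 9 * c ^+ 2 - 312 * c ^+ 3 + 44 * c ^+ 4)
   + (- (1928 / 3) + 3860 / 3 * c - 2480 / 3 * c ^+ 2 + 172 * c ^+ 3) * k
   + (368 - 448 * c + 132 * c ^+ 2) * k ^+ 2 + (36 * c - 72) * k ^+ 3)
   * (3 * c - 1) / ((c - 2) * (c - 1) * (c - 5 / 3) * (c - 2 / 3)).
pose G k := k%:R * y k%:R * hyp_term (c - 2) k.
have := sum_telescope G K.
have GK : G K = 0 by rewrite /G hK mulr0.
have G0 : G 0%N = 0 by rewrite /G !mul0r.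
rewrite GK G0 subr0 => tel.
apply: subr0_eq; rewrite /hyp_wsum !mulr_sumr -sumrB.
rewrite -[RHS]tel; clear tel GK G0.
apply: eq_bigr => k _; rewrite /G hyp_termS; last first.
  have := hreg k; rewrite (_ : (3 * (c - 2) + 5) / 6 = (3 * c - 1) / 6) //.
  by field.
rewrite (hyp_term_shift k hc) (_ : (3 * (c - 2) + 5) / 6 = (3 * c - 1) / 6); last by field.
have k1 : k.+1%:R = 1 + k%:R :> F by rewrite -addn1 natrD addrC.
have k10 : 1 + k%:R != 0 :> F by rewrite -k1 pnatr_eq0.
rewrite k1 /y.
have ek := hreg k.
have ek' : 3 * c - 1 + 6 * k%:R != 0.
  apply: contra ek => /eqP h; apply/eqP; transitivity ((3 * c - 1 + 6 * k%:R) / 6); last by rewrite h mul0r.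
  by move: (k%:R) => x; field.
move: (k%:R) (hyp_term _ _) k10 ek ek' => x t k10 ek ek'.
field.
by rewrite ?(mulrC c 3) ?(mulrC x 6) ?n2 ?n1 ?n53' ?n23' ?k10 ?ek'.
Qed.

Lemma pochSl (R : pzRingType) (a : R) k : poch a k.+1 = a * poch (a + 1) k.
Proof.
rewrite /poch big_ord_recl addr0; congr (_ * _); apply: eq_bigr => i _.
by rewrite lift0 -addn1 natrD addrAC addrA.
Qed.

Lemma poch_nat_eq0 (R : pzRingType) m k : (m < k)%N -> poch (- m%:R : R) k = 0.
Proof.
elim: k => // k IH; rewrite ltnS leq_eqVlt pochS => /orP[/eqP->|/IH ->].
  by rewrite addNr mulr0.
by rewrite mul0r.
Qed.

(** A zero would give [6 k = 3 m + 1], impossible modulo 3; in [regular_third] the equation is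
    [6 k = 3 m + 2]. *)
Lemma regular_nat (F : realFieldType) m : regular (- m%:R : F).
Proof.
split=> [|k]; first by rewrite oppr_le0 ler0n.
apply/eqP => h.
have e : (6 * k)%:R = (3 * m + 1)%:R :> F.
  have -> : (6 * k)%:R = 6 * k%:R :> F by rewrite natrM.
  have -> : (3 * m + 1)%:R = 3 * m%:R + 1 :> F by rewrite natrD natrM.
  by move: (m%:R) (k%:R) h => x y h; lra.
by move/eqP: e; rewrite eqr_nat => /eqP; lia.
Qed.

Lemma regular_third (F : realFieldType) m : regular (- m%:R - 1 / 3 : F).
Proof.
split=> [|k]; first by have : 0 <= m%:R :> F by []; move: (m%:R) => x; lra.
apply/eqP => h.
have e : (6 * k)%:R = (3 * m + 2)%:R :> F.
  have -> : (6 * k)%:R = 6 * k%:R :> F by rewrite natrM.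
  have -> : (3 * m + 2)%:R = 3 * m%:R + 2 :> F by rewrite natrD natrM.
  by move: (m%:R) (k%:R) h => x y h; lra.
by move/eqP: e; rewrite eqr_nat => /eqP; lia.
Qed.

Lemma hyp_term_nat_eq0 (F : realFieldType) m k : (m < k)%N -> hyp_term (- m%:R : F) k = 0.
Proof. by move=> h; rewrite /hyp_term poch_nat_eq0 // !mul0r. Qed.

Lemma hyp_term_third_eq0 (F : realFieldType) m k :
  (m < k)%N -> hyp_term (- m%:R - 1 / 3 : F) k = 0.
Proof. by move=> h; rewrite /hyp_term subrK poch_nat_eq0 // mulr0 !mul0r. Qed.

Lemma poch_gt0 (F : realFieldType) (a : F) k : 0 < a -> 0 < poch a k.
Proof. by move=> a0; apply: prodr_gt0 => i _; rewrite ltr_wpDr. Qed.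

Lemma hyp_sum_nat (F : realFieldType) a K : (2 * a < K)%N ->
  hyp_sum (- (2 * a)%:R : F) K =
    (27 / 8) ^+ (2 * a) * poch (2 / 3) (2 * a) / poch ((2 * a)%:R / 2 + 1 / 2) (2 * a).
Proof.
elim: a => [|a IH] hK.
  rewrite muln0 !poch0 expr0 oppr0 /hyp_sum; case: K hK => // K _.
  rewrite big_ord_recl hyp_term0 big1 ?addr0; first by field.
  by move=> i _; have := @hyp_term_nat_eq0 F 0 (lift ord0 i) isT; rewrite oppr0.
have hc := @regular_nat F (2 * a).
have e : - (2 * a.+1)%:R = - (2 * a)%:R - 2 :> F by rewrite mulnS natrD; ring.
have := hyp_sum_step hc; rewrite -e => /(_ K (hyp_term_nat_eq0 F hK)).
rewrite {}IH; last by lia.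
set X := hyp_sum _ _; rewrite mulnS 2!pochS 2!exprS.
have e2 : (2 * a)%:R = 2 * a%:R :> F by rewrite natrM.
have e3 : (2 + 2 * a)%:R = 2 + 2 * a%:R :> F by rewrite natrD e2.
have e4 : (2 * a).+1%:R = 2 * a%:R + 1 :> F by rewrite -addn1 natrD e2.
rewrite e2 e3 e4.
have a0 : 0 <= a%:R :> F by [].
(* From [a] to [a + 1] the denominator symbol grows by two in length and by one in its base;
   [poch_shift] brings it back to the old base. *)
have h := poch_shift ((2 * a%:R) / 2 + 1 / 2 : F) (2 + 2 * a).
rewrite (_ : (2 + 2 * a%:R) / 2 + 1 / 2 = 2 * a%:R / 2 + 1 / 2 + 1); last by field.
rewrite !(pochS (2 * a%:R / 2 + 1 / 2)) e2 e3 e4 in h.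
have nx : 2 * a%:R / 2 + 1 / 2 != 0 :> F by rewrite gt_eqF //; lra.
have -> : poch (2 * a%:R / 2 + 1 / 2 + 1) (2 + 2 * a) =
  (2 * a%:R / 2 + 1 / 2)^-1 * (poch (2 * a%:R / 2 + 1 / 2) (2 * a)
   * (2 * a%:R / 2 + 1 / 2 + 2 * a%:R)
   * (2 * a%:R / 2 + 1 / 2 + (2 * a%:R + 1))
   * (2 * a%:R / 2 + 1 / 2 + (2 + 2 * a%:R))) :> F.
  by rewrite -h mulKf.
have pp : poch (2 * a%:R / 2 + 1 / 2) (2 * a) != 0 :> F.
  by rewrite gt_eqF // poch_gt0 //; lra.
move: (a%:R) a0 nx pp => x x0 nx.
move: (poch _ _) (poch _ _) (_ ^+ _) => P Q E pp hX.
have n1 : 16 * (3 * - (2 * x) - 1) != 0 by rewrite lt_eqF //; lra.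
apply: (mulfI n1); rewrite hX.
have n2 : 3 * x + 1 / 2 != 0 by rewrite gt_eqF //; lra.
field.
by rewrite ?pp !gt_eqF //; lra.
Qed.

(** At parameter 0 only the term [k = 0] survives and its weight is 0; the recurrence propagates the
    zero. This is what makes [h] nilpotent when [p = 1] modulo 3. *)
Lemma hyp_wsum_nat (F : realFieldType) a K : (2 * a < K)%N ->
  hyp_wsum (- (2 * a)%:R : F) K = 0.
Proof.
elim: a => [|a IH] hK.
  rewrite muln0 oppr0 /hyp_wsum big1 // => -[[|k] hk] _ /=.
    by rewrite mulr0 addr0 mul0r.
  by have := @hyp_term_nat_eq0 F 0 k.+1 isT; rewrite oppr0 => ->; rewrite mulr0.
have hc := @regular_nat F (2 * a).
have e : - (2 * a.+1)%:R = - (2 * a)%:R - 2 :> F by rewrite mulnS natrD; ring.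
have := hyp_wsum_step hc; rewrite -e => /(_ K (hyp_term_nat_eq0 F hK)).
rewrite {}IH ?mulr0; last by lia.
have a0 : 0 <= (2 * a)%:R :> F by [].
by move=> /eqP; rewrite mulf_eq0 => /orP[|/eqP //]; rewrite lt_eqF //; lra.
Qed.

Lemma natr_fact_neq0 (F : realFieldType) n : (n`!)%:R != 0 :> F.
Proof. by rewrite pnatr_eq0 -lt0n fact_gt0. Qed.

Lemma fact3 (R : comPzRingType) m :
  ((3 * m.+1)`!)%:R = ((3 * m)`!)%:R * (3 * m%:R + 1) * (3 * m%:R + 2) * (3 * m%:R + 3) :> R.
Proof.
have e0 : (3 * m)%:R = 3 * m%:R :> R by rewrite natrM.
have e1 : (3 * m).+1%:R = 3 * m%:R + 1 :> R by rewrite -addn1 natrD e0.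
have e2 : (3 * m).+2%:R = 3 * m%:R + 2 :> R by rewrite -addn2 natrD e0.
have e3 : (3 * m).+3%:R = 3 * m%:R + 3 :> R by rewrite -addn3 natrD e0.
rewrite mulnS !addSn add0n !factS (natrM _ (3 * m).+3) (natrM _ (3 * m).+2) (natrM _ (3 * m).+1).
by rewrite e1 e2 e3; ring.
Qed.

Lemma hyp_sum_third (F : realFieldType) m K : (2 * m < K)%N ->
  hyp_sum (- (2 * m)%:R - 1 / 3 : F) K =
    (27 / 8) ^+ (2 * m) * ((2 * m)`!)%:R * poch (2 / 3) m / ((3 * m)`!)%:R.
Proof.
elim: m => [|m IH] hK.
  rewrite !muln0 !poch0 expr0 fact0 /hyp_sum; case: K hK => // K _.
  rewrite big_ord_recl hyp_term0 big1 ?addr0; first by field.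
  by move=> i _; apply: (@hyp_term_third_eq0 F 0).
have hc := @regular_third F (2 * m).
have e : - (2 * m.+1)%:R - 1 / 3 = - (2 * m)%:R - 1 / 3 - 2 :> F by rewrite mulnS natrD; ring.
have := hyp_sum_step hc; rewrite -e => /(_ K (hyp_term_third_eq0 F hK)).
rewrite {}IH; last by lia.
have f0 := natr_fact_neq0 F (3 * m).
set X := hyp_sum _ _; rewrite fact3 mulnS 2!exprS pochS !addSn add0n 2!factS (natrM _ (2 * m).+2) (natrM _ (2 * m).+1).
have e2 : (2 * m)%:R = 2 * m%:R :> F by rewrite natrM.
have e4 : (2 * m).+1%:R = 2 * m%:R + 1 :> F by rewrite -addn1 natrD e2.
have e5 : (2 * m).+2%:R = 2 * m%:R + 2 :> F by rewrite -addn2 natrD e2.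
rewrite e2 e4 e5.
have a0 : 0 <= m%:R :> F by [].
move: (m%:R) (((3 * m)`!)%:R) a0 f0 (((2 * m)`!)%:R) (poch _ _) (_ ^+ _) => x f x0 f0 f2 P E hX.
have n1 : 16 * (3 * (- (2 * x) - 1 / 3) - 1) != 0 by rewrite lt_eqF //; lra.
apply: (mulfI n1); rewrite hX; field.
by rewrite f0 !gt_eqF //; lra.
Qed.

Lemma hyp_wsum_third (F : realFieldType) m K : (2 * m < K)%N ->
  hyp_wsum (- (2 * m)%:R - 1 / 3 : F) K =
    - (1 / 3) * (27 / 8) ^+ (2 * m) * (m`!)%:R * poch (4 / 3) (2 * m) / ((3 * m)`!)%:R.
Proof.
elim: m => [|m IH] hK.
  rewrite !muln0 !poch0 expr0 fact0 /hyp_wsum; case: K hK => // K _.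
  rewrite big_ord_recl hyp_term0 big1 ?addr0; first by rewrite /=; field.
  by move=> i _; rewrite (@hyp_term_third_eq0 F 0) ?mulr0.
have hc := @regular_third F (2 * m).
have e : - (2 * m.+1)%:R - 1 / 3 = - (2 * m)%:R - 1 / 3 - 2 :> F by rewrite mulnS natrD; ring.
have := hyp_wsum_step hc; rewrite -e => /(_ K (hyp_term_third_eq0 F hK)).
rewrite {}IH; last by lia.
have f0 := natr_fact_neq0 F (3 * m).
set X := hyp_wsum _ _; rewrite fact3 mulnS 2!exprS !addSn add0n 2!pochS factS (natrM _ m.+1).
have e2 : (2 * m)%:R = 2 * m%:R :> F by rewrite natrM.
have e4 : (2 * m).+1%:R = 2 * m%:R + 1 :> F by rewrite -addn1 natrD e2.
rewrite e2 e4 -[m.+1]addn1 natrD.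
have a0 : 0 <= m%:R :> F by [].
move: (m%:R) (((3 * m)`!)%:R) a0 f0 ((m`!)%:R) (poch _ _) (_ ^+ _) => x f x0 f0 f2 P E hX.
have n1 : 16 * (3 * (- (2 * x) - 1 / 3) - 1) != 0 by rewrite lt_eqF //; lra.
apply: (mulfI n1); rewrite hX; field.
by rewrite f0 !gt_eqF //; lra.
Qed.

Lemma hyp_term1 (F : realFieldType) (c : F) : (3 * c + 5) / 6 != 0 ->
  hyp_term c 1 = c * (c + 1 / 3) / ((3 * c + 5) / 6) * - (1 / 8).
Proof. by move=> h; rewrite hyp_termS ?hyp_term0 ?addr0 // mulr1 mul1r; ring. Qed.

(** At parameter [-4/3] the two terms are 1 and -1, and the recurrence propagates the zero. This is
    what makes [g] nilpotent when [p = 2] modulo 3. *)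
Lemma hyp_sum_third_odd (F : realFieldType) b K : (2 * b + 1 < K)%N ->
  hyp_sum (- (2 * b + 1)%:R - 1 / 3 : F) K = 0.
Proof.
elim: b => [|b IH] hK.
  rewrite /hyp_sum; case: K hK => [|[|K]] // _.
  rewrite 2!big_ord_recl hyp_term0 /= /bump /= add1n.
  rewrite big1 => [|i _]; last by rewrite (@hyp_term_third_eq0 F 1).
  by rewrite hyp_term1; [field|apply/eqP; lra].
have hc := @regular_third F (2 * b + 1).
have e : - (2 * b.+1 + 1)%:R - 1 / 3 = - (2 * b + 1)%:R - 1 / 3 - 2 :> F.
  by rewrite mulnS !natrD; ring.
have := hyp_sum_step hc; rewrite -e => /(_ K (hyp_term_third_eq0 F hK)).
rewrite {}IH ?mulr0; last by lia.
have a0 : 0 <= (2 * b + 1)%:R :> F by [].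
by move=> /eqP; rewrite mulf_eq0 => /orP[|/eqP //]; rewrite lt_eqF //; lra.
Qed.

Lemma hyp_wsum_third_odd (F : realFieldType) b K : (2 * b + 1 < K)%N ->
  hyp_wsum (- (2 * b + 1)%:R - 1 / 3 : F) K =
    - ((27 / 8) ^+ (2 * b + 1) * poch (4 / 3) (2 * b + 1) / poch (b%:R + 3 / 2) (2 * b + 1)).
Proof.
elim: b => [|b IH] hK.
  rewrite /hyp_wsum; case: K hK => [|[|K]] // _.
  rewrite 2!big_ord_recl hyp_term0 /= /bump /= add1n.
  rewrite big1 => [|i _]; last by rewrite (@hyp_term_third_eq0 F 1) ?mulr0.
  rewrite hyp_term1; last by apply/eqP; lra.
  by rewrite !pochS !poch0 expr1; field.
have hc := @regular_third F (2 * b + 1).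
have e : - (2 * b.+1 + 1)%:R - 1 / 3 = - (2 * b + 1)%:R - 1 / 3 - 2 :> F.
  by rewrite mulnS !natrD; ring.
have := hyp_wsum_step hc; rewrite -e => /(_ K (hyp_term_third_eq0 F hK)).
rewrite {}IH; last by lia.
set X := hyp_wsum _ _.
have e2 : (2 * b + 1)%:R = 2 * b%:R + 1 :> F by rewrite natrD natrM.
have e3 : (2 * b + 1).+1%:R = 2 * b%:R + 2 :> F by rewrite -addn1 natrD e2; ring.
have e4 : (2 * b + 1).+2%:R = 2 * b%:R + 3 :> F by rewrite -addn2 natrD e2; ring.
have a0 : 0 <= b%:R :> F by [].
have h := poch_shift (b%:R + 3 / 2 : F) (2 * b + 1).+2.
rewrite !(pochS (b%:R + 3 / 2)) e2 e3 e4 in h.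
have nx : b%:R + 3 / 2 != 0 :> F by rewrite gt_eqF //; lra.
have pp : poch (b%:R + 3 / 2) (2 * b + 1) != 0 :> F.
  by rewrite gt_eqF // poch_gt0 //; lra.
rewrite (_ : (2 * b.+1 + 1)%N = (2 * b + 1).+2); last by lia.
rewrite (_ : b.+1%:R + 3 / 2 = b%:R + 3 / 2 + 1); last by rewrite -addn1 natrD; ring.
move/(congr1 (fun z => (b%:R + 3 / 2)^-1 * z)): h; rewrite mulKf // => ->.
rewrite 2!exprS 2!(pochS (4 / 3)) e2 e3.
move: (b%:R) a0 nx pp => x x0 nx.
move: (poch _ _) (poch _ _) (_ ^+ _) => P Q E pp hX.
have n1 : 16 * (3 * (- (2 * x + 1) - 1 / 3) - 1) != 0 by rewrite lt_eqF //; lra.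
apply: (mulfI n1); rewrite hX; field.
by rewrite ?pp !gt_eqF //; lra.
Qed.

Lemma fact3p1 (R : comPzRingType) m :
  ((3 * m.+1 + 1)`!)%:R = ((3 * m + 1)`!)%:R * (3 * m%:R + 2) * (3 * m%:R + 3) * (3 * m%:R + 4) :> R.
Proof.
rewrite (_ : (3 * m.+1 + 1)%N = (3 * m + 1).+3); last by lia.
have e0 : (3 * m + 1)%:R = 3 * m%:R + 1 :> R by rewrite natrD natrM.
have e1 : (3 * m + 1).+1%:R = 3 * m%:R + 2 :> R by rewrite -addn1 natrD e0; ring.
have e2 : (3 * m + 1).+2%:R = 3 * m%:R + 3 :> R by rewrite -addn2 natrD e0; ring.
have e3 : (3 * m + 1).+3%:R = 3 * m%:R + 4 :> R by rewrite -addn3 natrD e0; ring.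
rewrite !factS (natrM _ (3 * m + 1).+3) (natrM _ (3 * m + 1).+2) (natrM _ (3 * m + 1).+1).
by rewrite e1 e2 e3; ring.
Qed.

Lemma hyp_sum_nat_odd (F : realFieldType) m K : (2 * m + 1 < K)%N ->
  hyp_sum (- (2 * m + 1)%:R : F) K =
    3 / 4 * (27 / 8) ^+ (2 * m) * (m`!)%:R * poch (5 / 3) (2 * m) / ((3 * m + 1)`!)%:R.
Proof.
elim: m => [|m IH] hK.
  rewrite /hyp_sum; case: K hK => [|[|K]] // _.
  rewrite 2!big_ord_recl hyp_term0 /= /bump /= add1n.
  rewrite big1 => [|i _]; last by rewrite (@hyp_term_nat_eq0 F 1).
  rewrite hyp_term1; last by apply/eqP; lra.
  by rewrite muln0 fact0 add0n (_ : 1`! = 1%N) // !poch0 expr0; field.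
have hc := @regular_nat F (2 * m + 1).
have e : - (2 * m.+1 + 1)%:R = - (2 * m + 1)%:R - 2 :> F.
  by rewrite mulnS !natrD; ring.
have := hyp_sum_step hc; rewrite -e => /(_ K (hyp_term_nat_eq0 F hK)).
rewrite {}IH; last by lia.
set X := hyp_sum _ _.
have f0 := natr_fact_neq0 F (3 * m + 1).
rewrite fact3p1 mulnS 2!exprS !addSn add0n 2!pochS factS (natrM _ m.+1).
have e1 : (2 * m)%:R = 2 * m%:R :> F by rewrite natrM.
have e2 : (2 * m + 1)%:R = 2 * m%:R + 1 :> F by rewrite natrD natrM.
have e4 : (2 * m).+1%:R = 2 * m%:R + 1 :> F by rewrite -addn1.
rewrite e2 e4 e1 -[m.+1]addn1 natrD.
have a0 : 0 <= m%:R :> F by [].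
move: (m%:R) (((3 * m + 1)`!)%:R) a0 f0 ((m`!)%:R) (poch _ _) (_ ^+ _) => x f x0 f0 f2 P E hX.
have n1 : 16 * (3 * - (2 * x + 1) - 1) != 0 by rewrite lt_eqF //; lra.
apply: (mulfI n1); rewrite hX; field.
by rewrite f0 !gt_eqF //; lra.
Qed.

Lemma hyp_wsum_nat_odd (F : realFieldType) m K : (2 * m + 1 < K)%N ->
  hyp_wsum (- (2 * m + 1)%:R : F) K =
    - (3 / 2) * (27 / 8) ^+ (2 * m) * ((2 * m + 1)`!)%:R * poch (4 / 3) m / ((3 * m + 1)`!)%:R.
Proof.
elim: m => [|m IH] hK.
  rewrite /hyp_wsum; case: K hK => [|[|K]] // _.
  rewrite 2!big_ord_recl hyp_term0 /= /bump /= add1n.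
  rewrite big1 => [|i _]; last by rewrite (@hyp_term_nat_eq0 F 1) ?mulr0.
  rewrite hyp_term1; last by apply/eqP; lra.
  by rewrite !muln0 add0n (_ : 1`! = 1%N) // !poch0 expr0; field.
have hc := @regular_nat F (2 * m + 1).
have e : - (2 * m.+1 + 1)%:R = - (2 * m + 1)%:R - 2 :> F.
  by rewrite mulnS !natrD; ring.
have := hyp_wsum_step hc; rewrite -e => /(_ K (hyp_term_nat_eq0 F hK)).
rewrite {}IH; last by lia.
set X := hyp_wsum _ _.
have f0 := natr_fact_neq0 F (3 * m + 1).
rewrite fact3p1 (_ : (2 * m.+1 + 1)%N = (2 * m + 1).+2); last by lia.
rewrite mulnS 2!exprS pochS 2!factS (natrM _ (2 * m + 1).+2) (natrM _ (2 * m + 1).+1).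
have e2 : (2 * m + 1)%:R = 2 * m%:R + 1 :> F by rewrite natrD natrM.
have e3 : (2 * m + 1).+1%:R = 2 * m%:R + 2 :> F by rewrite -addn1 natrD e2; ring.
have e4 : (2 * m + 1).+2%:R = 2 * m%:R + 3 :> F by rewrite -addn2 natrD e2; ring.
rewrite e2 e3 e4.
have a0 : 0 <= m%:R :> F by [].
move: (m%:R) (((3 * m + 1)`!)%:R) a0 f0 (((2 * m + 1)`!)%:R) (poch _ _) (_ ^+ _) => x f x0 f0 f2 P E hX.
have n1 : 16 * (3 * - (2 * x + 1) - 1) != 0 by rewrite lt_eqF //; lra.
apply: (mulfI n1); rewrite hX; field.
by rewrite f0 !gt_eqF //; lra.
Qed.

(** * A Clausen formula for truncated series *)

Definition cf2 (k : nat) : nat := 'C(k.*2, k) * 'C(3 * k, k).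
Definition cf3 (k : nat) : nat := 'C(k.*2, k) ^ 2 * 'C(3 * k, k).

Lemma central_fact k : ('C(k.*2, k) * (k`! * k`!) = k.*2`!)%N.
Proof.
have /bin_fact : (k <= k.*2)%N by rewrite -addnn leq_addr.
by rewrite (_ : k.*2 - k = k)%N // -addnn addnK.
Qed.

Lemma cf2_fact k : (cf2 k * (k`! * k`! * k`!) = (3 * k)`!)%N.
Proof.
have /bin_fact : (k <= 3 * k)%N by lia.
rewrite (_ : (3 * k - k = k.*2)%N); last by lia.
by rewrite -central_fact /cf2; lia.
Qed.

Lemma fact_mul3S k : ((3 * k.+1)`! = (3 * k).+3 * ((3 * k).+2 * ((3 * k).+1 * (3 * k)`!)))%N.
Proof. by rewrite mulnS !addSn add0n !factS. Qed.

Lemma centralS k : ('C(k.+1.*2, k.+1) * k.+1 = 2 * (2 * k + 1) * 'C(k.*2, k))%N.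
Proof.
have := central_fact k.+1; rewrite doubleS (factS k.*2.+1) (factS k.*2) -central_fact => h.
have f0 := fact_gt0 k.
have g0 : (0 < k.+1 * (k`! * k`!))%N by rewrite !muln_gt0 f0.
apply/eqP; rewrite -(eqn_pmul2r g0); apply/eqP.
move: h; rewrite factS.
rewrite -[k.*2.+2]addn2 -[k.*2.+1]addn1 -mul2n -[k.+1]addn1.
move: (k`!) ('C(2 * k, k)) ('C(_, _)) => f b b' h.
transitivity (b' * ((k + 1) * f * ((k + 1) * f)))%N; first by ring.
by rewrite h; ring.
Qed.

Lemma cf2S k : (cf2 k.+1 * (k + 1) ^ 2 = 3 * (3 * k + 1) * (3 * k + 2) * cf2 k)%N.
Proof.
have := cf2_fact k.+1; rewrite fact_mul3S -cf2_fact !factS => h.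
have f0 := fact_gt0 k.
have g0 : (0 < k.+1 * (k`! * k`! * k`!))%N by rewrite !muln_gt0 f0.
apply/eqP; rewrite -(eqn_pmul2r g0); apply/eqP; move: h.
rewrite -[(3 * k).+3]addn3 -[(3 * k).+2]addn2 -[(3 * k).+1]addn1 -[k.+1 in X in X -> _]addn1 -[k.+1 in X in _ -> X]addn1.
move: (cf2 _) (cf2 k) (k`!) => b b' f h.
have -> : ((b * (k + 1) ^ 2 * ((k + 1) * (f * f * f))) = b * ((k + 1) * f * ((k + 1) * f) * ((k + 1) * f)))%N by ring.
rewrite h; ring.
Qed.

Lemma cf3S k : (cf3 k.+1 * (k + 1) ^ 3 = 6 * (2 * k + 1) * (3 * k + 1) * (3 * k + 2) * cf3 k)%N.
Proof.
have e j : (cf3 j = 'C(j.*2, j) * cf2 j)%N by rewrite /cf3 /cf2 -mulnn mulnA.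
rewrite !e.
transitivity (('C(k.+1.*2, k.+1) * k.+1) * (cf2 k.+1 * (k + 1) ^ 2))%N.
  by rewrite addn1; ring.
by rewrite centralS cf2S; ring.
Qed.

Section Theta.
Variable R : comNzRingType.
Implicit Types P Q : {poly R}.

(** The Euler operator turns recurrences between coefficients into differential equations. It is
    locked so that [ring] treats [theta P] as an atom. *)
Definition theta P : {poly R} := locked ('X * P^`()).

Lemma thetaE P : theta P = 'X * P^`().
Proof. by rewrite /theta -lock. Qed.


Lemma thetaD P Q : theta (P + Q) = theta P + theta Q.
Proof. by rewrite !thetaE derivD mulrDr. Qed.
Lemma thetaN P : theta (- P) = - theta P.
Proof. by rewrite !thetaE derivN mulrN. Qed.
Lemma thetaM P Q : theta (P * Q) = theta P * Q + P * theta Q.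
Proof. by rewrite !thetaE derivM; ring. Qed.
Lemma theta_nat n : theta n%:R = 0.
Proof. by rewrite thetaE -polyC_natr derivC mulr0. Qed.
Lemma thetaX : theta 'X = 'X.
Proof. by rewrite !thetaE derivX mulr1. Qed.
Lemma thetaXn n : theta 'X^n = n%:R * 'X^n.
Proof.
elim: n => [|n IH]; first by rewrite expr0 -[1]/(1%:R) theta_nat mul0r.
by rewrite exprS thetaM thetaX IH -addn1 natrD; ring.
Qed.
Lemma theta0 : theta 0 = 0. Proof. exact: (theta_nat 0). Qed.
Lemma theta1 : theta 1 = 0. Proof. exact: (theta_nat 1). Qed.

Definition thetaS := (theta_nat, theta0, theta1, thetaX, thetaXn, thetaD, thetaN, thetaM).

(** This is [theta^2 - 3 X (3 theta + 1) (3 theta + 2)], the recurrence [cf2S] in operator form. *)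
Definition hyp_op P : {poly R} :=
  (1 - 27 * 'X) * theta (theta P) - 27 * 'X * theta P - 6 * 'X * P.

(** On the square of a solution [y] of [hyp_op y = 0] this equals [2 (1 - 27 X) (theta y)^2]; one
    further derivative closes the system at order three. *)
Definition symsq_aux P : {poly R} :=
  (1 - 27 * 'X) * theta (theta P) - 27 * 'X * theta P - 12 * 'X * P.

(* Annihilates the square of any solution of [hyp_op P = 0]. *)
Definition symsq_op P : {poly R} :=
  (1 - 27 * 'X) * theta (symsq_aux P) - 27 * 'X * symsq_aux P
  - 12 * 'X * (1 - 27 * 'X) * theta P.

Lemma hyp_opD P Q : hyp_op (P + Q) = hyp_op P + hyp_op Q.
Proof. by rewrite /hyp_op !thetaS; ring. Qed.

Lemma symsq_opB P Q : symsq_op (P - Q) = symsq_op P - symsq_op Q.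
Proof. by rewrite /symsq_op /symsq_aux !thetaS; ring. Qed.

Lemma symsq_opD P Q : symsq_op (P + Q) = symsq_op P + symsq_op Q.
Proof. by rewrite /symsq_op /symsq_aux !thetaS; ring. Qed.

Definition poly2 K : {poly R} := \sum_(k < K) (cf2 k)%:R * 'X^k.
Definition poly3 K : {poly R} := \sum_(k < K) (cf3 k)%:R * ('X - 27 * 'X ^+ 2) ^+ k.

(** The recurrence cancels every coefficient except the one created by the truncation. *)
Lemma hyp_op_poly2 K : hyp_op (poly2 K) = - (K%:R ^+ 2 * (cf2 K)%:R * 'X^K).
Proof.
elim: K => [|K IH]; first by rewrite /poly2 big_ord0 /hyp_op !thetaS; ring.
have -> : poly2 K.+1 = poly2 K + (cf2 K)%:R * 'X^K by rewrite /poly2 big_ord_recr.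
rewrite hyp_opD IH /hyp_op !thetaS (exprS _ K).
have : (cf2 K.+1)%:R * (K%:R + 1) ^+ 2 = 3 * (3 * K%:R + 1) * (3 * K%:R + 2) * (cf2 K)%:R :> {poly R}.
  have := congr1 (fun n => n%:R : {poly R}) (cf2S K).
  by rewrite natrM natrX (natrD _ K) => ->; rewrite !natrM (natrD _ (3 * K) 1) (natrD _ (3 * K) 2) natrM.
have -> : K.+1%:R = K%:R + 1 :> {poly R} by rewrite -addn1 natrD.
move: (K%:R) (cf2 K.+1)%:R (cf2 K)%:R 'X^K => x a b y h.
have -> : (x + 1) ^+ 2 * a = a * (x + 1) ^+ 2 by ring.
by rewrite h; ring.
Qed.

Lemma symsq_op_sqr P : symsq_op (P ^+ 2) =
  4 * (1 - 27 * 'X) * theta P * hyp_op P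
  + 2 * (1 - 27 * 'X) * theta (P * hyp_op P) - 54 * 'X * P * hyp_op P.
Proof. by rewrite /symsq_op /symsq_aux /hyp_op expr2 !thetaS; ring. Qed.

(** Logarithmic derivative of [X (1 - 27 X)], with the denominator [1 - 27 X] cleared because it is
    not invertible among polynomials; the later identities carry the same factor. *)
Lemma theta_quad k : (1 - 27 * 'X) * theta (('X - 27 * 'X ^+ 2) ^+ k)
  = k%:R * (1 - 54 * 'X) * ('X - 27 * 'X ^+ 2) ^+ k.
Proof.
have tW : theta ('X - 27 * 'X ^+ 2) = 'X - 54 * 'X ^+ 2 by rewrite !thetaS; ring.
elim: k => [|k IH]; first by rewrite expr0 !thetaS; ring.
have kS : k.+1%:R = k%:R + 1 :> {poly R} by rewrite -addn1 natrD.
rewrite (exprS _ k) thetaM tW kS.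
move: IH; move: (('X - 27 * 'X ^+ 2) ^+ k) => w; move: (theta w) => t IH.
transitivity ((1 - 27 * 'X) * ('X - 54 * 'X ^+ 2) * w + ('X - 27 * 'X ^+ 2) * ((1 - 27 * 'X) * t)); first by ring.
by rewrite IH; ring.
Qed.

(** In the variable [W = X - 27 X^2] the operator becomes, up to a factor, [theta_W^3 - 6 W (2
    theta_W + 1) (3 theta_W + 1) (3 theta_W + 2)], which encodes the recurrence [cf3S]. *)
Lemma symsq_op_quad k : (1 - 27 * 'X) * symsq_op (('X - 27 * 'X ^+ 2) ^+ k) =
  (1 - 54 * 'X) * (k%:R ^+ 3 * ('X - 27 * 'X ^+ 2) ^+ k
     - 6 * (2 * k%:R + 1) * (3 * k%:R + 1) * (3 * k%:R + 2) * ('X - 27 * 'X ^+ 2) ^+ k.+1).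
Proof.
rewrite (exprS _ k); move: (theta_quad k); move: (('X - 27 * 'X ^+ 2) ^+ k) => w h1.
move: (k%:R) (theta_nat k) h1 => x tx h1.
have h2 : (1 - 27 * 'X) * theta (theta w)
    = 27 * 'X * theta w + x * ((1 - 54 * 'X) * theta w - 54 * 'X * w).
  have := congr1 theta h1; rewrite !(thetaS, tx) => /eqP; rewrite -subr_eq0 => /eqP h2.
  by apply: subr0_eq; rewrite -[RHS]h2; ring.
have h3 : (1 - 27 * 'X) * theta (theta (theta w))
    = 54 * 'X * theta (theta w) + 27 * 'X * theta w
      + x * ((1 - 54 * 'X) * theta (theta w) - 108 * 'X * theta w - 54 * 'X * w).
  have := congr1 theta h2; rewrite !(thetaS, tx) => /eqP; rewrite -subr_eq0 => /eqP h3.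
  by apply: subr0_eq; rewrite -[RHS]h3; ring.
rewrite /symsq_op /symsq_aux !thetaS.
move: (theta (theta (theta w))) (theta (theta w)) (theta w) h1 h2 h3 => w3 w2 w1.
move: ('X : {poly R}) => X h1 h2 h3.
apply: subr0_eq; move: h1 h2 h3.
move/eqP; rewrite -subr_eq0 => /eqP; set e1 := (X in X = 0) => h1.
move/eqP; rewrite -subr_eq0 => /eqP; set e2 := (X in X = 0) => h2.
move/eqP; rewrite -subr_eq0 => /eqP; set e3 := (X in X = 0) => h3.
(* Elimination from the top: each multiplier removes the highest derivative of [w] still present. *)
transitivity ((1 - 27 * X) ^+ 2 * e3 + (1 - 27 * X) * (x * (1 - 54 * X) - 27 * X) * e2
  + ((1 - 27 * X) * (- 24 * X - 108 * x * X) + x ^+ 2 * (1 - 54 * X) ^+ 2) * e1).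
  by rewrite /e1 /e2 /e3; ring.
by rewrite h1 h2 h3; ring.
Qed.

Lemma symsq_op_poly3 K : (1 - 27 * 'X) * symsq_op (poly3 K) =
  - ((1 - 54 * 'X) * K%:R ^+ 3 * (cf3 K)%:R * ('X - 27 * 'X ^+ 2) ^+ K).
Proof.
have symsq0 : symsq_op 0 = 0 :> {poly R} by rewrite /symsq_op /symsq_aux !thetaS; ring.
have symsqN n P : symsq_op (n%:R * P) = n%:R * symsq_op P.
  by rewrite /symsq_op /symsq_aux !(thetaS, theta_nat); ring.
elim: K => [|K IH]; first by rewrite /poly3 big_ord0 symsq0; ring.
rewrite /poly3 big_ord_recr -/(poly3 K) /= symsq_opD mulrDr IH symsqN (mulrCA (1 - 27 * 'X) (cf3 K)%:R) symsq_op_quad.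
have : (cf3 K.+1)%:R * (K%:R + 1) ^+ 3 = 6 * (2 * K%:R + 1) * (3 * K%:R + 1) * (3 * K%:R + 2) * (cf3 K)%:R :> {poly R}.
  have := congr1 (fun n => n%:R : {poly R}) (cf3S K).
  by rewrite natrM natrX (natrD _ K) => ->; rewrite !natrM (natrD _ (2 * K) 1) (natrD _ (3 * K) 1) (natrD _ (3 * K) 2) !natrM.
have -> : K.+1%:R = K%:R + 1 :> {poly R} by rewrite -addn1 natrD.
rewrite (exprS _ K); move: (K%:R) (cf3 K.+1)%:R (cf3 K)%:R (('X - 27 * 'X ^+ 2) ^+ K) => x a b y h.
transitivity (- ((1 - 54 * 'X) * (a * (x + 1) ^+ 3) * (('X - 27 * 'X ^+ 2) * y))); last by ring.
by rewrite h; ring.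
Qed.
End Theta.

(** * Congruences modulo powers of X and Clausen's identity *)

Section DvX.
Variable R : comNzRingType.
Implicit Types P Q : {poly R}.

Definition dvX n P := exists Q, P = 'X^n * Q.

Lemma dvX0 n : dvX n 0.
Proof. by exists 0; rewrite mulr0. Qed.
Lemma dvXD n P Q : dvX n P -> dvX n Q -> dvX n (P + Q).
Proof. by move=> [A ->] [B ->]; exists (A + B); rewrite mulrDr. Qed.
Lemma dvXN n P : dvX n P -> dvX n (- P).
Proof. by move=> [A ->]; exists (- A); rewrite mulrN. Qed.
Lemma dvXl n P Q : dvX n P -> dvX n (P * Q).
Proof. by move=> [A ->]; exists (A * Q); rewrite mulrA. Qed.
Lemma dvXr n P Q : dvX n Q -> dvX n (P * Q).
Proof. by rewrite mulrC; exact: dvXl. Qed.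
Lemma dvX_theta n P : dvX n P -> dvX n (theta P).
Proof.
by move=> [A ->]; exists (n%:R * A + theta A); rewrite !thetaS; ring.
Qed.
Lemma dvX_le m n P : (m <= n)%N -> dvX n P -> dvX m P.
Proof. by move=> /subnK <- [Q ->]; rewrite addnC exprD -mulrA; eexists. Qed.

Lemma dvX_symsq_op n P : dvX n P -> dvX n (symsq_op P).
Proof.
move=> h; have h1 := dvX_theta h; have h2 := dvX_theta h1.
have h3 : dvX n (symsq_aux P) by do ?[apply: dvXD|apply: dvXN|apply: dvXr].
by do ?[apply: dvXD|apply: dvXN|apply: dvXr => //]; apply: dvX_theta.
Qed.

(** The indicial polynomial is [m^3]. Over the integers it vanishes only at [m = 0], so a solution
    is determined by its constant term. *)
Lemma symsq_op_mono m (a : R) :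
  exists Q, symsq_op (a%:P * 'X^m) = ((m%:R ^+ 3 * a)%:P : {poly R}) * 'X^m + 'X^(m.+1) * Q.
Proof.
have ta : theta a%:P = 0 by rewrite thetaE derivC mulr0.
rewrite polyCM polyC_exp polyC_natr /symsq_op /symsq_aux !(ta, thetaS) (exprS _ m).
pose q : {poly R} := 27 * m%:R ^+ 2 + 27 * m%:R + 12.
exists (a%:P * (- 27 * m%:R ^+ 3 - q * (m%:R + 1) - 27 * m%:R ^+ 2 - 12 * m%:R
   + 'X * (27 * q * (m%:R + 2) + 324 * m%:R))).
rewrite /q; ring.
Qed.
End DvX.

(** Both polynomials have constant term 1 (for [K > 0]) and are annihilated by the third-order
    operator up to order [K]. The coefficients of the difference vanish one after the other, as
    [m^3 a = 0] forces [a = 0] in the integers for [m > 0]. *)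
Lemma clausen_int K : dvX K (poly3 int K - poly2 int K ^+ 2).
Proof.
set E := _ - _.
have hE : dvX K ((1 - 27 * 'X) * symsq_op E).
  rewrite symsq_opB mulrBr symsq_op_poly3 symsq_op_sqr hyp_op_poly2.
  have hw : dvX K (('X - 27 * 'X ^+ 2) ^+ K : {poly int}).
    by exists ((1 - 27 * 'X) ^+ K); rewrite -exprMn; congr (_ ^+ _); ring.
  have h : dvX K (- (K%:R ^+ 2 * (cf2 K)%:R * 'X^K) : {poly int}).
    by apply/dvXN/dvXr; exists 1; rewrite mulr1.
  apply: dvXD; first exact/dvXN/dvXr.
  apply: dvXN; apply: dvXr; apply: dvXD; last exact/dvXN/dvXr.
  by apply: dvXD; [exact: dvXr|apply/dvXr/dvX_theta/dvXr].
case: (posnP K) => [->|K0]; first by exists E; rewrite expr0 mul1r.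
suff H m : (m < K)%N -> dvX m.+1 E by rewrite -(prednK K0); apply: H; rewrite prednK.
elim: m => [|m IH] hm.
  have c3 : dvX 1 (poly3 int K - 1).
    rewrite /poly3 -(prednK K0) big_ord_recl mulr1 addrAC subrr add0r.
    elim/big_ind: _ => [||i _]; [exact: dvX0|exact: dvXD|].
    rewrite lift0 exprS; apply/dvXr/dvXl.
    by exists (1 - 27 * 'X); rewrite expr1; ring.
  have c2 : dvX 1 (poly2 int K - 1).
    rewrite /poly2 -(prednK K0) big_ord_recl mulr1 addrAC subrr add0r.
    elim/big_ind: _ => [||i _]; [exact: dvX0|exact: dvXD|].
    by rewrite lift0 exprS; apply/dvXr/dvXl; exists 1; rewrite expr1 mulr1.
  rewrite (_ : E = poly3 int K - 1 - (poly2 int K - 1) * (poly2 int K + 1)).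
    by apply/dvXD => //; apply/dvXN/dvXl.
  by rewrite /E; ring.
have /IH [Q eQ] : (m < K)%N by exact: ltnW.
pose a := Q`_0; pose Q2 := drop_poly 1 Q.
have eQ2 : Q = a%:P + Q2 * 'X.
  rewrite -{1}(poly_take_drop 1 Q) expr1; congr (_ + _).
  by apply/polyP => i; rewrite coef_take_poly coefC ltnS leqn0; case: eqP => // ->.
have eE : E = a%:P * 'X^(m.+1) + 'X^(m.+2) * Q2.
  by rewrite eQ {1}eQ2 mulrDr (exprS _ m.+1); ring.
have [S eS] := symsq_op_mono m.+1 a.
have a0 : a = 0.
  have [U eU] : dvX m.+2 ((m.+1%:R ^+ 3 * a)%:P * 'X^(m.+1) : {poly int}).
    (* Isolates the lowest term of [(1 - 27 X) symsq_op E]; all the rest is divisible by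
       [X^(m+2)]. *)
    have -> : (m.+1%:R ^+ 3 * a)%:P * 'X^(m.+1) =
       (1 - 27 * 'X) * symsq_op E - (1 - 27 * 'X) * symsq_op ('X^(m.+2) * Q2)
       - 'X^(m.+2) * S + 27 * ('X^(m.+2) * S)
       + 27 * 'X^(m.+2) * (m.+1%:R ^+ 3 * a)%:P + 27 * 'X^(m.+2) * ('X - 1) * S :> {poly int}.
      by rewrite {1}eE symsq_opD eS (exprS _ m.+1); ring.
    have xx : dvX m.+2 ('X^(m.+2) : {poly int}) by exists 1; rewrite mulr1.
    apply: dvXD; last by apply/dvXl/dvXl/dvXr.
    apply: dvXD; last by apply/dvXl/dvXr.
    apply: dvXD; last by apply/dvXr/dvXl.
    apply: dvXD; last by apply/dvXN/dvXl.
    apply: dvXD; first by apply: (dvX_le hm).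
    by apply/dvXN/dvXr/dvX_symsq_op/dvXl.
  have := congr1 (fun P : {poly int} => P`_m.+1) eU.
  rewrite coefCM coefXn eqxx mulr1 coefXnM ltnSn => /eqP.
  by rewrite mulf_eq0 expf_eq0 pnatr_eq0 /= => /eqP.
by exists Q2; rewrite eE a0 mul0r add0r.
Qed.

(** * Divisibility of the coefficients and Clausen's identity modulo p^2 *)

Lemma prime_dvd_fact p n : prime p -> (p %| n`!)%N = (p <= n)%N.
Proof.
move=> hp; apply/idP/idP => [|h]; last by apply: dvdn_fact; rewrite prime_gt0.
apply: contraLR; rewrite -ltnNge; elim: n => [|n IH] h.
  by rewrite fact0 dvdn1 neq_ltn prime_gt1 ?orbT.
have := IH (ltnW h); rewrite factS Euclid_dvdM // negb_or => ->; rewrite andbT.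
by apply/negP => /(dvdn_leq (ltn0Sn n)); rewrite leqNgt h.
Qed.

Lemma coprime_pexp_fact p a k : prime p -> (k < p)%N -> coprime (p ^ a) k`!.
Proof. by move=> hp h; rewrite coprimeXl // prime_coprime // prime_dvd_fact // -ltnNge. Qed.

(** [cf2 k] is [(3 k)! / k!^3] with denominator prime to [p], so every multiple of [p] up to [3 k]
    contributes a factor [p]. *)
Lemma dvdn_cf2 p k : prime p -> (k < p)%N -> (p <= 3 * k)%N -> (p %| cf2 k)%N.
Proof.
move=> hp kp h; have := coprime_pexp_fact 1 hp kp; rewrite expn1 => c.
have : (p %| cf2 k * (k`! * k`! * k`!))%N by rewrite cf2_fact prime_dvd_fact.
by rewrite Gauss_dvdl // !coprimeMr c.
Qed.

Lemma dvdn_cf2_sqr p k : prime p -> (k < p)%N -> (2 * p <= 3 * k)%N -> (p ^ 2 %| cf2 k)%N.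
Proof.
move=> hp kp h; have c := coprime_pexp_fact 2 hp kp.
have d : (p ^ 2 %| (3 * k)`!)%N.
  apply: (@dvdn_trans (2 * p)`!); last by rewrite -(bin_fact h) dvdn_mull // dvdn_mulr.
  have /bin_fact <- : (p <= 2 * p)%N by lia.
  have -> : (2 * p - p = p)%N by lia.
  by rewrite dvdn_mull // -mulnn dvdn_mul // prime_dvd_fact.
by move: d; rewrite -cf2_fact Gauss_dvdl // !coprimeMr c.
Qed.

Lemma dvdn_cf3_sqr p k : prime p -> (k < p)%N -> (p <= 2 * k)%N -> (p ^ 2 %| cf3 k)%N.
Proof.
move=> hp kp h; have := coprime_pexp_fact 1 hp kp; rewrite expn1 => c.
rewrite dvdn_mulr // dvdn_exp2r //.
have : (p %| 'C(k.*2, k) * (k`! * k`!))%N by rewrite central_fact prime_dvd_fact // -mul2n.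
by rewrite Gauss_dvdl // !coprimeMr c.
Qed.

(** An abstract stand-in for [Z/p^2], so that its concrete arithmetic never unfolds. That [n%:R = 0]
    forces [p ^ 2] to divide [n] is assumed separately, where integers or rationals have to be
    recovered. *)
Definition mod_sqr (p : nat) (R : comUnitRingType) : Prop :=
  [/\ prime p, p%:R ^+ 2 = 0 :> R &
      forall n, ~~ (p %| n)%N -> (n%:R : R) \is a GRing.unit].

Section ModSqr.
Variables (p : nat) (R : comUnitRingType).
Hypothesis hR : mod_sqr p R.

Let hp : prime p. Proof. by case: hR. Qed.
Let p20 : p%:R ^+ 2 = 0 :> R. Proof. by case: hR. Qed.

Lemma natr_eq0_sqr n : (p ^ 2 %| n)%N -> n%:R = 0 :> R.
Proof. by move=> /dvdnP[m ->]; rewrite natrM natrX p20 mulr0. Qed.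

Lemma unit_lt n : (0 < n < p)%N -> (n%:R : R) \is a GRing.unit.
Proof.
case/andP=> n0 np; case: hR => _ _; apply.
by apply/negP => /(dvdn_leq n0); rewrite leqNgt np.
Qed.

Lemma map_intr_poly2 K : map_poly (intr : int -> R) (poly2 int K) = poly2 R K.
Proof.
rewrite /poly2 rmorph_sum; apply: eq_bigr => k _.
by rewrite rmorphM /= map_polyXn rmorph_nat.
Qed.

Lemma map_intr_poly3 K : map_poly (intr : int -> R) (poly3 int K) = poly3 R K.
Proof.
rewrite /poly3 rmorph_sum; apply: eq_bigr => k _.
have e : map_poly (intr : int -> R) ('X - 27 * 'X ^+ 2) = 'X - 27 * 'X ^+ 2.
  by rewrite rmorphB rmorphM /= map_polyX map_polyXn rmorph_nat.
by rewrite rmorphM rmorph_nat /= -e -rmorphXn.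
Qed.

Lemma size_sum_le (I : Type) (r : seq I) (P : pred I) (F : I -> {poly R}) n :
  (forall i, P i -> size (F i) <= n)%N -> (size (\sum_(i <- r | P i) F i)%R <= n)%N.
Proof.
move=> h; elim/big_ind: _ => //; first by rewrite size_poly0.
by move=> x y hx hy; apply: (leq_trans (size_polyD _ _)); rewrite geq_max hx.
Qed.

Lemma size_natr_XnM c n : (size (c%:R * 'X^n : {poly R})%R <= n.+1)%N.
Proof. by rewrite mulr_natl -scaler_nat (leq_trans (size_scale_leq _ _)) // size_polyXn. Qed.

(** A term has degree [2 k], and its coefficient vanishes in [R] as soon as [2 k] reaches [p]. *)
Lemma size_poly3_p : (size (poly3 R p) <= p)%N.
Proof.
apply: size_sum_le => k _; case: (leqP p (2 * k)) => h.
  rewrite -polyC_natr natr_eq0_sqr ?mul0r ?size_poly0 //.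
  exact: dvdn_cf3_sqr.
rewrite mulr_natl -scaler_nat (leq_trans (size_scale_leq _ _)) //.
apply: leq_trans (size_exp_leq _ _) _.
have : (size ('X - 27 * 'X ^+ 2 : {poly R})%R <= 3)%N.
  rewrite (leq_trans (size_polyD _ _)) // geq_max size_polyX size_polyN.
  exact: (size_natr_XnM 27 2).
by move: (size _) => s hs; nia.
Qed.

(** If [k + l >= p], either both indices are at least [p/3] and each coefficient gives a factor [p],
    or one index is at least [2 p / 3] and its coefficient gives [p^2]. *)
Lemma size_poly2_sqr_p : (size (poly2 R p ^+ 2)%R <= p)%N.
Proof.
rewrite expr2 /poly2 mulr_suml; apply: size_sum_le => k _.
rewrite mulr_sumr; apply: size_sum_le => l _.
rewrite mulrACA -natrM -exprD.
case: (leqP p (k + l)) => h; last exact: leq_trans (size_natr_XnM _ _) h.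
rewrite -polyC_natr natr_eq0_sqr ?mul0r ?size_poly0 //.
have hk := ltn_ord k; have hl := ltn_ord l.
case: (leqP p (3 * k)) => h1; case: (leqP p (3 * l)) => h2.
- by rewrite -mulnn dvdn_mul // dvdn_cf2.
- by rewrite dvdn_mulr // dvdn_cf2_sqr //; lia.
- by rewrite dvdn_mull // dvdn_cf2_sqr //; lia.
- by lia.
Qed.

(** Both sides have degree below [p], so the congruence modulo [X^p] is an equality of polynomials
    and can be evaluated at a point. *)
Lemma clausen_mod : poly3 R p = poly2 R p ^+ 2.
Proof.
have [Q eQ] := clausen_int p.
have := congr1 (map_poly (intr : int -> R)) eQ.
rewrite rmorphB rmorphXn /= map_intr_poly3 map_intr_poly2 rmorphM /= map_polyXn => e.
apply: subr0_eq; rewrite e.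
have := leq_trans (size_polyD (poly3 R p) (- (poly2 R p ^+ 2))) _.
move=> /(_ p); rewrite geq_max size_poly3_p size_polyN size_poly2_sqr_p e => /(_ isT) hs.
case: (eqVneq (map_poly (intr : int -> R) Q) 0) => [->|nz]; first by rewrite mulr0.
move: hs; rewrite mulrC size_mulXn // -[X in (_ <= X)%N]addn0 leq_add2l leqn0 size_poly_eq0.
by rewrite (negPf nz).
Qed.

(** * Evaluation at x = -1/216 *)

Section AtPoint.
Variables (x w : R).
Hypothesis p5 : (5 < p)%N.
Hypothesis hx : 216 * x = -1.
Hypothesis hw : 192 * w = -1.

Let u2 : (2 : R) \is a GRing.unit. Proof. by apply: unit_lt; lia. Qed.
Let u3 : (3 : R) \is a GRing.unit. Proof. by apply: unit_lt; lia. Qed.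

Definition gsum : R := \sum_(k < p) (cf2 k)%:R * x ^+ k.
Definition gwsum : R := \sum_(k < p) k%:R * (cf2 k)%:R * x ^+ k.
Definition qsum j : R := \sum_(k < p) k%:R ^+ j * (cf3 k)%:R * w ^+ k.

Lemma horner_quad : ('X - 27 * 'X ^+ 2).[x] = w.
Proof.
have -> : ('X - 27 * 'X ^+ 2).[x] = x - 27 * x ^+ 2.
  by rewrite -polyC_natr !hornerE.
have u8 : (8 * 216 : R) \is a GRing.unit.
  rewrite (_ : 8 * 216 = 2 ^+ 6 * 3 ^+ 3 :> R); last by ring.
  by rewrite unitrM !unitrX.
apply: (mulrI u8).
transitivity (8 * (216 * x) * (1 - 27 * x)); first by ring.
transitivity (9 * (192 * w)); last by ring.
rewrite hx hw; transitivity (- 8 + 216 * x : R); first by ring.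
by rewrite hx; ring.
Qed.

Lemma horner_poly2 : (poly2 R p).[x] = gsum.
Proof.
rewrite /poly2 horner_sum; apply: eq_bigr => k _.
by rewrite -polyC_natr !hornerE.
Qed.

Lemma horner_theta_poly2 : (theta (poly2 R p)).[x] = gwsum.
Proof.
have -> : theta (poly2 R p) = \sum_(k < p) k%:R * (cf2 k)%:R * 'X^k.
  rewrite /poly2; elim/big_rec2: _ => [|k a b _ <-]; first exact: theta0.
  by rewrite !thetaS; ring.
rewrite horner_sum; apply: eq_bigr => k _.
by rewrite -!polyC_natr !hornerE.
Qed.

Let P j : {poly R} := \sum_(k < p) k%:R ^+ j * (cf3 k)%:R * ('X - 27 * 'X ^+ 2) ^+ k.

Let horner_P j : (P j).[x] = qsum j.
Proof.
rewrite /P horner_sum; apply: eq_bigr => k _.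
by rewrite hornerM horner_exp horner_quad -natrX -natrM -polyC_natr hornerC natrM natrX.
Qed.

Let theta_P j : (1 - 27 * 'X) * theta (P j) = (1 - 54 * 'X) * P j.+1.
Proof.
rewrite /P mulr_sumr; elim/big_rec2: _ => [|k a b _ IH].
  by rewrite theta0 mulr0.
rewrite thetaD mulrDr IH; congr (_ + _).
rewrite -natrX -natrM thetaM theta_nat mul0r add0r mulrCA theta_quad natrM natrX (exprS _ j).
by ring.
Qed.

(** The derivative of Clausen's identity; at this point [1 - 27 x = 9/8] and [1 - 54 x = 5/4]. *)
Lemma qsum1_gsum : 5 * qsum 1 = 9 * (gsum * gwsum).
Proof.
have e0 : P 0 = poly2 R p ^+ 2.
  rewrite -clausen_mod /P /poly3; apply: eq_bigr => k _.
  by rewrite expr0 mul1r.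
have := theta_P 0; rewrite e0 expr2 thetaM => /(congr1 (fun q => 4 * q.[x])).
rewrite -!polyC_natr !(hornerM, hornerD, hornerN, hornerC, hornerX, horner_exp) horner_theta_poly2 horner_poly2 horner_P.
move: gsum gwsum (qsum 1) => g h q e.
apply: subr0_eq.
transitivity ((1 + 216 * x) * (q - g * h)
  - (4 * ((1 - 27 * x) * (h * g + g * h)) - 4 * ((1 - 54 * x) * q))); first by ring.
by rewrite e hx; ring.
Qed.

Lemma qsum2_gsum : 162 * gwsum ^+ 2 - 4 * gsum ^+ 2 = 18 * qsum 1 + 100 * qsum 2.
Proof.
have e0 : P 0 = poly2 R p ^+ 2.
  rewrite -clausen_mod /P /poly3; apply: eq_bigr => k _.
  by rewrite expr0 mul1r.
pose y := poly2 R p.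
have ode : (1 - 27 * 'X) * theta (theta y) = 27 * 'X * theta y + 6 * 'X * y.
  have := hyp_op_poly2 R p.
  (* The truncation defect carries the factor [p^2], so in [R] the truncated series satisfies its
     differential equation exactly. *)
  rewrite -natrX (_ : (p ^ 2)%:R = 0); last by rewrite -polyC_natr natr_eq0_sqr.
  rewrite !mul0r oppr0 /hyp_op -/y => h; apply: subr0_eq; rewrite -[RHS]h; ring.
have t1 := theta_P 0; have t2 := theta_P 1.
rewrite e0 -/y expr2 thetaM in t1.
have := congr1 (@theta R) t1; rewrite !thetaS => /(congr1 (fun q => (1 - 27 * 'X) * q)) t3.
have : 2 * (1 - 27 * 'X) ^+ 2 * theta y ^+ 2 + 12 * 'X * (1 - 27 * 'X) * y ^+ 2
   = - 54 * 'X * (1 - 27 * 'X) * P 1 + (1 - 54 * 'X) ^+ 2 * P 2.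
  transitivity ((1 - 27 * 'X) * (- (27 * 'X) * (theta y * y + y * theta y)
     + (1 - 27 * 'X) * (2 * theta y ^+ 2) + 2 * y * ((1 - 27 * 'X) * theta (theta y)))).
    by rewrite ode; ring.
  transitivity ((1 - 27 * 'X) * (- (54 * 'X) * P 1) + (1 - 54 * 'X) * ((1 - 27 * 'X) * theta (P 1))).
    by apply: subr0_eq; move/eqP: t3; rewrite -subr_eq0 => /eqP t3; rewrite -[RHS]t3; ring.
  by rewrite t2; ring.
move/(congr1 (fun q => 64 * q.[x])).
rewrite -!polyC_natr !(hornerM, hornerD, hornerN, hornerC, hornerX, horner_exp) horner_theta_poly2 horner_poly2 !horner_P.
move: gsum gwsum (qsum 1) (qsum 2) => g h q r e.
apply: subr0_eq; move/eqP: e; rewrite -subr_eq0 => /eqP e; rewrite -[RHS]e.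
apply: subr0_eq.
transitivity ((1 + 216 * x) * ((34 - 2 * 216 * x) * h ^+ 2 + (- 4 + 96 * x) * g ^+ 2
   + (- 18 + 432 * x) * q + (- 36 + 4 * 216 * x) * r)); last by rewrite hx; ring.
ring.
Qed.

Lemma cf3_last : (cf3 p.-1)%:R = 0 :> R.
Proof.
by rewrite natr_eq0_sqr // dvdn_cf3_sqr // ?prednK ?prime_gt0 //; move: p5; lia.
Qed.

(** Division of [(2 k + 1) (3 k + 1) (3 k + 2)] by [k + 1] leaves quotient [18 k^2 + 9 k + 4] and
    remainder -2. The remainder isolates the summand with [k + 1] in its denominator, so that its
    sum reduces to [qsum 0], [qsum 1] and [qsum 2]. *)
Lemma cf3_div (k : nat) : (k.+1 < p)%N ->
  (k.+1)%:R ^+ 2 * (cf3 k.+1)%:R =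
  6 * (18 * k%:R ^+ 2 + 9 * k%:R + 4) * (cf3 k)%:R - 12 * ((cf3 k)%:R / k.+1%:R) :> R.
Proof.
move=> hk; have u : (k.+1%:R : R) \is a GRing.unit by apply: unit_lt.
apply: (mulrI u).
have := congr1 (fun n => n%:R : R) (cf3S k).
have kS : k.+1%:R = k%:R + 1 :> R by rewrite -addn1 natrD.
rewrite natrM natrX (natrD _ k) => e.
have eN : (6 * (2 * k + 1) * (3 * k + 1) * (3 * k + 2))%:R
    = 6 * (2 * k%:R + 1) * (3 * k%:R + 1) * (3 * k%:R + 2) :> R.
  by rewrite !natrM (natrD _ (2 * k) 1) (natrD _ (3 * k) 1) (natrD _ (3 * k) 2) !natrM.
rewrite natrM eN in e.
have := divrK u (cf3 k)%:R; rewrite kS; move: (_ / _) => d eb; rewrite -eb in e *.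
move: (k%:R) (cf3 k.+1)%:R e => y a e.
transitivity (a * (y + 1) ^+ 3); first by ring.
by rewrite e; ring.
Qed.

Lemma sum_cf3_div :
  2 * (\sum_(0 <= k < p.-1) (cf3 k)%:R * w ^+ k / k.+1%:R) = 81 * gwsum ^+ 2 + 2 * gsum ^+ 2.
Proof.
set S := \sum_(_ <= _ < _) _.
have p1 : p.-1.+1 = p by rewrite prednK // prime_gt0.
have drop (f : nat -> R) :
    \sum_(k < p) f k * (cf3 k)%:R * w ^+ k = \sum_(k < p.-1) f k * (cf3 k)%:R * w ^+ k.
  transitivity (\sum_(k < p.-1.+1) f k * (cf3 k)%:R * w ^+ k); first by rewrite p1.
  by rewrite big_ord_recr /= cf3_last mulr0 mul0r addr0.
have q2 : qsum 2 = w * (108 * qsum 2 + 54 * qsum 1 + 24 * qsum 0 - 12 * S).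
  have q2s : qsum 2 = \sum_(k < p.-1) k.+1%:R ^+ 2 * (cf3 k.+1)%:R * w ^+ k.+1.
    transitivity (\sum_(k < p.-1.+1) k%:R ^+ 2 * (cf3 k)%:R * w ^+ k); first by rewrite p1.
    by rewrite big_ord_recl /= expr0n !mul0r add0r; apply: eq_bigr.
  have dj j : qsum j = \sum_(k < p.-1) k%:R ^+ j * (cf3 k)%:R * w ^+ k.
    exact: (drop (fun k => k%:R ^+ j)).
  rewrite {1}q2s /S big_mkord (dj 2%N) (dj 1%N) (dj 0%N).
  rewrite !mulr_sumr -!big_split -sumrB mulr_sumr; apply: eq_bigr => k _.
  rewrite cf3_div; last by have := ltn_ord k; lia.
  by rewrite (exprS w k) expr0 expr1 /=; ring.
have q2' : 192 * qsum 2 = - (108 * qsum 2 + 54 * qsum 1 + 24 * qsum 0 - 12 * S).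
  by rewrite {1}q2 mulrA hw mulN1r.
have q0 : qsum 0 = gsum ^+ 2.
  rewrite -horner_poly2 -horner_exp -clausen_mod -(horner_P 0) /P /poly3; congr (_ .[x]).
  by apply: eq_bigr => k _; rewrite expr0 mul1r.
have u6 : (6 : R) \is a GRing.unit by rewrite (_ : 6 = 2 * 3 :> R) ?unitrM ?u2 //; ring.
apply: (mulrI u6).
move: q2' q0 (qsum2_gsum); move: gsum gwsum (qsum 0) (qsum 1) (qsum 2) => g h q s r e1 e0 e2; rewrite {}e0 in e1.
apply: subr0_eq; move: e1 e2 => /eqP; rewrite -subr_eq0 => /eqP; set E1 := (X in X = 0) => e1.
move=> /eqP; rewrite -subr_eq0 => /eqP; set E2 := (X in X = 0) => e2.
transitivity (- 3 * E2 - E1); first by rewrite /E1 /E2; ring.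
by rewrite e1 e2; ring.
Qed.
End AtPoint.
End ModSqr.

(** * Reduction of rationals modulo p^2 *)

Section Transport.
Variables (p : nat) (R : comUnitRingType).
Hypothesis hR : mod_sqr p R.

Let hp : prime p. Proof. by case: hR. Qed.
Let p20 : p%:R ^+ 2 = 0 :> R. Proof. by case: hR. Qed.
Let unitN n : ~~ (p %| n)%N -> (n%:R : R) \is a GRing.unit. Proof. by case: hR => _ _; apply. Qed.

(* The graph of reduction modulo [p ^ 2] on the rationals with denominator prime to [p]. *)
Definition reduces (a : rat) (x : R) : Prop :=
  exists (m : int) (d : nat),
    [/\ ~~ (p %| d)%N, a = m%:~R / d%:R & x = m%:~R / d%:R].

Let ratN0 d : ~~ (p %| d)%N -> d%:R != 0 :> rat.
Proof. by move=> h; rewrite pnatr_eq0; apply: contra h => /eqP ->. Qed.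

Lemma reduces_int (m : int) : reduces m%:~R m%:~R.
Proof.
exists m, 1%N; split; rewrite ?divr1 //.
by rewrite dvdn1 neq_ltn prime_gt1 ?orbT.
Qed.

Lemma reduces_nat n : reduces n%:R n%:R.
Proof. exact: (reduces_int n). Qed.

Lemma reduces0 : reduces 0 0. Proof. exact: (reduces_nat 0). Qed.
Lemma reduces1 : reduces 1 1. Proof. exact: (reduces_nat 1). Qed.

Lemma reducesN a x : reduces a x -> reduces (- a) (- x).
Proof. by case=> m [d [h -> ->]]; exists (- m), d; split; rewrite // rmorphN mulNr. Qed.

Let ndvdM d d' : ~~ (p %| d)%N -> ~~ (p %| d')%N -> ~~ (p %| d * d')%N.
Proof. by move=> h h'; rewrite Euclid_dvdM // negb_or h. Qed.

Lemma reducesD a b x y : reduces a x -> reduces b y -> reduces (a + b) (x + y).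
Proof.
case=> m [d [h -> ->]] [m' [d' [h' -> ->]]].
exists (m * d' + m' * d), (d * d')%N; split; first exact: ndvdM.
  by rewrite addf_div ?ratN0 // natrM rmorphD !rmorphM.
apply: (canRL (mulrK (unitN (ndvdM h h')))).
by rewrite natrM mulrDl rmorphD !rmorphM mulrA divrK ?unitN // mulrCA divrK ?unitN // [_%:R * _]mulrC.
Qed.

Lemma reducesM a b x y : reduces a x -> reduces b y -> reduces (a * b) (x * y).
Proof.
case=> m [d [h -> ->]] [m' [d' [h' -> ->]]].
exists (m * m'), (d * d')%N; split; first exact: ndvdM.
  by rewrite mulf_div natrM rmorphM.
by rewrite mulrACA natrM rmorphM invrM ?unitN // [_^-1 * _]mulrC.
Qed.

Lemma reducesV a x : reduces a x -> x \is a GRing.unit -> reduces a^-1 x^-1.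
Proof.
case=> m [d [h -> ->]] u.
have um : (m%:~R : R) \is a GRing.unit by move: u; rewrite unitrM => /andP[].
have hm : ~~ (p %| `|m|)%N.
  apply/negP => /dvdnP[k hk].
  have : (`|m|%N%:R : R) \is a GRing.unit.
    move: um; rewrite {1}[m]intEsign rmorphM unitrM rmorph_sign => /andP[_].
    by rewrite /= -pmulrn.
  rewrite hk natrM unitrM => /andP[_ up].
  by have := unitrX 2 up; rewrite p20 unitr0.
have s1 (T : comUnitRingType) : m%:~R = (-1) ^+ (m < 0)%R * `|m|%N%:R :> T.
  by rewrite {1}[m]intEsign rmorphM rmorph_sign /= -pmulrn.
have sV (T : comUnitRingType) (n : bool) : ((-1) ^+ n)^-1 = (-1) ^+ n :> T.
  by case: n; rewrite ?expr0 ?expr1 ?invr1 // invrN1.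
exists ((-1) ^+ (m < 0)%R * d%:Z), `|m|%N; split=> //.
  by rewrite invf_div s1 invfM sV rmorphM rmorph_sign mulrA [d%:R * _]mulrC /= -pmulrn.
rewrite s1 invrM ?unitrV ?unitN // ?unitrM ?unitrX ?unitrN1 ?unitN // invrK.
by rewrite invrM ?unitrX ?unitrN1 ?unitN // sV rmorphM rmorph_sign /= -pmulrn; ring.
Qed.

Lemma reducesX a x n : reduces a x -> reduces (a ^+ n) (x ^+ n).
Proof.
by move=> h; elim: n => [|n IH]; [exact: reduces1|rewrite !exprS; exact: reducesM].
Qed.

Lemma reduces_sum n (f : nat -> rat) (g : nat -> R) :
  (forall k, (k < n)%N -> reduces (f k) (g k)) ->
  reduces (\sum_(k < n) f k) (\sum_(k < n) g k).
Proof.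
elim: n => [|n IH] h; first by rewrite !big_ord0; exact: reduces0.
rewrite !big_ord_recr; apply: reducesD; last exact: h.
by apply: IH => k hk; apply: h; exact: ltnW.
Qed.

Lemma reduces_fun a x y : reduces a x -> reduces a y -> x = y.
Proof.
case=> m [d [h -> ->]] [m' [d' [h' e ->]]].
have {e} e : m * d' = m' * d.
  apply/eqP; rewrite -(eqr_int rat) !rmorphM /=; apply/eqP.
  move/eqP: e; rewrite eqr_div ?ratN0 // => /eqP e.
  by rewrite -!pmulrn e.
apply/eqP; rewrite -subr_eq0; apply/eqP.
apply: (mulIr (unitN h)); apply: (mulIr (unitN h')).
rewrite !mul0r.
transitivity (m%:~R / d%:R * d%:R * d'%:R - m'%:~R / d'%:R * d'%:R * d%:R : R); first by ring.
rewrite !divrK ?unitN //.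
have := congr1 (fun z : int => z%:~R : R) e.
by rewrite !rmorphM /= -!pmulrn => ->; rewrite subrr.
Qed.

Lemma reduces_cong a b x : (forall n, n%:R = 0 :> R -> (p ^ 2 %| n)%N) ->
  reduces a x -> reduces b x -> rat_cong p 2 a b.
Proof.
move=> hz ha hb; have := reducesD ha (reducesN hb); rewrite subrr.
move=> [m [d [h e e0]]]; rewrite /rat_cong e.
have m0 : (m%:~R : R) = 0.
  have : m%:~R / d%:R * d%:R = 0 * d%:R :> R by rewrite -e0.
  by rewrite divrK ?unitN // mul0r.
have {m0} dm : (p ^ 2 %| `|m|)%N.
  apply: hz; move: m0; rewrite {1}[m]intEsign rmorphM rmorph_sign /= -pmulrn => h0.
  by rewrite -[LHS](signrMK (m < 0)%R) h0 mulr0.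
have [k ek] : exists k : int, m = (p ^ 2)%:Z * k.
  case/dvdnP: dm => k hk; exists ((-1) ^+ (m < 0)%R * k%:Z).
  by rewrite {1}[m]intEsign hk PoszM; ring.
exists (k%:~R / d%:R); split; last first.
  by rewrite ek rmorphM /= -pmulrn mulrA.
have hd : (`|denq (k%:~R / d%:R)| %| d)%N.
  rewrite -[X in (_ %| X)%N]/(`|d%:Z|%N) [d%:R]pmulrn; case: divqP => [d0|j y j0].
    by rewrite dvdn0.
  by rewrite abszM dvdn_mull.
by apply: contra h => hq; exact: dvdn_trans hd.
Qed.
End Transport.

(** * First-order interpolation in the parameter *)

Section Affine.
Variables (R : comUnitRingType) (e : R).
Hypothesis e2 : e * e = 0.

Lemma unit_addr_nil a b : a \is a GRing.unit -> a + e * b \is a GRing.unit.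
Proof.
move=> u; apply/unitrPr; exists (a^-1 - e * b * a^-1 * a^-1).
transitivity (a * a^-1 - (a * a^-1) * (e * b * a^-1) + (e * b * a^-1)
   - e * e * b ^+ 2 * a^-1 * a^-1); first by ring.
by rewrite divrr // e2; ring.
Qed.

(* First-order Taylor expansion along the square-zero increments [i * e]. *)
Definition affine (f : nat -> R) := exists a b, forall i, f i = a + i%:R * (e * b).

Lemma affine_const c : affine (fun=> c).
Proof. by exists c, 0 => i; rewrite !mulr0 addr0. Qed.

Lemma affineD f g : affine f -> affine g -> affine (fun i => f i + g i).
Proof.
by move=> [a [b h]] [a' [b' h']]; exists (a + a'), (b + b') => i; rewrite h h'; ring.
Qed.

Lemma affineM f g : affine f -> affine g -> affine (fun i => f i * g i).
Proof.
move=> [a [b h]] [a' [b' h']]; exists (a * a'), (a * b' + b * a') => i; rewrite h h'.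
transitivity (a * a' + i%:R * (e * (a * b' + b * a')) + (e * e) * (i%:R ^+ 2 * b * b')).
  by ring.
by rewrite e2; ring.
Qed.

Lemma affineV f : f 0%N \is a GRing.unit -> affine f -> affine (fun i => (f i)^-1).
Proof.
move=> u [a [b h]]; have ua : a \is a GRing.unit by move: u; rewrite h mul0r addr0.
exists a^-1, (- (b * a^-1 * a^-1)) => i; rewrite h.
have v : a + i%:R * (e * b) \is a GRing.unit.
  by rewrite mulrCA; apply: unit_addr_nil.
apply: (mulrI v); rewrite divrr //.
transitivity (a * a^-1 + i%:R * e * b * a^-1 - (a * a^-1) * (i%:R * e * b * a^-1)
   - e * e * i%:R ^+ 2 * b ^+ 2 * a^-1 * a^-1); last by ring.
by rewrite divrr // e2; ring.
Qed.

Lemma affine_sum n (F : nat -> nat -> R) : (forall k, (k < n)%N -> affine (F k)) ->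
  affine (fun i => \sum_(k < n) F k i).
Proof.
move=> h; elim: n h => [|n IH] h.
  by exists 0, 0 => i; rewrite big_ord0; ring.
have [|a [b hab]] := affineD (IH _) (h n (ltnSn n)).
  by move=> k hk; apply: h; apply: ltnW.
by exists a, b => i; rewrite big_ord_recr -hab.
Qed.

Lemma affine_poch f k : affine f -> affine (fun i => poch (f i) k).
Proof.
move=> hf; elim: k => [|k IH].
  by exists 1, 0 => i; rewrite poch0; ring.
have [a [b h]] := affineM IH (affineD hf (affine_const k%:R)).
by exists a, b => i; rewrite pochS -h.
Qed.

Lemma affine_interp f : affine f ->
  f 0%N = 2 * f 1%N - f 2%N /\ exists d, f 1%N = f 2%N + e * d.
Proof. by move=> [a [b h]]; rewrite !h; split; [ring|exists (- b); ring]. Qed.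
End Affine.

(** * Displacing the parameter by multiples of p/3 *)

Section Values.
Variables (p : nat) (R : comUnitRingType).
Hypothesis hR : mod_sqr p R.
Hypothesis p5 : (5 < p)%N.

Let hp : prime p. Proof. by case: hR. Qed.
Let p20 : p%:R ^+ 2 = 0 :> R. Proof. by case: hR. Qed.
Let u2 : (2 : R) \is a GRing.unit. Proof. by apply: (unit_lt hR); lia. Qed.
Let u3 : (3 : R) \is a GRing.unit. Proof. by apply: (unit_lt hR); lia. Qed.
Let u6 : (6 : R) \is a GRing.unit.
Proof. by rewrite (_ : 6 = 2 * 3 :> R) ?unitrM ?u2 //; ring. Qed.
Let u8 : (8 : R) \is a GRing.unit.
Proof. by rewrite (_ : 8 = 2 ^+ 3 :> R) ?unitrX //; ring. Qed.
Let u27 : (27 : R) \is a GRing.unit.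
Proof. by rewrite (_ : 27 = 3 ^+ 3 :> R) ?unitrX //; ring. Qed.

Let e : R := p%:R / 3.
Let e2 : e * e = 0.
Proof. by rewrite /e mulrACA -expr2 p20 mul0r. Qed.

Lemma unit_fact k : (k < p)%N -> ((k`!)%:R : R) \is a GRing.unit.
Proof.
by move=> h; case: hR => _ _; apply; rewrite prime_dvd_fact // -ltnNge.
Qed.

Lemma poch1 (T : pzRingType) k : poch (1 : T) k = (k`!)%:R.
Proof.
elim: k => [|k IH]; first by rewrite poch0.
by rewrite pochS IH factS mulnC natrM -[in k.+1%:R]addn1 addnC natrD.
Qed.

Lemma unit_poch1 d k : (k < p)%N -> poch (1 + e * d) k \is a GRing.unit.
Proof.
move=> hk; elim: k hk => [|k IH] hk; first by rewrite poch0 unitr1.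
rewrite pochS unitrM IH ?(ltnW hk) // addrAC; apply: unit_addr_nil => //.
by rewrite -(natrD _ 1) add1n (unit_lt hR).
Qed.

(** For [p = 3 N + 1], [ci 1 = -N] and [ci 2 + 1/3 = -2 N]; for [p = 3 n + 2], [ci 1 + 1/3 = -n] and
    [ci 2 = -(2 n + 1)]. Either way the series terminates before index [p]. *)
Let ci i : R := 1 / 3 - i%:R * e.

(** For each [i] the denominator parameter is 1 plus a nilpotent, so its Pochhammer symbols of
    length below [p] are units. *)
Lemma ci_den i : (3 * ci i + 5) / 6 = 1 + e * (- i%:R / 2).
Proof.
apply: (mulrI u6); apply: (mulrI u2).
have -> : 6 * ((3 * ci i + 5) / 6) = 3 * ci i + 5 by rewrite mulrC divrK.
have -> : 2 * (6 * (1 + e * (- i%:R / 2))) = 12 - 6 * e * i%:R * (2 / 2) by ring.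
rewrite divrr // /ci.
have -> : 3 * (1 / 3 - i%:R * e) = 3 / 3 - 3 * (i%:R * e) by ring.
by rewrite divrr //; ring.
Qed.

Let aff_ci : affine e ci.
Proof. by exists (1 / 3), (- 1) => i; rewrite /ci; ring. Qed.

Lemma affine_hyp_term k : (k < p)%N -> affine e (fun i => hyp_term (ci i) k).
Proof.
move=> hk; rewrite /hyp_term.
have c := affine_const e.
apply: (affineM e2); last exact: c.
apply: (affineM e2).
  by apply: (affineM e2); apply: (affine_poch e2) => //; apply: affineD.
apply: (affineV e2).
  rewrite ci_den mulr0n oppr0 mul0r mulr0 addr0 poch1.
  by rewrite unitrM !unit_fact.
apply: (affineM e2) => //; apply: (affine_poch e2).
apply: (affineM e2) => //; apply: affineD => //; exact: (affineM e2).
Qed.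

Lemma affine_hyp_sum : affine e (fun i => hyp_sum (ci i) p).
Proof. exact: (@affine_sum _ e p (fun k i => hyp_term (ci i) k) affine_hyp_term). Qed.

Lemma affine_hyp_wsum : affine e (fun i => hyp_wsum (ci i) p).
Proof.
apply: (@affine_sum _ e p (fun k i => (3 * k%:R + ci i) * hyp_term (ci i) k)) => k hk.
apply: (affineM e2); last exact: affine_hyp_term.
by apply: affineD => //; exact: affine_const.
Qed.

Lemma reduces_poch a (x : R) k : reduces p a x -> reduces p (poch a k) (poch x k).
Proof.
move=> h; elim: k => [|k IH]; first by rewrite !poch0; exact: reduces1.
by rewrite !pochS; apply: reducesM => //; apply: reducesD => //; exact: reduces_nat.
Qed.

Lemma reduces_hyp_term (a : rat) (x : R) k : reduces p a x ->
  poch ((3 * x + 5) / 6) k \is a GRing.unit -> (k < p)%N ->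
  reduces p (hyp_term a k) (hyp_term x k).
Proof.
move=> h u hk; rewrite /hyp_term.
have r3 : reduces p (1 / 3) (1 / 3 : R).
  apply: (reducesM hR) (reduces1 hR) _; exact: (reducesV hR) (reduces_nat hR 3) u3.
have r8 : reduces p (- (1 / 8)) (- (1 / 8) : R).
  apply: reducesN; apply: (reducesM hR) (reduces1 hR) _.
  exact: (reducesV hR) (reduces_nat hR 8) u8.
have rd : reduces p ((3 * a + 5) / 6) ((3 * x + 5) / 6).
  apply: (reducesM hR); last exact: (reducesV hR) (reduces_nat hR 6) u6.
  by apply: (reducesD hR); [apply: (reducesM hR) => //|]; exact: (reduces_nat hR).
apply: (reducesM hR); last exact: (reducesX hR).
apply: (reducesM hR).
  by apply: (reducesM hR); apply: reduces_poch => //; apply: (reducesD hR).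
apply: (reducesV hR); last by rewrite unitrM u unit_fact.
by apply: (reducesM hR); [exact: reduces_poch|exact: (reduces_nat hR)].
Qed.

Lemma reduces_hyp_sum (a : rat) i : reduces p a (ci i) ->
  reduces p (hyp_sum a p) (hyp_sum (ci i) p) /\ reduces p (hyp_wsum a p) (hyp_wsum (ci i) p).
Proof.
move=> h.
have t k : (k < p)%N -> reduces p (hyp_term a k) (hyp_term (ci i) k).
  by move=> hk; apply: reduces_hyp_term => //; rewrite ci_den unit_poch1.
split; first exact: (reduces_sum hR).
apply: (reduces_sum hR (f := fun k => (3 * k%:R + a) * hyp_term a k)
  (g := fun k => (3 * k%:R + ci i) * hyp_term (ci i) k)) => k hk.
apply: (reducesM hR); last exact: t.
by apply: (reducesD hR) => //; apply: (reducesM hR); exact: (reduces_nat hR).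
Qed.

Lemma fact_mul3_poch (T : comUnitRingType) k : (3 : T) \is a GRing.unit ->
  27 ^+ k * poch (1 / 3) k * poch (2 / 3) k * (k`!)%:R = ((3 * k)`!)%:R :> T.
Proof.
move=> v3; elim: k => [|k IH]; first by rewrite !poch0; ring.
rewrite fact3 -IH !pochS factS natrM exprS -[in k.+1%:R]addn1 natrD.
move: (poch _ _) (poch _ _) (k`!)%:R (27 ^+ k) => P Q f c.
have -> : 3 * k%:R + 1 = 3 * (1 / 3 + k%:R) :> T.
  by rewrite mulrDr mulrCA divrr // mulr1 addrC.
have -> : 3 * k%:R + 2 = 3 * (2 / 3 + k%:R) :> T.
  by rewrite mulrDr mulrCA divrr // mulr1 addrC.
by ring.
Qed.

Lemma hyp_term_third (x : R) k : 216 * x = -1 -> (k < p)%N ->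
  hyp_term (1 / 3) k = (cf2 k)%:R * x ^+ k.
Proof.
move=> hx hk.
have uk := unit_fact hk.
have e1 : (3 * (1 / 3) + 5) / 6 = 1 :> R.
  by rewrite mulrCA divrr // mulr1 (_ : 1 + 5 = 6) ?divrr //; ring.
have e3 : 1 / 3 + 1 / 3 = 2 / 3 :> R by ring.
rewrite /hyp_term e1 e3 poch1.
apply: (mulrI (unitrX k u27)); apply: (mulrI uk); apply: (mulrI uk); apply: (mulrI uk).
have := fact_mul3_poch k u3; rewrite -cf2_fact natrM (natrM _ (k`! * k`!)) (natrM _ k`!) => h.
have -> : x = - (1 / 8) / 27.
  apply: (mulrI u27); apply: (mulrI u8).
  transitivity (216 * x); first by ring.
  rewrite hx; transitivity (- (8 / 8) * (27 / 27) : R); last by ring.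
  by rewrite !divrr // mulr1.
have e27 : 27 ^+ k * 27^-1 ^+ k = 1 :> R by rewrite -exprMn divrr // expr1n.
rewrite (exprMn k (- (1 / 8))) invrM // .
have ekk : (k`!)%:R / (k`!)%:R = 1 :> R by rewrite divrr.
pose f : R := (k`!)%:R; rewrite -/f in h ekk *.
move: ((- (1 / 8)) ^+ k) (27^-1 ^+ k) (27 ^+ k) (poch (1 / 3) k) (poch (2 / 3) k) h e27.
move: (cf2 k)%:R f^-1 ekk; move: f => f b v ekk y z c P Q h e27.
transitivity ((c * P * Q * f) * y * (f * v) * (f * v)); first by ring.
rewrite h ekk; transitivity (b * (f * f * f) * y * (c * z)); last by ring.
by rewrite e27; ring.
Qed.

Lemma gsum_interp (x : R) : 216 * x = -1 ->
  gsum p x = 2 * hyp_sum (ci 1) p - hyp_sum (ci 2) p /\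
  3 * gwsum p x + gsum p x / 3 = 2 * hyp_wsum (ci 1) p - hyp_wsum (ci 2) p.
Proof.
move=> hx; have c0 : ci 0 = 1 / 3 by rewrite /ci mul0r subr0.
have [<- _] := affine_interp affine_hyp_sum.
have [<- _] := affine_interp affine_hyp_wsum.
rewrite c0 /gsum /gwsum /hyp_sum /hyp_wsum; split.
  by apply: eq_bigr => k _; rewrite (hyp_term_third hx).
rewrite mulr_sumr mulr_suml -big_split; apply: eq_bigr => k _ /=.
by rewrite (hyp_term_third hx) //; ring.
Qed.

(** The pair [g], [h] is preferable to [g] and its derivative: one of [g^2], [h^2] will vanish and
    [3 g h] will be [p] or [-p]. *)
Lemma sums_gh (x w : R) : 216 * x = -1 -> 192 * w = -1 ->
  let g := gsum p x in let h := 3 * gwsum p x + g / 3 in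
  5 * qsum p w 1 = 3 * g * h - g ^+ 2 /\
  2 * (\sum_(0 <= k < p.-1) (cf3 k)%:R * w ^+ k / k.+1%:R) = 9 * h ^+ 2 - 6 * g * h + 3 * g ^+ 2.
Proof.
move=> hx hw; rewrite (qsum1_gsum hR p5 hx hw) (sum_cf3_div hR p5 hx hw) /=.
move: (gsum p x) (gwsum p x) => g k.
have d3 : g / 3 * 3 = g by rewrite divrK.
by move: d3; move: (g / 3) => d <-; split; ring.
Qed.
End Values.

(** * Values of the series modulo p^2 *)

Lemma poch_rev (R : comPzRingType) (a : R) k : poch a k = (-1) ^+ k * poch (1 - a - k%:R) k.
Proof.
rewrite /poch (reindex_inj rev_ord_inj) /=.
have -> : (-1) ^+ k = \prod_(i < k) (-1 : R) by rewrite prodr_const card_ord.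
rewrite -big_split; apply: eq_bigr => i _ /=.
by rewrite natrB ?ltn_ord // -addn1 natrD; ring.
Qed.

Lemma poch_add (R : pzRingType) (a : R) m k : poch a (m + k) = poch a m * poch (a + m%:R) k.
Proof.
rewrite /poch big_split_ord /=; congr (_ * _).
by apply: eq_bigr => i _; rewrite natrD addrA.
Qed.

Lemma poch_natS (R : comPzRingType) m k : poch (m.+1%:R : R) k * (m`!)%:R = ((m + k)`!)%:R.
Proof.
elim: k => [|k IH]; first by rewrite poch0 mul1r addn0.
by rewrite pochS mulrAC IH addnS factS natrM -natrD addSn mulrC.
Qed.

Lemma poch_oppn (R : comPzRingType) m : poch (- m%:R : R) m = (-1) ^+ m * (m`!)%:R.
Proof. by rewrite poch_rev opprK addrK poch1. Qed.

Section Nilpotent.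
Variables (R : comPzRingType) (e : R).
Hypothesis e2 : e * e = 0.

Lemma mul_poch_nil a b k : e * poch (a + e * b) k = e * poch a k.
Proof.
elim: k => [|k IH]; first by rewrite !poch0.
rewrite !pochS mulrA IH.
transitivity (e * (poch a k * (a + k%:R)) + (e * e) * b * poch a k); first by ring.
by rewrite e2; ring.
Qed.

(** The factors run from [e - m] to [e + m + 1]; since [e] itself is one of them, the others matter
    only modulo [e]. *)
Lemma poch_centered m : poch (e - m%:R) (m + m.+2) = (-1) ^+ m * e * (m`!)%:R * (m.+1`!)%:R.
Proof.
rewrite poch_add subrK pochSl.
have -> : e * poch (e + 1) m.+1 = e * (m.+1`!)%:R.
  by have := mul_poch_nil 1 1 m.+1; rewrite mulr1 addrC => ->; rewrite poch1.
rewrite mulrA [_ * e]mulrC (_ : e - m%:R = - m%:R + e * 1); last by ring.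
by rewrite mul_poch_nil poch_oppn; ring.
Qed.

(** Factor by factor, [(i - d)^2 = i (i - 2 d)]. *)
Lemma poch_sqr_nil d k : d * d = 0 -> poch (1 - d) k ^+ 2 = (k`!)%:R * poch (1 - 2 * d) k :> R.
Proof.
move=> d2; elim: k => [|k IH]; first by rewrite !poch0 ?fact0; ring.
rewrite !pochS exprMn IH factS natrM -[in k.+1%:R]addn1 natrD.
transitivity ((k%:R + 1) * (k`!)%:R * (poch (1 - 2 * d) k * (1 - 2 * d + k%:R))
  + (d * d) * ((k`!)%:R * poch (1 - 2 * d) k) : R); first by ring.
by rewrite d2; ring.
Qed.
End Nilpotent.

Section Cases.
Variables (p : nat) (R : comUnitRingType).
Hypothesis hR : mod_sqr p R.
Hypothesis p5 : (5 < p)%N.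

Let hp : prime p. Proof. by case: hR. Qed.
Let p20 : p%:R ^+ 2 = 0 :> R. Proof. by case: hR. Qed.
Let u2 : (2 : R) \is a GRing.unit. Proof. by apply: (unit_lt hR); lia. Qed.
Let u3 : (3 : R) \is a GRing.unit. Proof. by apply: (unit_lt hR); lia. Qed.
Let u8 : (8 : R) \is a GRing.unit.
Proof. by rewrite (_ : 8 = 2 ^+ 3 :> R) ?unitrX //; ring. Qed.
Let u27 : (27 : R) \is a GRing.unit.
Proof. by rewrite (_ : 27 = 3 ^+ 3 :> R) ?unitrX //; ring. Qed.

Let e : R := p%:R / 3.
Let e2 : e * e = 0.
Proof. by rewrite /e mulrACA -expr2 p20 mul0r. Qed.
Let pe : p%:R = 3 * e. Proof. by rewrite /e mulrCA divrr ?mulr1. Qed.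

(** After multiplication by [e] only residues modulo [p] count, which turns the theorems of Fermat
    and Wilson into identities in [R]. *)
Lemma mulp_modn m n : m = n %[mod p] -> e * m%:R = e * n%:R.
Proof.
move=> h; rewrite (divn_eq m p) (divn_eq n p) h !natrD !natrM pe !mulrDr.
congr (_ + _); transitivity (e * e * 3 * (m %/ p)%:R); first by ring.
transitivity (e * e * 3 * (n %/ p)%:R); last by ring.
by rewrite e2; ring.
Qed.

Lemma mulp_fermat a : (0 < a < p)%N -> e * a%:R ^+ p.-1 = e.
Proof.
move=> ha; apply: (mulIr (unit_lt hR ha)).
rewrite -mulrA -exprSr prednK ?prime_gt0 // -natrX.
exact/mulp_modn/fermat_little.
Qed.

Lemma mulp_wilson : e * (p.-1`!)%:R = - e.
Proof.
have p1 : (1 < p)%N by exact: prime_gt1.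
have := hp; rewrite (Wilson p1) => /dvdnP[k hk].
have : e * (p.-1`!.+1)%:R = e * (k * p)%:R by rewrite hk.
rewrite -addn1 natrD natrM pe => h; apply: subr0_eq.
transitivity (e * ((p.-1`!)%:R + 1)); first by ring.
by rewrite h; transitivity (e * e * (k%:R * 3)); [ring|rewrite e2 mul0r].
Qed.

Lemma fact_pred_rev n : (n < p)%N ->
  (p.-1`!)%:R = ((p.-1 - n)`!)%:R * (-1) ^+ n * poch (1 - p%:R) n :> R.
Proof.
elim: n => [|n IH] hn; first by rewrite subn0 poch0; ring.
rewrite IH; last exact: ltnW.
have -> : (p.-1 - n = (p.-1 - n.+1).+1)%N by lia.
rewrite factS natrM pochS exprS.
have -> : ((p.-1 - n.+1).+1)%:R = p%:R - (n%:R + 1) :> R.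
  by rewrite -(natrD _ n 1) -natrB; [congr (_%:R); lia|lia].
by ring.
Qed.

Lemma mulp_ratio n : (3 * n + 1 = p)%N -> e * (27 / 8) ^+ (4 * n) = e.
Proof.
move=> hn; have hp1 : p.-1 = (3 * n)%N by lia.
have f3 := @mulp_fermat 3; have f2 := @mulp_fermat 2.
have q (a : R) k : e * a ^+ k = e -> e * (a ^+ k) ^+ 4 = e.
  by move=> h; rewrite !exprS expr0 mulr1 !mulrA !h.
have h3 : e * 27 ^+ (4 * n) = e.
  rewrite (_ : 27 = 3 ^+ 3 :> R); last by ring.
  by rewrite -exprM (_ : (3 * (4 * n) = p.-1 * 4)%N) ?exprM ?q ?f3 //; lia.
have h2 : e * 8 ^+ (4 * n) = e.
  rewrite (_ : 8 = 2 ^+ 3 :> R); last by ring.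
  by rewrite -exprM (_ : (3 * (4 * n) = p.-1 * 4)%N) ?exprM ?q ?f2 //; lia.
apply: (mulIr (unitrX (4 * n) u8)).
by rewrite -mulrA -exprMn divrK // h3 h2.
Qed.

(** The power is [(3/2)^(12 n)] with [12 n = 4 (p - 1) - 4], so Fermat leaves [(2/3)^4]. *)
Lemma mulp_ratio2 n : (3 * n + 2 = p)%N -> 81 * (e * (27 / 8) ^+ (4 * n)) = 16 * e.
Proof.
move=> hn; have hp1 : p.-1 = (3 * n + 1)%N by lia.
have f3 := @mulp_fermat 3; have f2 := @mulp_fermat 2.
have q (a : R) k : e * a ^+ k = e -> e * (a ^+ k) ^+ 4 = e.
  by move=> h; rewrite !exprS expr0 mulr1 !mulrA !h.
have h3 : 81 * (e * 27 ^+ (4 * n)) = e.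
  rewrite (_ : 27 = 3 ^+ 3 :> R); last by ring.
  rewrite -[RHS](q 3 p.-1) ?f3 //; last by lia.
  by rewrite -!exprM hp1 (_ : ((3 * n + 1) * 4 = 4 + 3 * (4 * n))%N) ?exprD; [ring|lia].
have h2 : 16 * (e * 8 ^+ (4 * n)) = e.
  rewrite (_ : 8 = 2 ^+ 3 :> R); last by ring.
  rewrite -[RHS](q 2 p.-1) ?f2 //; last by lia.
  by rewrite -!exprM hp1 (_ : ((3 * n + 1) * 4 = 4 + 3 * (4 * n))%N) ?exprD; [ring|lia].
apply: (mulIr (unitrX (4 * n) u8)).
transitivity (81 * (e * (27 / 8 * 8) ^+ (4 * n))); first by rewrite (exprMn (4 * n) (27 / 8) 8) !mulrA.
by rewrite divrK // h3 -[LHS]h2; ring.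
Qed.

Let hyp_eq (a : rat) i x : reduces p a (1 / 3 - i%:R * e) ->
  reduces p (hyp_sum a p) x -> hyp_sum (1 / 3 - i%:R * e) p = x.
Proof.
move=> ha hx; have [h _] := reduces_hyp_sum hR p5 ha.
exact: (reduces_fun hR h hx).
Qed.

Let hyp_weq (a : rat) i x : reduces p a (1 / 3 - i%:R * e) ->
  reduces p (hyp_wsum a p) x -> hyp_wsum (1 / 3 - i%:R * e) p = x.
Proof.
move=> ha hx; have [_ h] := reduces_hyp_sum hR p5 ha.
exact: (reduces_fun hR h hx).
Qed.

Let interp_sum : exists d, hyp_sum (1 / 3 - 1%:R * e) p = hyp_sum (1 / 3 - 2%:R * e) p + e * d.
Proof. by have [_] := affine_interp (affine_hyp_sum hR p5). Qed.

Let interp_wsum : exists d, hyp_wsum (1 / 3 - 1%:R * e) p = hyp_wsum (1 / 3 - 2%:R * e) p + e * d.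
Proof. by have [_] := affine_interp (affine_hyp_wsum hR p5). Qed.

Let r27_8 : reduces p (27 / 8) (27 / 8 : R).
Proof. exact: (reducesM hR) (reduces_nat hR 27) (reducesV hR (reduces_nat hR 8) u8). Qed.

Let rdiv a b : (b%:R : R) \is a GRing.unit -> reduces p (a%:R / b%:R) (a%:R / b%:R : R).
Proof. by move=> u; exact: (reducesM hR) (reduces_nat hR a) (reducesV hR (reduces_nat hR b) u). Qed.

(** * The case p = 3 N + 1, where N is even because p is odd *)

Section OneModThree.
Variables (a : nat).
Let N := (2 * a)%N.
Hypothesis hN : (3 * N + 1 = p)%N.
Variable x : R.
Hypothesis hx : 216 * x = -1.
Let g := gsum p x.
Let h := 3 * gwsum p x + g / 3.

Let sgnN : (-1) ^+ N = 1 :> R. Proof. by rewrite /N exprM sqrrN expr1n expr1n. Qed.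
Let eN : N%:R = e - 1 / 3 :> R.
Proof.
apply: (mulrI u3); rewrite mulrBr -pe mulrCA divrr // mulr1 -hN natrD natrM addrK //.
Qed.

Let P : R := poch (2 / 3) N.
Let q : R := poch (1 - p%:R) N.
Let Q : R := poch (N%:R / 2 + 1 / 2) N.

Let fact_eq : (p.-1`!)%:R = ((2 * N)`!)%:R * q :> R.
Proof.
rewrite (@fact_pred_rev N); last by clear -hN; lia.
rewrite (_ : p.-1 - N = 2 * N)%N; last by clear -hN; lia.
by rewrite sgnN mulr1.
Qed.

Let uq : q \is a GRing.unit.
Proof.
have : ((p.-1`!)%:R : R) \is a GRing.unit by apply: (unit_fact hR); rewrite prednK ?prime_gt0.
by rewrite fact_eq unitrM => /andP[].
Qed.

(** Reflection moves the base of [Q] to [1 - p/2], where [poch_sqr_nil] applies. Only the square of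
    [Q] will enter [g]. *)
Let Qsqr : Q ^+ 2 = (N`!)%:R * q.
Proof.
have e3 : 2 * (p%:R / 2) = p%:R :> R by rewrite mulrCA divrr // mulr1.
rewrite /q -e3 -poch_sqr_nil; last first.
  by rewrite mulrACA -expr2 p20 mul0r.
rewrite /Q (poch_rev (N%:R / 2 + 1 / 2)) sgnN [1 * poch _ _]mul1r; congr (_ ^+ 2); apply: (congr1 (fun z : R => poch z N)).
apply: (mulrI u2).
transitivity (2 - (N%:R * 2 / 2 + 2 / 2) - 2 * N%:R : R); first by ring.
rewrite mulrK // divrr // mulrBr e3 -hN natrD natrM; ring.
Qed.

Let uQ : Q \is a GRing.unit.
Proof. by rewrite -(@unitrX_pos _ _ 2) // Qsqr unitrM uq (unit_fact hR) //; clear -hN; lia. Qed.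

(* The values at [i = 0] and [i = 1] are mirror images of each other, so the affine function
   [i |-> poch (N + 1 + (i - 2) e) N] is constant. *)
Lemma poch_shift_const i : poch (N.+1%:R + (i%:R - 2) * e) N = P.
Proof.
have aff : affine e (fun i => poch (N.+1%:R + (i%:R - 2) * e) N).
  by apply: (affine_poch e2); exists (N.+1%:R - 2 * e), 1 => k; ring.
have NS : N.+1%:R = e + 2 / 3 :> R.
  rewrite -addn1 natrD eN; transitivity (e - 1 / 3 + 3 / 3); first by rewrite divrr.
  by ring.
have f0 : poch (N.+1%:R + (0%:R - 2) * e) N = P.
  rewrite poch_rev sgnN mul1r; apply: (congr1 (fun z : R => poch z N)); rewrite NS eN.
  transitivity (3 / 3 - 1 / 3 : R); last by ring.
  by rewrite divrr //; ring.
have f1 : poch (N.+1%:R + (1%:R - 2) * e) N = P.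
  by apply: (congr1 (fun z : R => poch z N)); rewrite NS; ring.
have [c [d hf]] := aff; rewrite hf.
have hc : c = P by rewrite -f0 (hf 0%N) mul0r addr0.
have -> : e * d = 0 by apply: (addrI c); rewrite addr0 [RHS]hc -f1 (hf 1%N) mul1r.
by rewrite mulr0 addr0.
Qed.

Lemma poch_two_thirds : P * (N`!)%:R = ((2 * N)`!)%:R.
Proof.
rewrite mul2n -addnn -(poch_natS _ N N) -(poch_shift_const 2); congr (_ * _).
by apply: (congr1 (fun z : R => poch z N)); ring.
Qed.

Let uP : P \is a GRing.unit.
Proof.
have : (((2 * N)`!)%:R : R) \is a GRing.unit by apply: (unit_fact hR); clear -hN; lia.
by rewrite -poch_two_thirds unitrM => /andP[].
Qed.

Let rP : reduces p (poch (2 / 3) N) P.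
Proof. exact/(reduces_poch hR)/rdiv. Qed.

Let rQ : reduces p (poch (N%:R / 2 + 1 / 2) N) Q.
Proof.
apply: (reduces_poch hR); apply: (reducesD hR); first exact: rdiv.
exact: (@rdiv 1 2 u2).
Qed.

Let c1 : 1 / 3 - 1%:R * e = - N%:R :> R. Proof. by rewrite eN; ring. Qed.
Let c2 : 1 / 3 - 2%:R * e = - (2 * N)%:R - 1 / 3 :> R.
Proof. by rewrite natrM eN; ring. Qed.

Let uF : ((p.-1`!)%:R : R) \is a GRing.unit.
Proof. by rewrite (unit_fact hR) // prednK ?prime_gt0. Qed.
Let u3N : (((3 * N)`!)%:R : R) \is a GRing.unit.
Proof. by rewrite (unit_fact hR) //; clear -hN; lia. Qed.
Let p1N : p.-1 = (3 * N)%N. Proof. by clear -hN; lia. Qed.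

Let r1 : reduces p (- N%:R) (1 / 3 - 1%:R * e).
Proof. by rewrite c1; apply/reducesN/(reduces_nat hR). Qed.
Let r2 : reduces p (- (2 * N)%:R - 1 / 3) (1 / 3 - 2%:R * e).
Proof.
rewrite c2; apply: (reducesD hR); first by apply/reducesN/(reduces_nat hR).
by apply: reducesN; exact: (@rdiv 1 3 u3).
Qed.

Let V1E : hyp_sum (1 / 3 - 1%:R * e) p = (27 / 8) ^+ N * P / Q.
Proof.
apply: (hyp_eq r1); rewrite hyp_sum_nat; last by clear -hN; lia.
apply: (reducesM hR); last exact: (reducesV hR).
by apply: (reducesM hR) => //; exact: (reducesX hR).
Qed.

Let W1E : hyp_wsum (1 / 3 - 1%:R * e) p = 0.
Proof. by apply: (hyp_weq r1); rewrite hyp_wsum_nat; [exact: (reduces0 hR)|clear -hN; lia]. Qed.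

Let V2E : hyp_sum (1 / 3 - 2%:R * e) p = ((27 / 8) ^+ N) ^+ 2 * P / q.
Proof.
have -> : ((27 / 8) ^+ N) ^+ 2 * P / q = (27 / 8) ^+ (2 * N) * ((2 * N)`!)%:R * P / ((3 * N)`!)%:R :> R.
  apply: (mulIr u3N); rewrite divrK // -p1N fact_eq -exprM (mulnC N 2).
  transitivity ((27 / 8) ^+ (2 * N) * P * ((2 * N)`!)%:R * (q / q)); first by ring.
  by rewrite divrr // mulr1; ring.
apply: (hyp_eq r2); rewrite hyp_sum_third; last by clear -hN; lia.
apply: (reducesM hR); last exact: (reducesV hR) (reduces_nat hR _) u3N.
apply: (reducesM hR) => //; apply: (reducesM hR); first exact: (reducesX hR).
exact: (reduces_nat hR).
Qed.

Let W2E : 3 * hyp_wsum (1 / 3 - 2%:R * e) p * (p.-1`!)%:R =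
  - (((27 / 8) ^+ N) ^+ 2 * (N`!)%:R * poch (4 / 3) (2 * N)).
Proof.
suff -> : hyp_wsum (1 / 3 - 2%:R * e) p =
   - (1 / 3) * (27 / 8) ^+ (2 * N) * (N`!)%:R * poch (4 / 3) (2 * N) / ((3 * N)`!)%:R.
  rewrite p1N -mulrA divrK // -exprM (mulnC N 2).
  by transitivity (- (3 / 3 * ((27 / 8) ^+ (2 * N) * (N`!)%:R * poch (4 / 3) (2 * N))) : R); [ring|rewrite divrr // mul1r].
apply: (hyp_weq r2); rewrite hyp_wsum_third; last by clear -hN; lia.
apply: (reducesM hR); last exact: (reducesV hR) (reduces_nat hR _) u3N.
apply: (reducesM hR); last exact/(reduces_poch hR)/rdiv.
apply: (reducesM hR); last exact: (reduces_nat hR).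
apply: (reducesM hR); last exact: (reducesX hR).
by apply: reducesN; exact: (@rdiv 1 3 u3).
Qed.

Let uNf : ((N`!)%:R : R) \is a GRing.unit. Proof. by apply: (unit_fact hR); clear -hN; lia. Qed.
Let ur : ((27 / 8) ^+ N : R) \is a GRing.unit. Proof. by rewrite unitrX // unitrM u27 unitrV. Qed.

Lemma value_one_mod3 : g = ('C(2 * N, N))%:R.
Proof.
have [g2 _] := gsum_interp hR p5 hx.
have [d hd] := interp_sum.
pose V1 := hyp_sum (1 / 3 - 1%:R * e) p; pose V2 := hyp_sum (1 / 3 - 2%:R * e) p.
(* [V1 - V2] is a multiple of [e], so [(2 V1 - V2) V2 = V1^2]. In [V1^2 / V2] the powers of [27/8]
   cancel. *)
have gE : g * V2 = V1 ^+ 2.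
  rewrite /g g2 -/V1 -/V2 [V1]hd -/V2; apply: subr0_eq.
  by transitivity (- (e * e) * d ^+ 2); [ring|rewrite e2; ring].
have gP : g * (N`!)%:R = P.
  move: gE; rewrite /V1 V1E /V2 V2E; move: ((27 / 8) ^+ N) ur => y uy h'.
  apply: (mulIr (unitrX 2 uy)); apply: (mulIr uP); apply: (mulIr uq).
  transitivity (g * (y ^+ 2 * P / q) * (N`!)%:R * q * q).
    by transitivity (g * (y ^+ 2 * P) * (N`!)%:R * q * (q / q)); [rewrite divrr //; ring|ring].
  rewrite h'; transitivity ((y * P) ^+ 2 * q * (Q^-1 ^+ 2 * ((N`!)%:R * q))); first by ring.
  rewrite -Qsqr -exprMn mulVr // expr1n; ring.
apply: (mulIr uNf); rewrite gP; apply: (mulIr uNf).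
rewrite poch_two_thirds -mulrA -!natrM; congr (_%:R).
have /bin_fact : (N <= 2 * N)%N by clear -hN; lia.
by rewrite (_ : 2 * N - N = N)%N //; clear -hN; lia.
Qed.

(** Since the weighted sum vanishes at the first terminating parameter, [h] is a multiple of [e].
    Hence [h^2 = 0], and in [g h] the remaining factors matter only modulo [p]. *)
Lemma deriv_one_mod3 : h ^+ 2 = 0 /\ 3 * (g * h) = p%:R.
Proof.
have [g2 h2] := gsum_interp hR p5 hx.
have [d hd] := interp_sum; have [d' hd'] := interp_wsum.
pose V2 := hyp_sum (1 / 3 - 2%:R * e) p; pose W2 := hyp_wsum (1 / 3 - 2%:R * e) p.
have W2d : W2 = - (e * d') by apply: subr0_eq; rewrite opprK /W2 -hd' W1E.
have hE : h = e * d' by rewrite /h h2 W1E -/W2 W2d; ring.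
have hW : h = - W2 by rewrite hE W2d opprK.
split; first by rewrite hE exprMn (expr2 e) e2 mul0r.
have gV : g * h = - (V2 * W2).
  rewrite hW /g g2 hd -/V2 W2d; apply: subr0_eq.
  by transitivity ((e * e) * (2 * d * d')); [ring|rewrite e2 mul0r].
have [s hs] : exists s, 3 * (g * h) = e * s by exists (3 * g * d'); rewrite hE; ring.
(* [4/3 = e - (N - 1)], so the [2 N] factors of the symbol straddle [e]. *)
have Zp : poch (4 / 3 : R) (2 * N) = - (e * (N.-1`!)%:R * (N`!)%:R).
  have N1 : (0 < N)%N by clear -hN p5; lia.
  have := poch_centered e2 N.-1; rewrite prednK //.
  rewrite (_ : N.-1 + N.+1 = 2 * N)%N; last by clear -N1; lia.
  have -> : (-1) ^+ N.-1 = -1 :> R.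
    by have := sgnN; rewrite -{1}(prednK N1) exprS mulN1r => /eqP; rewrite eqr_oppLR => /eqP.
  have -> : e - N.-1%:R = 4 / 3 :> R.
    have : N.-1%:R = N%:R - 1 :> R by rewrite -{2}(prednK N1) -addn1 natrD addrK.
    move=> ->; rewrite eN; transitivity (1 / 3 + 3 / 3 : R); last by ring.
    by rewrite divrr //; ring.
  by move=> ->; ring.
have key : e * s * q * (p.-1`!)%:R = - (e * ((27 / 8) ^+ N) ^+ 4 * P * (N`!)%:R * (N.-1`!)%:R * (N`!)%:R).
  rewrite -hs gV /V2 V2E.
  transitivity (- (((27 / 8) ^+ N) ^+ 2 * P * (q / q) * (3 * W2 * (p.-1`!)%:R))); first by ring.
  by rewrite divrr // W2E Zp; ring.
have er : e * ((27 / 8) ^+ N) ^+ 4 = e by rewrite -exprM (mulnC N 4) mulp_ratio.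
have eq : e * q = e * (N`!)%:R.
  rewrite /q (_ : 1 - p%:R = 1 + e * - 3); last by rewrite pe; ring.
  by rewrite mul_poch_nil // poch1.
have eF := mulp_wilson.
have eF2 : e * (((2 * N)`!)%:R * (N`!)%:R) = - e.
  rewrite -eF fact_eq; transitivity (((2 * N)`!)%:R * (e * (N`!)%:R)); first by ring.
  by rewrite -eq; ring.
(* Modulo [e], [N] is [-1/3]; this therefore amounts to [e s = 3 e = p]. *)
have es : e * s * N%:R = - e.
  have f1 : (N.-1`!)%:R * N%:R = (N`!)%:R :> R.
    by have := factS N.-1; rewrite -natrM mulnC prednK => [->//|]; clear -hN p5; lia.
  have uN1 : ((N.-1`!)%:R : R) \is a GRing.unit by apply: (unit_fact hR); clear -hN; lia.
  apply: (mulIr uN1); transitivity (e * s * ((N.-1`!)%:R * N%:R)); first by ring.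
  rewrite f1.
  transitivity (- (s * (N`!)%:R * (e * (p.-1`!)%:R))); first by rewrite eF; ring.
  transitivity (- (e * s * q * (p.-1`!)%:R)).
    by transitivity (- (s * (p.-1`!)%:R * (e * (N`!)%:R))); [ring|rewrite -eq; ring].
  rewrite key opprK.
  transitivity ((e * ((27 / 8) ^+ N) ^+ 4) * (P * (N`!)%:R * (N`!)%:R) * (N.-1`!)%:R); first by ring.
  rewrite er poch_two_thirds; transitivity (e * (((2 * N)`!)%:R * (N`!)%:R) * (N.-1`!)%:R); first by ring.
  by rewrite eF2; ring.
rewrite hs pe.
transitivity (- 3 * (e * s * N%:R) + (e * e) * (3 * s)).
  by rewrite eN; transitivity (e * s * (3 / 3)); [rewrite divrr // mulr1|ring].
by rewrite es e2; ring.
Qed.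
End OneModThree.

(** * The case p = 3 n + 2, where n is odd *)

Section TwoModThree.
Variables (b : nat).
Let n := (2 * b + 1)%N.
Hypothesis hn : (3 * n + 2 = p)%N.
Variable x : R.
Hypothesis hx : 216 * x = -1.
Let g := gsum p x.
Let h := 3 * gwsum p x + g / 3.

Let sgnn : (-1) ^+ n = -1 :> R. Proof. by rewrite /n exprD exprM sqrrN expr1n expr1n expr1 mul1r. Qed.
Let en : n%:R = e - 2 / 3 :> R.
Proof.
apply: (mulrI u3); rewrite mulrBr -pe mulrCA divrr // mulr1 -hn natrD natrM addrK //.
Qed.

Let P : R := poch (4 / 3) n.
Let q : R := poch (1 - p%:R) n.
Let Q : R := poch (b%:R + 3 / 2) n.
Let G : R := ((2 * n + 1)`!)%:R.

Let fact_eq : (p.-1`!)%:R = - (G * q).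
Proof.
rewrite (@fact_pred_rev n); last by lia.
rewrite (_ : p.-1 - n = 2 * n + 1)%N; last by lia.
by rewrite sgnn mulrN1 mulNr.
Qed.

Let uq : q \is a GRing.unit.
Proof.
have : ((p.-1`!)%:R : R) \is a GRing.unit by apply: (unit_fact hR); rewrite prednK ?prime_gt0.
by rewrite fact_eq unitrN unitrM => /andP[].
Qed.

Let Qsqr : Q ^+ 2 = (n`!)%:R * q.
Proof.
have e3 : 2 * (p%:R / 2) = p%:R :> R by rewrite mulrCA divrr // mulr1.
rewrite /q -e3 -poch_sqr_nil; last first.
  by rewrite mulrACA -expr2 p20 mul0r.
rewrite /Q (poch_rev (b%:R + 3 / 2)) sgnn mulN1r sqrrN; congr (_ ^+ 2); apply: (congr1 (fun z : R => poch z n)).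
apply: (mulrI u2).
transitivity (2 - (b%:R * 2 + 3 * (2 / 2)) - 2 * n%:R : R); first by ring.
rewrite divrr // mulrBr e3 -hn natrD natrM /n natrD natrM; ring.
Qed.

Let uQ : Q \is a GRing.unit.
Proof. by rewrite -(@unitrX_pos _ _ 2) // Qsqr unitrM uq (unit_fact hR) //; lia. Qed.

(** Let [f i] be the symbol at [n + 1 - i e]. Reflection gives [P = - f 2] and the shift from [1/3]
    to [4/3] gives [P = (p - 1) f 1]. As [f] is affine, these two relations determine [P] from
    [f 0 = (2 n)! / n!]. *)
Let P_fact : P * (n`!)%:R = (2 * p%:R - 1) * ((2 * n)`!)%:R.
Proof.
have aff : affine e (fun i => poch (n.+1%:R - i%:R * e) n).
  by apply: (affine_poch e2); exists n.+1%:R, (- 1) => i; ring.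
have [c [d hf]] := aff.
have nS : n.+1%:R = e + 1 / 3 :> R.
  rewrite -addn1 natrD en; transitivity (e - 2 / 3 + 3 / 3); first by rewrite divrr.
  by ring.
have f2 : P = - poch (n.+1%:R - 2%:R * e) n.
  rewrite [in RHS]poch_rev sgnn mulN1r opprK; apply: (congr1 (fun z : R => poch z n)); rewrite nS en.
  transitivity (1 / 3 + 3 / 3 : R); first by ring.
  by rewrite divrr //; ring.
have f1 : P = (p%:R - 1) * poch (n.+1%:R - 1%:R * e) n.
  have -> : n.+1%:R - 1%:R * e = 1 / 3 by rewrite nS; ring.
  have := poch_shift (1 / 3 : R) n.
  have -> : 1 / 3 + 1 = 4 / 3 :> R.
    by transitivity (1 / 3 + 3 / 3 : R); [rewrite divrr|ring].
  rewrite -/P => h1.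
  transitivity (3 * (1 / 3 * P)); first by transitivity (3 / 3 * P); [rewrite divrr // mul1r|ring].
  rewrite h1 en pe.
  transitivity ((3 * e - 3 / 3) * poch (1 / 3) n); first by ring.
  by rewrite divrr.
have f0 := hf 0%N; rewrite mul0r subr0 mul0r addr0 in f0.
rewrite !hf in f1 f2.
rewrite mul2n -addnn -(poch_natS _ n n) f0 mulrA; congr (_ * _).
rewrite f1 pe in f2.
have f3 : e * d = - (3 * e * c).
  apply: subr0_eq; move/eqP: f2; rewrite -subr_eq0 => /eqP; set E := (X in X = 0) => f2.
  transitivity (E - 3 * (e * e) * d); first by rewrite /E; ring.
  by rewrite f2 e2; ring.
rewrite f1 f3 pe; apply: subr0_eq.
by transitivity (- 9 * (e * e) * c); [ring|rewrite e2; ring].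
Qed.

Let uP : P \is a GRing.unit.
Proof.
have : ((2 * p%:R - 1) * ((2 * n)`!)%:R : R) \is a GRing.unit.
  rewrite unitrM (unit_fact hR) ?andbT; last by clear -hn; lia.
  have := @unit_addr_nil R e e2 (-1) 6 (unitrN1 R).
  by rewrite (_ : -1 + e * 6 = 2 * p%:R - 1) // pe; ring.
by rewrite -P_fact unitrM => /andP[].
Qed.

Let Z : R := poch (5 / 3) (2 * n).
Let r : R := (27 / 8) ^+ n.
Let rP : reduces p (poch (4 / 3) n) P.
Proof. exact/(reduces_poch hR)/rdiv. Qed.

Let rQ : reduces p (poch (b%:R + 3 / 2) n) Q.
Proof.
by apply: (reduces_poch hR); apply: (reducesD hR); [exact: (reduces_nat hR)|exact: rdiv].
Qed.

Let c1 : 1 / 3 - 1%:R * e = - n%:R - 1 / 3 :> R. Proof. by rewrite en; ring. Qed.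
Let c2 : 1 / 3 - 2%:R * e = - (2 * n + 1)%:R :> R.
Proof.
rewrite natrD natrM en; transitivity (4 / 3 - 3 / 3 - 2 * e : R); first by ring.
by rewrite divrr //; ring.
Qed.

Let uF : ((p.-1`!)%:R : R) \is a GRing.unit.
Proof. by rewrite (unit_fact hR) // prednK ?prime_gt0. Qed.
Let p1n : (3 * n + 1 = p.-1)%N. Proof. by clear -hn; lia. Qed.

Let r1 : reduces p (- n%:R - 1 / 3) (1 / 3 - 1%:R * e).
Proof.
rewrite c1; apply: (reducesD hR); first by apply/reducesN/(reduces_nat hR).
by apply: reducesN; exact: (@rdiv 1 3 u3).
Qed.
Let r2 : reduces p (- (2 * n + 1)%:R) (1 / 3 - 2%:R * e).
Proof. by rewrite c2; apply/reducesN/(reduces_nat hR). Qed.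

Let V1E : hyp_sum (1 / 3 - 1%:R * e) p = 0.
Proof. by apply: (hyp_eq r1); rewrite hyp_sum_third_odd; [exact: (reduces0 hR)|clear -hn; lia]. Qed.

Let W1E : hyp_wsum (1 / 3 - 1%:R * e) p = - (r * P / Q).
Proof.
apply: (hyp_weq r1); rewrite hyp_wsum_third_odd; last by clear -hn; lia.
apply: reducesN; apply: (reducesM hR); last exact: (reducesV hR).
by apply: (reducesM hR) => //; exact: (reducesX hR).
Qed.

Let V2E : 4 * hyp_sum (1 / 3 - 2%:R * e) p * (p.-1`!)%:R = 3 * r ^+ 2 * (n`!)%:R * Z.
Proof.
have u4 : (4 : R) \is a GRing.unit by rewrite (_ : 4 = 2 * 2 :> R) ?unitrM ?u2 //; ring.
suff -> : hyp_sum (1 / 3 - 2%:R * e) p =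
   3 / 4 * (27 / 8) ^+ (2 * n) * (n`!)%:R * Z / ((3 * n + 1)`!)%:R.
  rewrite -p1n -mulrA divrK ?p1n // /r -exprM (mulnC n 2).
  by transitivity (3 * (4 / 4) * (27 / 8) ^+ (2 * n) * (n`!)%:R * Z : R); [ring|rewrite divrr // mulr1].
apply: (hyp_eq r2); rewrite hyp_sum_nat_odd; last by clear -hn; lia.
apply: (reducesM hR); last by apply: (reducesV hR); [exact: (reduces_nat hR)|rewrite p1n].
apply: (reducesM hR); last exact/(reduces_poch hR)/rdiv.
apply: (reducesM hR); last exact: (reduces_nat hR).
by apply: (reducesM hR); [exact: rdiv|exact: (reducesX hR)].
Qed.

Let W2E : 2 * hyp_wsum (1 / 3 - 2%:R * e) p * q = 3 * r ^+ 2 * P.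
Proof.
suff -> : hyp_wsum (1 / 3 - 2%:R * e) p =
   - (3 / 2) * (27 / 8) ^+ (2 * n) * G * P / ((3 * n + 1)`!)%:R.
  have uG : G \is a GRing.unit by move: uF; rewrite fact_eq unitrN unitrM => /andP[].
  apply: (mulIr uG).
  have Gq : G * q = - (p.-1`!)%:R by rewrite fact_eq opprK.
  rewrite p1n.
  transitivity (- 3 * (2 / 2) * (27 / 8) ^+ (2 * n) * P * (G * q) / (p.-1`!)%:R * G : R); first by ring.
  rewrite Gq; transitivity (3 * (2 / 2) * (27 / 8) ^+ (2 * n) * P * G * ((p.-1`!)%:R / (p.-1`!)%:R) : R).
    by ring.
  by rewrite !divrr // /r -exprM (mulnC n 2); ring.
apply: (hyp_weq r2); rewrite hyp_wsum_nat_odd; last by clear -hn; lia.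
apply: (reducesM hR); last by apply: (reducesV hR); [exact: (reduces_nat hR)|rewrite p1n].
apply: (reducesM hR) => //.
apply: (reducesM hR); last exact: (reduces_nat hR).
by apply: (reducesM hR); [apply: reducesN; exact: rdiv|exact: (reducesX hR)].
Qed.

Let unf : ((n`!)%:R : R) \is a GRing.unit. Proof. by apply: (unit_fact hR); clear -hn; lia. Qed.
Let ur : r \is a GRing.unit. Proof. by rewrite unitrX // unitrM u27 unitrV. Qed.
Let n1E : 3 * (n.+1%:R : R) = p%:R + 1.
Proof.
by rewrite -[n.+1]addn1 (natrD _ n) en pe; transitivity (3 * e - 2 * (3 / 3) + 3 : R); [ring|rewrite divrr //; ring].
Qed.
Let n21E : 3 * ((2 * n + 1)%:R : R) = 2 * p%:R - 1.
Proof.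
by rewrite (natrD _ (2 * n)) natrM en pe; transitivity (6 * e - 4 * (3 / 3) + 3 : R); [ring|rewrite divrr //; ring].
Qed.

(** The roles are exchanged: the weighted sums now satisfy [h W2 = W1^2], with the same
    cancellation, leaving [3 h = 2 P / n!]. *)
Lemma deriv_two_mod3 : 3 * h = 2 * (1 + p%:R) * ('C(2 * n + 1, n))%:R.
Proof.
have [_ h2] := gsum_interp hR p5 hx.
have [d hd] := interp_wsum.
pose W1 := hyp_wsum (1 / 3 - 1%:R * e) p; pose W2 := hyp_wsum (1 / 3 - 2%:R * e) p.
have hW : h * W2 = W1 ^+ 2.
  rewrite /h h2 -/W1 -/W2 [W1]hd -/W2; apply: subr0_eq.
  by transitivity (- (e * e) * d ^+ 2); [ring|rewrite e2; ring].
have hP : 3 * h * (n`!)%:R = 2 * P.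
  apply: (mulIr (unitrX 2 ur)); apply: (mulIr uP); apply: (mulIr uq).
  transitivity ((n`!)%:R * q * h * (3 * r ^+ 2 * P)); first by ring.
  rewrite -W2E -/W2; transitivity ((n`!)%:R * q * 2 * (h * W2) * q); first by ring.
  rewrite hW /W1 W1E sqrrN -Qsqr.
  transitivity (2 * P * r ^+ 2 * P * q * (Q / Q) ^+ 2); first by ring.
  by rewrite divrr // expr1n mulr1.
have bin : ('C(2 * n + 1, n))%:R * ((n`!)%:R * (n.+1%:R * (n`!)%:R)) = (2 * n + 1)%:R * ((2 * n)`!)%:R :> R.
  rewrite -!natrM -factS; congr (_%:R).
  have /bin_fact : (n <= 2 * n + 1)%N by clear; lia.
  rewrite (_ : 2 * n + 1 - n = n.+1)%N; last by clear; lia.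
  by move=> ->; rewrite addn1 factS.
have un1 : (n.+1%:R : R) \is a GRing.unit by apply: (unit_lt hR); clear -hn; lia.
apply: (mulIr unf); rewrite hP; apply: (mulIr unf); apply: (mulIr un1); apply: (mulIr u3).
transitivity (2 * (P * (n`!)%:R) * (3 * n.+1%:R)); first by ring.
rewrite P_fact n1E.
transitivity (2 * (1 + p%:R) * (3 * ((2 * n + 1)%:R * ((2 * n)`!)%:R)) : R).
  by rewrite -n21E; ring.
by rewrite -bin; ring.
Qed.

Lemma value_two_mod3 : g ^+ 2 = 0 /\ 3 * (g * h) = - p%:R.
Proof.
have [g2 h2] := gsum_interp hR p5 hx.
have [d hd] := interp_sum; have [d' hd'] := interp_wsum.
pose V2 := hyp_sum (1 / 3 - 2%:R * e) p; pose W2 := hyp_wsum (1 / 3 - 2%:R * e) p.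
have V2d : V2 = - (e * d) by apply: subr0_eq; rewrite opprK /V2 -hd V1E.
have gE : g = e * d by rewrite /g g2 V1E -/V2 V2d; ring.
have gV : g = - V2 by rewrite gE V2d opprK.
split; first by rewrite gE exprMn (expr2 e) e2 mul0r.
have gW : g * h = - (V2 * W2).
  rewrite gV V2d /h h2 hd' -/W2; apply: subr0_eq.
  by transitivity ((e * e) * (2 * d * d')); [ring|rewrite e2 mul0r].
have [s hs] : exists s, g * h = e * s by exists (d * h); rewrite gE; ring.
have n0 : (0 < n)%N by rewrite /n addn1.
have Zp : Z = e * (n.-1`!)%:R * (n`!)%:R.
  have := poch_centered e2 n.-1; rewrite prednK //.
  rewrite (_ : n.-1 + n.+1 = 2 * n)%N; last by clear -n0; lia.
  have -> : (-1) ^+ n.-1 = 1 :> R by rewrite /n addn1 /= exprM sqrrN expr1n expr1n.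
  have -> : e - n.-1%:R = 5 / 3 :> R.
    have : n.-1%:R = n%:R - 1 :> R by rewrite -{2}(prednK n0) -addn1 natrD addrK.
    move=> ->; rewrite en; transitivity (2 / 3 + 3 / 3 : R); last by ring.
    by rewrite divrr //; ring.
  by rewrite mul1r.
have key : 8 * (e * s) * q * (p.-1`!)%:R
    = - (9 * (e * r ^+ 4) * (P * (n`!)%:R) * (n.-1`!)%:R * (n`!)%:R).
  rewrite -hs gW.
  transitivity (- ((4 * V2 * (p.-1`!)%:R) * (2 * W2 * q))); first by ring.
  by rewrite V2E W2E Zp; ring.
have er : 81 * (e * r ^+ 4) = 16 * e by rewrite /r -exprM (mulnC n 4) mulp_ratio2.
have eq : e * q = e * (n`!)%:R.
  rewrite /q (_ : 1 - p%:R = 1 + e * - 3); last by rewrite pe; ring.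
  by rewrite mul_poch_nil // poch1.
have eF := mulp_wilson.
have eG : e * (G * (n`!)%:R) = e.
  apply: oppr_inj; rewrite -eF fact_eq.
  by transitivity (- (G * (e * (n`!)%:R))); [ring|rewrite -eq; ring].
have eP : e * (P * (n`!)%:R) = - (e * ((2 * n)`!)%:R).
  rewrite P_fact pe; apply: subr0_eq.
  by transitivity (6 * (e * e) * ((2 * n)`!)%:R); [ring|rewrite e2; ring].
have GE : G = (2 * n + 1)%:R * ((2 * n)`!)%:R by rewrite /G addn1 factS natrM.
have un1 : ((n.-1`!)%:R : R) \is a GRing.unit by apply: (unit_fact hR); clear -hn; lia.
have f1 : (n.-1`!)%:R * n%:R = (n`!)%:R :> R.
  by have := factS n.-1; rewrite -natrM mulnC prednK // => ->.
have e1 : - 648 * (e * s) * n%:R * (2 * n + 1)%:R = 144 * e.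
  apply: (mulIr un1).
  transitivity (81 * (8 * s * (n`!)%:R * (e * (p.-1`!)%:R)) * (2 * n + 1)%:R).
    by rewrite eF -f1; ring.
  transitivity (81 * (8 * (e * s) * q * (p.-1`!)%:R) * (2 * n + 1)%:R).
    transitivity (81 * (8 * s * (p.-1`!)%:R * (e * (n`!)%:R)) * (2 * n + 1)%:R); first by ring.
    by rewrite -eq; ring.
  rewrite key.
  transitivity (- 9 * (81 * (e * r ^+ 4)) * (P * (n`!)%:R) * (n.-1`!)%:R * (n`!)%:R * (2 * n + 1)%:R).
    by ring.
  rewrite er; transitivity (- 144 * (e * (P * (n`!)%:R)) * (n.-1`!)%:R * (n`!)%:R * (2 * n + 1)%:R).
    by ring.
  rewrite eP; transitivity (144 * (n.-1`!)%:R * (e * (G * (n`!)%:R))); first by rewrite GE; ring.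
  by rewrite eG; ring.
(* Modulo [e], [3 n = -2] and [3 (2 n + 1) = -1], so the left side of [e1] is [-144 e s]. *)
have e3 : 144 * (e * s) = - (144 * e).
  rewrite -e1; transitivity (72 * (e * s) * (3 * n%:R) * (3 * (2 * n + 1)%:R)); last by ring.
  rewrite n21E en pe.
  transitivity (72 * (e * s) * (2 * (3 / 3)) + (e * e) * 0); first by rewrite divrr //; ring.
  transitivity (72 * (e * s) * (2 * (3 / 3)) + (e * e) * (72 * s * (18 * e - 3 - 12 * (3 / 3)))).
    by rewrite e2; ring.
  by ring.
have u144 : (144 : R) \is a GRing.unit.
  have -> : 144 = 2 ^+ 4 * 3 ^+ 2 :> R by ring.
  by rewrite unitrM !unitrX.
have -> : g * h = - e by rewrite hs; apply: (mulrI u144); rewrite e3 mulrN.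
by rewrite pe mulrN.
Qed.
End TwoModThree.
End Cases.

(** * Jacobi sums modulo p^2 *)

Lemma val_Fp_ltp p (hp : prime p) (t : 'F_p) : (t < p)%N.
Proof. by have := ltn_ord t; rewrite [X in (_ < X)%N]Fp_cast. Qed.

Lemma Fp_sub1 p (hp : prime p) (t : 'F_p) : 1 - t = (1 + (p - t))%:R.
Proof.
rewrite natrD natrB ?(ltnW (val_Fp_ltp hp t)) // natr_Zp.
by rewrite (_ : p%:R = 0 :> 'F_p) ?sub0r //; apply: pchar_Fp_0.
Qed.

Lemma Fp_fermat p (hp : prime p) (t : 'F_p) : t != 0 -> t ^+ p.-1 = 1.
Proof.
move=> t0; apply: (mulIf t0); rewrite mul1r -exprSr prednK ?prime_gt0 //.
rewrite -[t]natr_Zp -natrX; apply: val_inj => /=.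
by rewrite !val_Fp_nat //; exact: fermat_little.
Qed.

(** Otherwise [X^r - 1], with [r] the residue of [m] modulo [p - 1], would have more roots than its
    degree. *)
Lemma exists_expr_neq1 p (hp : prime p) m : ~~ (p.-1 %| m)%N -> exists2 z : 'F_p, z != 0 & z ^+ m != 1.
Proof.
move=> hm; pose r := (m %% p.-1)%N.
have p1 : (1 < p)%N := prime_gt1 hp.
have r0 : (0 < r)%N by rewrite lt0n.
have rp : (r < p.-1)%N by rewrite ltn_mod -ltnS prednK // ltnW.
have zr (z : 'F_p) : z != 0 -> z ^+ m = z ^+ r.
  by move=> z0; rewrite {1}(divn_eq m p.-1) exprD mulnC exprM (Fp_fermat hp) // expr1n mul1r.
have [/existsP[z /andP[z0 z1]]|/existsPn H] := boolP [exists z : 'F_p, (z != 0) && (z ^+ r != 1)].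
  by exists z => //; rewrite zr.
pose P : {poly 'F_p} := 'X^r - 1.
have P0 : P != 0 by rewrite -size_poly_eq0 size_XnsubC.
have := @max_poly_roots _ P (enum [pred z : 'F_p | z != 0]) P0.
rewrite enum_uniq size_XnsubC // => /(_ _ isT) => h.
have : (#|[pred z : 'F_p | z != 0]%R| < r.+1)%N.
  rewrite cardE; apply: h; apply/allP => z; rewrite mem_enum inE => z0.
  by rewrite rootE !hornerE subr_eq0; have := H z; rewrite z0 /= negbK.
have := cardC1 (0 : 'F_p); rewrite card_Fp // => -> .
by rewrite ltnS leqNgt rp.
Qed.

Section Teichmuller.
Variables (p : nat) (R : comUnitRingType).
Hypothesis hR : mod_sqr p R.

Let hp : prime p. Proof. by case: hR. Qed.
Let p20 : p%:R ^+ 2 = 0 :> R. Proof. by case: hR. Qed.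

Lemma exprDp (x d : R) n : (x + p%:R * d) ^+ n.+1 = x ^+ n.+1 + n.+1%:R * (p%:R * d) * x ^+ n.
Proof.
elim: n => [|n IH]; first by rewrite !expr1 expr0; ring.
have nS : n.+2%:R = n.+1%:R + 1 :> R by rewrite -[n.+2]addn1 natrD.
rewrite exprS IH nS (exprS x n.+1) (exprS x n).
transitivity (x * (x * x ^+ n) + (n.+1%:R + 1) * (p%:R * d) * (x * x ^+ n)
  + p%:R ^+ 2 * (d ^+ 2 * n.+1%:R * x ^+ n)); first by ring.
by rewrite p20 mul0r addr0.
Qed.

Lemma exprDp_p (x d : R) : (x + p%:R * d) ^+ p = x ^+ p.
Proof.
have := exprDp x d p.-1; rewrite prednK ?prime_gt0 // => ->.
transitivity (x ^+ p + p%:R ^+ 2 * (d * x ^+ p.-1)); first by ring.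
by rewrite p20 mul0r addr0.
Qed.

Lemma natr_modp m n : m = n %[mod p] -> exists d, m%:R = n%:R + p%:R * d :> R.
Proof.
move=> h; exists ((m %/ p)%:R - (n %/ p)%:R).
by rewrite {1}(divn_eq m p) {1}(divn_eq n p) h !natrD !natrM; ring.
Qed.

(* Since [p ^ 2 = 0] in [R], the [p]-th power of a lift depends only on its residue class. *)
Definition teich (t : 'F_p) : R := (t : nat)%:R ^+ p.

Lemma teich_nat n : teich n%:R = n%:R ^+ p.
Proof.
rewrite /teich val_Fp_nat //.
by have [d ->] := natr_modp (modn_mod n p); rewrite exprDp_p.
Qed.

Lemma teichM s t : teich (s * t) = teich s * teich t.
Proof. by rewrite -[s]natr_Zp -[t]natr_Zp -natrM !teich_nat natrM exprMn. Qed.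

Lemma teich1 : teich 1 = 1. Proof. by rewrite (teich_nat 1) expr1n. Qed.
Lemma teich0 : teich 0 = 0. Proof. by rewrite (teich_nat 0) expr0n gtn_eqF ?prime_gt0. Qed.

Lemma teichX t n : teich (t ^+ n) = teich t ^+ n.
Proof.
by elim: n => [|n IH]; rewrite ?expr0 ?teich1 // !exprS teichM IH.
Qed.

Lemma teich_lift t : exists d, teich t = (t : nat)%:R + p%:R * d.
Proof. by rewrite /teich -natrX; apply/natr_modp/fermat_little. Qed.

Lemma teich_expp t : teich t ^+ p = teich t.
Proof. by have [d e] := teich_lift t; rewrite {1}e exprDp_p. Qed.

Lemma teich_sub_unit s t : s != t -> teich s - teich t \is a GRing.unit.
Proof.
have pn : (p%:R : R) * p%:R = 0 by rewrite -expr2.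
have main (a b : nat) : (a < b)%N -> (b < p)%N -> forall d, b%:R - a%:R + p%:R * d \is a @GRing.unit R.
  move=> ab bp d; apply: unit_addr_nil => //.
  by rewrite -natrB ?(ltnW ab) // (unit_lt hR) //; lia.
have [d ->] := teich_lift s; have [d' ->] := teich_lift t => st.
case: (ltngtP s t) => [h|h|h].
- rewrite -unitrN (_ : - _ = (t : nat)%:R - (s : nat)%:R + p%:R * (d' - d)); last by ring.
  by apply: main => //; exact: (val_Fp_ltp hp).
- rewrite (_ : _ - _ = (s : nat)%:R - (t : nat)%:R + p%:R * (d - d')); last by ring.
  by apply: main => //; exact: (val_Fp_ltp hp).
- by case/eqP: st; exact: val_inj.
Qed.

(** Orthogonality of characters. Cancelling [z^m - 1] takes a unit, not merely a nonzero element;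
    this is where [teich_sub_unit] enters. *)
Lemma sum_teich m : (0 < m)%N ->
  \sum_(t : 'F_p) teich t ^+ m = if (p.-1 %| m)%N then p%:R - 1 else 0.
Proof.
move=> m0; case: ifP => [/dvdnP[k hk]|/negbT hm].
  rewrite (bigD1 (0 : 'F_p)) //= teich0 expr0n gtn_eqF // add0r.
  rewrite (eq_bigr (fun=> 1)) => [|t t0]; last first.
    by rewrite -teichX hk mulnC exprM (Fp_fermat hp) // expr1n teich1.
  rewrite sumr_const; have := cardC1 (0 : 'F_p); rewrite card_Fp // => ->.
  by rewrite -subn1 natrB // prime_gt0.
have [z z0 zm] := exists_expr_neq1 hp hm.
have u := teich_sub_unit zm; apply: (mulrI u); rewrite mulr0 mulrBl teich1 mul1r.
rewrite [X in _ - X](reindex_inj (mulfI z0)) /= mulr_sumr -sumrB big1 // => t _.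
by rewrite teichM exprMn teichX subrr.
Qed.

Lemma sum_teich_binomial k b : (0 < k)%N ->
  \sum_(t : 'F_p) teich t ^+ k * (1 - teich t) ^+ b =
  \sum_(j < b.+1) (if (p.-1 %| k + j)%N then (-1) ^+ j * ('C(b, j))%:R * (p%:R - 1) else 0).
Proof.
move=> k0.
transitivity (\sum_(t : 'F_p) \sum_(j < b.+1) (-1) ^+ j * ('C(b, j))%:R * teich t ^+ (k + j)).
  apply: eq_bigr => t _; rewrite exprDn mulr_sumr; apply: eq_bigr => j _.
  rewrite -[_ *+ 'C(b, j)]mulr_natr expr1n mul1r (exprNn (teich t)) exprD.
  by move: ((-1) ^+ j) (teich t ^+ j) => y z; ring.
rewrite exchange_big; apply: eq_bigr => j _ /=.
by rewrite -mulr_sumr sum_teich ?addn_gt0 ?k0 //; case: ifP => // _; rewrite mulr0.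
Qed.

(* Both powers on the right are first-order expansions around [teich (1 - t) ^ b]; the weights
   cancel the error term. *)
Lemma teich_expr_interp t b : (1 < b)%N ->
  teich (1 - t) ^+ b = (1 - b%:R) * (1 - teich t) ^+ b + b%:R * (1 - teich t) ^+ (b + p.-1).
Proof.
case: b => [|[|b]] // _.
have [d hd] : exists d, 1 - teich t = teich (1 - t) + p%:R * d.
  have [d1 e1] := teich_lift t.
  rewrite (Fp_sub1 hp) teich_nat -natrX.
  have [d2 ->] := natr_modp (fermat_little (1 + (p - t)) hp).
  exists (- d1 - 1 - d2).
  rewrite e1 natrD natrB ?(ltnW (val_Fp_ltp hp t)) //; ring.
rewrite hd; have := teich_expp (1 - t); move: (teich (1 - t)) => u up.
have upn m : u ^+ (m + p) = u ^+ m.+1 by rewrite exprD up -exprSr.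
have p1 : p.-1.+1 = p by rewrite prednK // prime_gt0.
rewrite (_ : b.+2 + p.-1 = (b.+1 + p.-1).+1)%N // !exprDp.
rewrite (_ : (b.+1 + p.-1).+1 = b.+1 + p)%N; last by rewrite -addnS p1.
rewrite (_ : (b.+1 + p.-1) = b + p)%N; last by rewrite addSn -addnS p1.
rewrite !upn; have -> : (b.+1 + p)%:R = b.+2%:R - 1 + p%:R :> R.
  by rewrite natrD -[b.+2]addn1 natrD; ring.
move: (b.+2%:R) (u ^+ b.+2) (u ^+ b.+1) => y z z'.
transitivity (z + p%:R ^+ 2 * (y * d * z')); first by rewrite p20 mul0r addr0.
ring.
Qed.

Section Jacobi.
Variable N : nat.
Hypothesis hN : (3 * N + 1 = p)%N.
Hypothesis evN : ~~ odd N.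
Hypothesis p5 : (5 < p)%N.

(** As [3 N = p - 1], the [N]-th power of [teich] is a cubic character; [jacobi2] belongs to its
    conjugate. *)
Definition jacobi1 : R := \sum_(t : 'F_p) teich t ^+ N * teich (1 - t) ^+ N.
Definition jacobi2 : R := \sum_(t : 'F_p) teich t ^+ (2 * N) * teich (1 - t) ^+ (2 * N).

Let N2 : (1 < N)%N. Proof. by move: evN p5; rewrite -hN; case: N => [|[|m]]. Qed.
Let p1 : p.-1 = (3 * N)%N. Proof. by rewrite -hN addn1. Qed.

Let sum_interp k b : (0 < k)%N -> (1 < b)%N ->
  \sum_(t : 'F_p) teich t ^+ k * teich (1 - t) ^+ b =
  (1 - b%:R) * (\sum_(t : 'F_p) teich t ^+ k * (1 - teich t) ^+ b)
  + b%:R * (\sum_(t : 'F_p) teich t ^+ k * (1 - teich t) ^+ (b + p.-1)).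
Proof.
move=> k0 b1; rewrite !mulr_sumr -big_split; apply: eq_bigr => t _ /=.
by rewrite teich_expr_interp //; ring.
Qed.

Let dvd3N m : (3 * N %| m)%N -> (m < 9 * N)%N -> [\/ m = 0, m = 3 * N | m = 6 * N]%N.
Proof.
move=> /dvdnP[[|[|[|k]]] ->] h; [by constructor 1|by constructor 2; lia|by constructor 3; lia|].
by move: h N2; nia.
Qed.

(** In the two binomial sums the exponent [N + j] runs up to [2 N] and [5 N]; the only multiple of
    [3 N] it meets is [3 N], in the second, at [j = 2 N]. *)
Lemma jacobi1_eq : jacobi1 = N%:R * (('C(4 * N, 2 * N))%:R * (p%:R - 1)).
Proof.
rewrite /jacobi1 sum_interp ?(ltnW N2) // !sum_teich_binomial ?(ltnW N2) // p1.
rewrite big1 => [|j _]; last first.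
  have hj := ltn_ord j; case: ifP => // /dvd3N; case; lia.
have h2 : (2 * N < (N + 3 * N).+1)%N by lia.
rewrite mulr0 add0r (bigD1 (Ordinal h2)) //= big1 => [|j jN]; last first.
  have hj := ltn_ord j; case: ifP => // /dvd3N; case; try lia.
  by move=> e; case/eqP: jN; apply: val_inj => /=; lia.
rewrite (_ : N + 2 * N = 3 * N)%N; last by lia.
rewrite dvdnn addr0 exprM sqrrN !expr1n mul1r.
by rewrite (_ : N + 3 * N = 4 * N)%N; last by lia.
Qed.

(** Here [2 N + j] runs up to [4 N] and [7 N]. The first sum contributes [j = N], the second [j = N]
    and [j = 4 N], with equal binomials. *)
Lemma jacobi2_eq : jacobi2 = (p%:R - 1) *
  ((1 - (2 * N)%:R) * ('C(2 * N, N))%:R + (2 * N)%:R * (2 * ('C(5 * N, N))%:R)).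
Proof.
have NN : (0 < 2 * N)%N by lia.
rewrite /jacobi2 sum_interp //; last by lia.
rewrite !sum_teich_binomial // p1.
have sg : (-1) ^+ N = 1 :> R by rewrite -signr_odd (negPf evN).
have h1 : (N < (2 * N).+1)%N by lia.
rewrite (bigD1 (Ordinal h1)) //= big1 => [|j jN]; last first.
  have hj := ltn_ord j; case: ifP => // /dvd3N; case; try lia.
  by move=> e; case/eqP: jN; apply: val_inj => /=; lia.
have h2 : (N < (2 * N + 3 * N).+1)%N by lia.
have h3 : (4 * N < (2 * N + 3 * N).+1)%N by lia.
rewrite (bigD1 (Ordinal h2)) //= (bigD1 (Ordinal h3)) /=; last first.
  by apply/eqP => /(congr1 val) /=; lia.
rewrite big1 => [|j /andP[jN j4]]; last first.
  have hj := ltn_ord j; case: ifP => // /dvd3N; case; try lia.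
    by move=> e; case/eqP: jN; apply: val_inj => /=; lia.
  by move=> e; case/eqP: j4; apply: val_inj => /=; lia.
rewrite (_ : 2 * N + N = 3 * N)%N; last by lia.
rewrite (_ : 2 * N + 4 * N = 2 * (3 * N))%N; last by lia.
rewrite dvdnn dvdn_mull // sg (_ : 2 * N + 3 * N = 5 * N)%N; last by lia.
have -> : 'C(5 * N, 4 * N) = 'C(5 * N, N).
  by rewrite -bin_sub; [congr 'C(_, _)|]; lia.
rewrite (mulnC 4 N) exprM sg expr1n; ring.
Qed.

End Jacobi.
End Teichmuller.

(** * Orbits of size three and uniqueness of 4 p = x^2 + 27 y^2 *)

Lemma dvdn3_card (T : finType) (f : T -> T) (A : {set T}) :
  (forall t, t \in A -> [/\ f t \in A, f t != t & f (f (f t)) = t]) -> (3 %| #|A|)%N.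
Proof.
move: {2}(#|A|) (leqnn #|A|) => n; elim: n A => [|n IH] A hn hA.
  by move: hn; rewrite leqn0 => /eqP ->.
case: (set_0Vmem A) => [->|[t tA]]; first by rewrite cards0.
have [ftA ft e3] := hA t tA; have [fftA fft e3'] := hA _ ftA.
have fft' : f (f t) != t by apply/eqP => e; move: ft; rewrite -{1}e e3 eqxx.
pose B := A :\ t :\ f t :\ f (f t).
have cA : (#|A| = 3 + #|B|)%N.
  rewrite (cardsD1 t) tA (cardsD1 (f t)) !inE ftA ft.
  by rewrite (cardsD1 (f (f t))) !inE fftA fft fft'.
rewrite cA dvdn_addr //; apply: IH; first by move: hn; rewrite cA; lia.
move=> s; rewrite !inE => /and4P[s1 s2 s3 sA]; have [fsA fs es] := hA s sA.
split=> //; rewrite fsA andbT; apply/and3P; split.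
- by apply/eqP => e; move: s2; rewrite -es e e3 eqxx.
- by apply/eqP => e; move: s3; rewrite -es e e3 eqxx.
- by apply/eqP => e; move: s1; rewrite -es e eqxx.
Qed.

(** Composing the two representations gives [16 p^2 = (x a + 27 y b)^2 + 27 (x b - a y)^2] and the
    same with [y] negated. By [key], [p] divides [x b - a y] or [x b + a y]; that number is zero, as
    otherwise [27 p^2 <= 16 p^2]. *)
Lemma sqr_norm_form_unique (p : nat) (x y a b : int) : prime p ->
  (4 * p)%:R = x ^+ 2 + 27 * y ^+ 2 -> (4 * p)%:R = a ^+ 2 + 27 * b ^+ 2 ->
  x ^+ 2 = a ^+ 2.
Proof.
move=> hp hx ha; have p0 : (0 : int) < p%:R by rewrite ltr0n prime_gt0.
have h4 : (4 * p)%:R = 4 * p%:R :> int by rewrite natrM.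
rewrite {}h4 in hx ha.
have small (c d : int) : 16 * p%:R ^+ 2 = c ^+ 2 + 27 * d ^+ 2 -> (p%:Z %| d)%Z -> d = 0.
  move=> e /dvdzP[k hk]; apply/eqP; apply/negPn/negP => d0.
  have k1 : 1 <= k ^+ 2.
    rewrite -gtz0_ge1 exprn_even_gt0 //=; apply: contraNneq d0 => k0.
    by rewrite hk k0 mul0r.
  have : 27 * (k ^+ 2 * p%:R ^+ 2) <= 16 * p%:R ^+ 2 :> int.
    have -> : 27 * (k ^+ 2 * p%:R ^+ 2) = 27 * d ^+ 2 :> int by rewrite hk natz; ring.
    by rewrite e lerDr sqr_ge0.
  have pp : 0 < p%:R ^+ 2 :> int by rewrite exprn_gt0.
  have := ler_peMl (ltW pp) k1; lra.
have key : (x * b - a * y) * (x * b + a * y) = 4 * p%:R * (b ^+ 2 - y ^+ 2).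
  transitivity ((x ^+ 2 + 27 * y ^+ 2) * b ^+ 2 - (a ^+ 2 + 27 * b ^+ 2) * y ^+ 2); first by ring.
  by rewrite -hx -ha; ring.
have dv : (p%:Z %| (x * b - a * y) * (x * b + a * y))%Z.
  by rewrite key natz; apply/dvdzP; exists (4 * (b ^+ 2 - y ^+ 2)); ring.
have xb : x * b = a * y \/ x * b = - (a * y).
  move: dv; rewrite !dvdzE abszM Euclid_dvdM // => /orP[h|h]; [left|right].
    apply: subr0_eq; apply: (small (x * a + 27 * y * b)) h.
    transitivity ((4 * p%:R) * (4 * p%:R) : int); first by ring.
    by rewrite {1}hx ha; ring.
  apply: subr0_eq; rewrite opprK; apply: (small (x * a - 27 * y * b)) h.
  transitivity ((4 * p%:R) * (4 * p%:R) : int); first by ring.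
  by rewrite {1}hx ha; ring.
have sq : x ^+ 2 * b ^+ 2 = a ^+ 2 * y ^+ 2.
  by rewrite -!exprMn; case: xb => ->; rewrite ?sqrrN.
have p40 : 4 * p%:R != 0 :> int by rewrite mulf_neq0 // gt_eqF.
apply: (mulIf p40); rewrite {1}ha hx !mulrDr.
transitivity (x ^+ 2 * a ^+ 2 + 27 * (x ^+ 2 * b ^+ 2)); first by ring.
by rewrite sq; ring.
Qed.

Lemma poch_bin (R : pzRingType) m k : poch (m.+1%:R : R) k = ('C(m + k, k) * k`!)%:R.
Proof.
elim: k => [|k IH]; first by rewrite poch0 bin0.
rewrite pochS IH -natrD -natrM factS addnS; congr (_%:R).
transitivity ((m + k).+1 * 'C(m + k, k) * k`!)%N; first by rewrite addSn; ring.
by rewrite mul_bin_diag; ring.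
Qed.

(** * Closed forms of the Jacobi sums *)

Section JacobiValues.
Variables (p : nat) (R : comUnitRingType).
Hypothesis hR : mod_sqr p R.
Hypothesis p5 : (5 < p)%N.
Variable a : nat.
Let N := (2 * a)%N.
Hypothesis hN : (3 * N + 1 = p)%N.

Let hp : prime p. Proof. by case: hR. Qed.
Let p20 : p%:R ^+ 2 = 0 :> R. Proof. by case: hR. Qed.
Let pp : (p%:R : R) * p%:R = 0. Proof. by rewrite -expr2. Qed.
Let u3 : (3 : R) \is a GRing.unit. Proof. by apply: (unit_lt hR); lia. Qed.
Let evN : ~~ odd N. Proof. by rewrite /N oddM. Qed.
Let sgnN : (-1) ^+ N = 1 :> R. Proof. by rewrite /N exprM sqrrN expr1n expr1n. Qed.
Let uNf : ((N`!)%:R : R) \is a GRing.unit. Proof. by apply: (unit_fact hR); lia. Qed.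
Let uF2 : (((2 * N)`!)%:R : R) \is a GRing.unit. Proof. by apply: (unit_fact hR); lia. Qed.
Let p1N : p.-1 = (3 * N)%N. Proof. by lia. Qed.
Let N0 : (0 < N)%N. Proof. by lia. Qed.

Let C : R := ('C(2 * N, N))%:R.

Let binC : C * (N`!)%:R * (N`!)%:R = ((2 * N)`!)%:R.
Proof.
rewrite /C -mulrA -!natrM; congr (_%:R).
have /bin_fact : (N <= 2 * N)%N by clear; lia.
by rewrite (_ : 2 * N - N = N)%N //; clear; lia.
Qed.

Let pe3 : 3 * (p%:R / 3) = p%:R :> R. Proof. by rewrite mulrCA divrr // mulr1. Qed.

Let wilson : p%:R * (p.-1`!)%:R = - p%:R :> R.
Proof. by rewrite -pe3 -mulrA (mulp_wilson hR p5) mulrN. Qed.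

Let wilson2 : p%:R * (((2 * N)`!)%:R * (N`!)%:R) = - p%:R :> R.
Proof.
rewrite -wilson (fact_pred_rev hR p5 (n := N)); last by clear -hN; lia.
rewrite (_ : p.-1 - N = 2 * N)%N; last by clear -hN; lia.
have := mul_poch_nil pp 1 (-1) N; rewrite mulrN1 poch1 => e.
by rewrite sgnN; transitivity (((2 * N)`!)%:R * (p%:R * (N`!)%:R) : R); [ring|rewrite -e; ring].
Qed.

(** [C(5 N, N) N!] is the symbol at [4 N + 1 = N + p]; moving its base up by one reaches
    [poch_shift_const] at [i = 5], whose displacement is [3 e = p]. *)
Let bin5 : ('C(5 * N, N))%:R * (2 * N%:R + p%:R) = (N%:R + p%:R) * C.
Proof.
have Pc : poch (N%:R + p%:R + 1) N = C * (N`!)%:R :> R.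
  apply: (mulIr uNf); rewrite binC -(poch_two_thirds hR p5 hN) -(poch_shift_const hR p5 hN 5); congr (_ * _).
  apply: (congr1 (fun z : R => poch z N)); rewrite -[N.+1]addn1 (natrD _ N) -{1}pe3; ring.
have b5 : ('C(5 * N, N))%:R * (N`!)%:R = poch (N%:R + p%:R) N :> R.
  rewrite -natrM (_ : 5 * N = 4 * N + N)%N; last by clear; lia.
  rewrite -poch_bin; apply: (congr1 (fun z : R => poch z N)).
  by rewrite -natrD; congr (_%:R); rewrite -hN; clear; lia.
have := poch_shift (N%:R + p%:R : R) N; rewrite Pc -b5 => h.
apply: (mulIr uNf).
transitivity (('C(5 * N, N))%:R * (N`!)%:R * (N%:R + p%:R + N%:R) : R); first by ring.
by rewrite -h; ring.
Qed.

Lemma jacobi2_value : jacobi2 p R N = - C.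
Proof.
have u : 2 * N%:R + p%:R \is a @GRing.unit R.
  rewrite -[p%:R]mulr1; apply: (unit_addr_nil pp).
  by rewrite -natrM (unit_lt hR) //; lia.
rewrite (jacobi2_eq hR hN) //; apply: (mulIr u); rewrite natrM -/C.
transitivity ((p%:R - 1) * ((1 - 2 * N%:R) * C * (2 * N%:R + p%:R)
  + 4 * N%:R * (('C(5 * N, N))%:R * (2 * N%:R + p%:R))) : R); first by ring.
rewrite bin5; apply: subr0_eq.
transitivity ((p%:R * p%:R) * (1 + 2 * N%:R) * C : R); first by ring.
by rewrite pp !mul0r.
Qed.

(** The product from [2 N + 1] to [4 N] splits at [3 N + 1 = p]: the lower half completes [(p - 1)!]
    and the upper half starts with [p]. *)
Let bin4 : ('C(4 * N, 2 * N))%:R * ((2 * N)`!)%:R * ((2 * N)`!)%:R = - (p%:R * (N.-1`!)%:R) :> R.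
Proof.
have e : ('C(4 * N, 2 * N) * (2 * N)`!)%:R = poch ((2 * N).+1%:R) (2 * N) :> R.
  by rewrite poch_bin (_ : 2 * N + 2 * N = 4 * N)%N //; clear; lia.
rewrite -natrM e {2}(_ : 2 * N = N + N)%N; last by clear; lia.
rewrite poch_add mulrAC poch_natS (_ : 2 * N + N = p.-1)%N; last by clear -hN; lia.
rewrite -natrD (_ : (2 * N).+1 + N = p)%N; last by clear -hN; lia.
have := pochSl (p%:R : R) N.-1; rewrite prednK // addrC -[X in 1 + X]mulr1 mul_poch_nil // poch1 => ->.
by rewrite mulrA [_ * p%:R]mulrC wilson mulNr.
Qed.

Lemma jacobi_prod_value : jacobi1 p R N ^+ 2 = 0 /\ jacobi1 p R N * jacobi2 p R N = p%:R.
Proof.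
have f1 : N%:R * (N.-1`!)%:R = (N`!)%:R :> R.
  by rewrite -natrM -{3}(prednK N0) factS prednK.
have e : jacobi1 p R N * ((2 * N)`!)%:R * ((2 * N)`!)%:R = p%:R * (N`!)%:R.
  rewrite (jacobi1_eq hR hN) //.
  transitivity (N%:R * (p%:R - 1) * (('C(4 * N, 2 * N))%:R * ((2 * N)`!)%:R * ((2 * N)`!)%:R) : R).
    by ring.
  rewrite bin4; apply: subr0_eq.
  transitivity (p%:R * (N%:R * (N.-1`!)%:R - (N`!)%:R) - p%:R * p%:R * N%:R * (N.-1`!)%:R : R).
    by ring.
  by rewrite f1 subrr pp; ring.
pose s : R := (N`!)%:R / ((2 * N)`!)%:R / ((2 * N)`!)%:R.
have hs : jacobi1 p R N = p%:R * s.
  by apply: (mulIr uF2); apply: (mulIr uF2); rewrite e /s !mulrA !divrK.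
split; first by rewrite hs exprMn p20 mul0r.
have sC : s * C * (((2 * N)`!)%:R * (N`!)%:R) = 1.
  apply: (mulIr uNf); rewrite mul1r /s.
  transitivity ((C * (N`!)%:R * (N`!)%:R) * (((2 * N)`!)%:R / ((2 * N)`!)%:R) * (N`!)%:R / ((2 * N)`!)%:R : R).
    by ring.
  rewrite binC divrr // mulr1 mulrAC divrr // mul1r //.
rewrite jacobi2_value hs.
transitivity (s * C * - p%:R : R); first by ring.
rewrite -wilson2; transitivity (p%:R * (s * C * (((2 * N)`!)%:R * (N`!)%:R)) : R); first by ring.
by rewrite sC mulr1.
Qed.
End JacobiValues.

Lemma card_sum_bool (T : finType) (b : pred T) : #|[set t | b t]| = (\sum_(t : T) b t)%N.
Proof.
by rewrite -sum1_card big_mkcond; apply: eq_bigr => t _; rewrite inE; case: (b t).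
Qed.

(** * The integers behind the Jacobi sums *)

Section Count.
Variables (p : nat) (R : comUnitRingType).
Hypothesis hR : mod_sqr p R.
Hypothesis hz : forall n, n%:R = 0 :> R -> (p ^ 2 %| n)%N.
Hypothesis p5 : (5 < p)%N.
Variable a : nat.
Let N := (2 * a)%N.
Hypothesis hN : (3 * N + 1 = p)%N.

Let hp : prime p. Proof. by case: hR. Qed.
Let N0 : (0 < N)%N. Proof. by lia. Qed.
Let p1N : p.-1 = (3 * N)%N. Proof. by lia. Qed.
Let evN : ~~ odd N. Proof. by rewrite /N oddM. Qed.

Let norm_res (t : 'F_p) : 'F_p := (t * (1 - t)) ^+ N.

Let count (y : 'F_p) : nat := (\sum_(t : 'F_p) (norm_res t == y))%N.

(* The projective line [u + v + w = 0] carries the rotation [t |-> 1 / (1 - t)], which multiplies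
   [t (1 - t)] by a cube. *)
Let norm_res_rot t : norm_res t != 0 -> norm_res (1 - t)^-1 = norm_res t.
Proof.
rewrite expf_eq0 N0 mulf_eq0 negb_or => /andP[t0 t1].
rewrite /norm_res; have -> : (1 - t)^-1 * (1 - (1 - t)^-1) = - (t * (1 - t)) / (1 - t) ^+ 3 by field.
rewrite exprMn exprVn -exprM -p1N (Fp_fermat hp) // divr1 exprNn -signr_odd (negPf evN).
by rewrite expr0 mul1r.
Qed.

(** A fixed point of the rotation has [t (1 - t) = 1], hence [norm_res t = 1]. The fibres over the
    other nonzero values are unions of three-cycles. *)
Let dvdn3_count y : y != 0 -> y != 1 -> (3 %| count y)%N.
Proof.
move=> y0 y1; rewrite /count -(card_sum_bool (fun t => norm_res t == y)).
apply: (@dvdn3_card _ (fun t : 'F_p => (1 - t)^-1)) => t; rewrite inE => /eqP ht.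
have t01 : norm_res t != 0 by rewrite ht.
have := t01; rewrite expf_eq0 N0 mulf_eq0 negb_or => /andP[t0 t1].
split.
- by rewrite inE norm_res_rot // ht.
- apply/eqP => e; case/eqP: y1; rewrite -ht /norm_res.
  have : (1 - t)^-1 * (1 - t) = 1 by rewrite mulVf.
  by rewrite e => ->; rewrite expr1n.
- have e1 : 1 - (1 - t)^-1 = - t / (1 - t) by field.
  rewrite e1 invf_div; have tn : - t != 0 by rewrite oppr_eq0.
  have -> : 1 - (1 - t) / - t = t^-1.
    by rewrite invrN mulrN opprK mulrBl mul1r divff // addrCA subrr addr0.
  by rewrite invrK.
Qed.

(** Grouping by cubic residue writes [J1 = n0 + n1 w + n2 w^2] with [w] a primitive cube root of
    unity in [R]. The norm form [D] of these counts is [J1 J2] in [R], and four times it is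
    [(2 n0 - n1 - n2)^2 + 3 (n1 - n2)^2]. *)
Lemma norm_form_binomial : exists A B : int,
  (4 * p)%:R = A ^+ 2 + 27 * B ^+ 2 /\
  (A ^+ 2)%:~R = ('C(2 * N, N))%:R ^+ 2 + 2 * p%:R :> R.
Proof.
have [z z0 zN] : exists2 z : 'F_p, z != 0 & z ^+ N != 1.
  apply: (exists_expr_neq1 hp); rewrite p1N; apply/negP => /(dvdn_leq N0).
  by clear -N0; lia.
pose om : 'F_p := z ^+ N; rewrite -/om in zN.
have om3 : om ^+ 3 = 1 by rewrite /om -exprM mulnC -p1N (Fp_fermat hp).
have om0 : om != 0 by rewrite expf_neq0.
have om2 : om ^+ 2 != 1.
  by apply: contra zN => /eqP e; move: om3; rewrite exprS e mulr1 => ->.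
have om12 : om ^+ 2 != om.
  by apply: contra zN => /eqP e; apply/eqP/(mulfI om0); rewrite mulr1 -expr2.
have oms : 1 + om + om ^+ 2 = 0.
  have : (om - 1) * (1 + om + om ^+ 2) = 0 by transitivity (om ^+ 3 - 1); [ring|rewrite om3 subrr].
  by move=> /eqP; rewrite mulf_eq0 subr_eq0 (negPf zN) => /eqP.
pose w := @teich p R om.
have w3 : w ^+ 3 = 1 by rewrite /w -(teichX hR) om3 (teich1 hR).
have ws : w ^+ 2 = - 1 - w.
  have u : w - 1 \is a GRing.unit by rewrite -(teich1 hR); exact: (teich_sub_unit hR).
  apply: (mulrI u); apply: subr0_eq; transitivity (w ^+ 3 - 1); first by ring.
  by rewrite w3 subrr.
have val_res t : teich R (norm_res t) = (norm_res t == 1)%:R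
    + (norm_res t == om)%:R * w + (norm_res t == om ^+ 2)%:R * w ^+ 2.
  have [e|nz] := eqVneq (norm_res t) 0.
    rewrite e (teich0 hR) ![0 == _]eq_sym oner_eq0 (negPf om0) expf_eq0 (negPf om0) /=; ring.
  have : (norm_res t - 1) * (norm_res t - om) * (norm_res t - om ^+ 2) = 0.
    have y3 : norm_res t ^+ 3 = 1.
      rewrite /norm_res -exprM mulnC -p1N (Fp_fermat hp) //.
      by move: nz; rewrite expf_eq0 N0.
    move: (norm_res t) y3 => y y3.
    transitivity (y ^+ 3 - 1 + (1 + om + om ^+ 2) * (- y ^+ 2 + om * y) + (1 - om ^+ 3)).
      by ring.
    by rewrite y3 oms om3; ring.
  move=> /eqP; rewrite !mulf_eq0 !subr_eq0 -orbA => /or3P[] /eqP ->.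
  - by rewrite (teich1 hR) eqxx ![1 == _]eq_sym (negPf zN) (negPf om2) /=; ring.
  - by rewrite eqxx (negPf zN) [om == _]eq_sym (negPf om12) /w /=; ring.
  - by rewrite eqxx (negPf om2) (negPf om12) (teichX hR) /w /=; ring.
have val_sqr t : teich R (norm_res t) ^+ 2 = (norm_res t == 1)%:R
    + (norm_res t == om)%:R * w ^+ 2 + (norm_res t == om ^+ 2)%:R * w.
  rewrite val_res; have [->|n1] := eqVneq (norm_res t) 1.
    by rewrite ![1 == _]eq_sym (negPf zN) (negPf om2) /=; ring.
  have [->|n2] := eqVneq (norm_res t) om.
    by rewrite [om == _]eq_sym (negPf om12) /=; ring.
  case: eqVneq => _ /=; last by ring.
  by transitivity (w ^+ 3 * w); [ring|rewrite w3; ring].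
pose n0 := count 1; pose n1 := count om; pose n2 := count (om ^+ 2).
have cR y (c : R) : \sum_(t : 'F_p) (norm_res t == y)%:R * c = (count y)%:R * c.
  by rewrite -mulr_suml -natr_sum.
have j1 : jacobi1 p R N = n0%:R + n1%:R * w + n2%:R * w ^+ 2.
  rewrite -[n0%:R]mulr1 -!cR -!big_split; apply: eq_bigr => t _ /=.
  by rewrite -exprMn -(teichM hR) -(teichX hR) val_res; ring.
have j2 : jacobi2 p R N = n0%:R + n1%:R * w ^+ 2 + n2%:R * w.
  rewrite -[n0%:R]mulr1 -!cR -!big_split; apply: eq_bigr => t _ /=.
  by rewrite mulr1 -val_sqr /norm_res (teichX hR) (teichM hR) -exprM mulnC exprMn.
have nsum : (n0 + n1 + n2 <= p)%N.
  rewrite -[X in (_ <= X)%N](card_Fp hp) -sum1_card /n0 /n1 /n2 /count -!big_split /=.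
  apply: leq_sum => t _; case: (eqVneq _ 1) => [->|_].
    by rewrite ![1 == _]eq_sym (negPf zN) (negPf om2).
  case: (eqVneq _ om) => [->|_]; last by case: eqVneq.
  by rewrite [om == _]eq_sym (negPf om12).
have [j11 j12] := jacobi_prod_value hR p5 hN.
have j22 := jacobi2_value hR p5 hN.
pose D : int := n0%:Z ^+ 2 + n1%:Z ^+ 2 + n2%:Z ^+ 2 - n0%:Z * n1%:Z - n1%:Z * n2%:Z - n0%:Z * n2%:Z.
have DR : D%:~R = p%:R :> R.
  rewrite -j12 j1 j2 /D !(rmorphB, rmorphD, rmorphM, rmorphXn) /= -!pmulrn.
  move: (n0%:R : R) (n1%:R : R) (n2%:R : R) => x0 x1 x2.
  transitivity (x0 ^+ 2 + x1 ^+ 2 * w ^+ 3 + x2 ^+ 2 * w ^+ 3 + (x0 * x1 + x0 * x2) * (w + w ^+ 2)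
    + x1 * x2 * (w ^+ 2 + w ^+ 3 * w)); last by ring.
  by rewrite w3 ws; ring.
(* [D] and [p] agree modulo [p^2], and [0 <= D <= (n0 + n1 + n2)^2 <= p^2] leaves room only for
   equality. *)
have Dp : D = p%:Z.
  have : (p ^ 2 %| `|D - p%:Z|)%N.
    apply: hz; rewrite -[X in X = 0]/(`|D - p%:Z|%N%:R).
    have e0 : (D - p%:Z)%:~R = 0 :> R by rewrite rmorphB /= DR -pmulrn subrr.
    move: e0; rewrite {1}[D - _]intEsign rmorphM rmorph_sign /= -pmulrn => h0.
    by rewrite -[LHS](signrMK (D - p%:Z < 0)%R) h0 mulr0.
  have D0 : 0 <= D.
    rewrite -(pmulr_rge0 _ (isT : 0 < 4 :> int)).
    have -> : 4 * D = (2 * n0%:Z - n1%:Z - n2%:Z) ^+ 2 + 3 * (n1%:Z - n2%:Z) ^+ 2 by rewrite /D; ring.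
    by apply: addr_ge0; [exact: sqr_ge0|apply: mulr_ge0 => //; exact: sqr_ge0].
  have Dle : D <= p%:Z ^+ 2.
    apply: (@le_trans _ _ ((n0 + n1 + n2)%N%:Z ^+ 2)); last by rewrite lerXn2r ?nnegrE // lez_nat.
    rewrite -subr_ge0 !PoszD.
    have -> : (n0%:Z + n1%:Z + n2%:Z) ^+ 2 - D = 3 * (n0%:Z * n1%:Z + n1%:Z * n2%:Z + n0%:Z * n2%:Z).
      by rewrite /D; ring.
    by apply: mulr_ge0 => //; do ![apply: addr_ge0]; exact: mulr_ge0.
  have pp0 : (5 < p%:Z)%R by rewrite ltz_nat.
  move=> dv; apply/eqP; rewrite -subr_eq0 -absz_eq0; apply/negPn/negP => ne.
  have := dvdn_leq _ dv; rewrite lt0n ne => /(_ isT).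
  have : (`|D - p%:Z| < p ^ 2)%N.
    rewrite -ltz_nat abszE -mulnn PoszM -expr2; move: D0 Dle pp0; clear.
    move: D (p%:Z) => d q d0 dq q5; have q2 : q < q ^+ 2 by rewrite expr2 ltr_pMr; lra.
    by rewrite ltr_norml; apply/andP; split; lra.
  by rewrite ltnNge => /negP.
have [m1 e1] : exists m, n1 = (m * 3)%N by apply/dvdnP/dvdn3_count.
have [m2 e2] : exists m, n2 = (m * 3)%N by apply/dvdnP/dvdn3_count; rewrite ?expf_neq0.
(* Divisibility of [n1] and [n2] by 3 turns the coefficient 3 of the norm form into 27. As
   [w + w^2 = -1], the first witness is [J1 + J2] in [R], with square [J2^2 + 2 J1 J2]. *)
exists (2 * n0%:Z - n1%:Z - n2%:Z), (m1%:Z - m2%:Z); split.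
  have pD : p%:R = D :> int by rewrite Dp natz.
  by rewrite natrM pD /D e1 e2 !PoszM; ring.
rewrite rmorphXn /= (_ : (2 * n0%:Z - n1%:Z - n2%:Z)%:~R = jacobi1 p R N + jacobi2 p R N).
  rewrite sqrrD j11 j12 j22 sqrrN; ring.
rewrite j1 j2 !(rmorphB, rmorphM) /= -!pmulrn.
move: (n0%:R : R) (n1%:R : R) (n2%:R : R) => x0 x1 x2.
by rewrite ws; ring.
Qed.
End Count.

(** * The theorem *)

Lemma Zp_sqr_mod_sqr p : prime p -> mod_sqr p 'Z_(p ^ 2).
Proof.
move=> hp; have p1 := prime_gt1 hp.
have q1 : (1 < p ^ 2)%N by rewrite -(exp1n 2) ltn_exp2r.
split=> // [|n hn]; first by rewrite -natrX; apply: val_inj; rewrite /= val_Zp_nat // modnn.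
by rewrite unitZpE // coprimeXl // prime_coprime.
Qed.

Lemma Zp_sqr_natr_eq0 p n : prime p -> n%:R = 0 :> 'Z_(p ^ 2) -> (p ^ 2 %| n)%N.
Proof.
move=> hp h; have p1 := prime_gt1 hp.
have q1 : (1 < p ^ 2)%N by rewrite -(exp1n 2) ltn_exp2r.
by have := congr1 val h; rewrite /= val_Zp_nat // => /eqP.
Qed.

Section Sums.
Variables (p : nat) (R : comUnitRingType).
Hypothesis hR : mod_sqr p R.
Hypothesis p5 : (5 < p)%N.

Let u2 : (2 : R) \is a GRing.unit. Proof. by apply: (unit_lt hR); lia. Qed.
Let u3 : (3 : R) \is a GRing.unit. Proof. by apply: (unit_lt hR); lia. Qed.
Let u192 : (192 : R) \is a GRing.unit.
Proof. have -> : 192 = 2 ^+ 6 * 3 :> R by ring.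
  by rewrite unitrM unitrX. Qed.
Let w : R := - 192^-1.

Let hw : 192 * w = -1. Proof. by rewrite /w mulrN divrr. Qed.
Let ux k : (-192 : R) ^+ k \is a GRing.unit. Proof. by rewrite unitrX // unitrN. Qed.
Let wX k : w ^+ k = ((-192) ^+ k)^-1. Proof. by rewrite /w -invrN exprVn. Qed.
Let r192 k : reduces p ((-192) ^+ k) ((-192 : R) ^+ k).
Proof. exact (reducesX hR k (reducesN (reduces_nat hR 192))). Qed.

Lemma reduces_S1 : reduces p
  (\sum_(0 <= k < p) (k%:R * ('C(k.*2, k) ^ 2 * 'C(3 * k, k))%:R / (-192) ^+ k)) (qsum p w 1).
Proof.
rewrite big_mkord.
apply: (reduces_sum hR
  (f := fun k : nat => k%:R * ('C(k.*2, k) ^ 2 * 'C(3 * k, k))%:R / (-192) ^+ k)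
  (g := fun k : nat => k%:R ^+ 1 * (cf3 k)%:R * w ^+ k)) => k hk.
apply: (reducesM hR); first by apply: (reducesM hR); rewrite ?expr1; exact: (reduces_nat hR).
by rewrite wX; exact (reducesV hR (r192 k) (ux k)).
Qed.

Lemma reduces_S2 : reduces p
  (\sum_(0 <= k < p.-1) (('C(k.*2, k) ^ 2 * 'C(3 * k, k))%:R / ((-192) ^+ k * (k.+1)%:R)))
  (\sum_(0 <= k < p.-1) (cf3 k)%:R * w ^+ k / k.+1%:R).
Proof.
rewrite !big_mkord.
apply: (reduces_sum hR (f := fun k : nat => ('C(k.*2, k) ^ 2 * 'C(3 * k, k))%:R / ((-192) ^+ k * (k.+1)%:R))
  (g := fun k : nat => (cf3 k)%:R * w ^+ k / k.+1%:R)) => k hk.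
have uk : (k.+1%:R : R) \is a GRing.unit by apply: (unit_lt hR); lia.
have -> : (cf3 k)%:R * w ^+ k / k.+1%:R = (cf3 k)%:R * ((-192) ^+ k * k.+1%:R)^-1 :> R.
  by rewrite wX invrM // -mulrA [_^-1 * _^-1 in RHS]mulrC.
apply: (reducesM hR); first exact: (reduces_nat hR).
have u : (-192 : R) ^+ k * k.+1%:R \is a GRing.unit by rewrite unitrM ux.
exact (reducesV hR (reducesM hR (r192 k) (reduces_nat hR k.+1)) u).
Qed.
End Sums.

Theorem theorem2p8 (p : nat) (hp : prime p) (hp5 : (5 < p)%N) :
  let S1 : rat := \sum_(0 <= k < p)
      (k%:R * ('C(k.*2, k) ^ 2 * 'C(3 * k, k))%:R / (-192) ^+ k) in
  let S2 : rat := \sum_(0 <= k < p.-1)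
      (('C(k.*2, k) ^ 2 * 'C(3 * k, k))%:R / ((-192) ^+ k * (k.+1)%:R)) in
  ((p %% 3 = 1)%N -> forall x y : int, (4 * p)%:R = x ^+ 2 + 27 * y ^+ 2 ->
      rat_cong p 2 S1 (3 / 5 * p%:R - 1 / 5 * (x ^+ 2)%:~R)
   /\ rat_cong p 2 S2 (3 / 2 * (x ^+ 2)%:~R - 4 * p%:R))
  /\
  ((p %% 3 = 2)%N ->
      rat_cong p 2 S1 (- (p%:R / 5))
   /\ rat_cong p 2 S2
        (2 * (2 * p + 1)%:R * ('C((2 * p) %/ 3, p %/ 3) ^ 2)%:R + p%:R)).
Proof.
move=> S1 S2.
have hR := Zp_sqr_mod_sqr hp; set R : comUnitRingType := 'Z_(p ^ 2) in hR.
have hz n : n%:R = 0 :> R -> (p ^ 2 %| n)%N := @Zp_sqr_natr_eq0 p n hp.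
(* From here on [R] is known only through [hR] and [hz]. *)
clearbody R.
have u2 : (2 : R) \is a GRing.unit by apply: (unit_lt hR); lia.
have u3 : (3 : R) \is a GRing.unit by apply: (unit_lt hR); lia.
have u5 : (5 : R) \is a GRing.unit by apply: (unit_lt hR); lia.
have u192 : (192 : R) \is a GRing.unit.
  have -> : 192 = 2 ^+ 6 * 3 :> R by ring.
  by rewrite unitrM unitrX.
have u216 : (216 : R) \is a GRing.unit.
  have -> : 216 = 2 ^+ 3 * 3 ^+ 3 :> R by ring.
  by rewrite unitrM !unitrX.
have hx : 216 * - 216^-1 = -1 :> R by rewrite mulrN divrr.
have hw : 192 * - 192^-1 = -1 :> R by rewrite mulrN divrr.
have [] := sums_gh hR hp5 hx hw.
have r1 := reduces_S1 hR hp5; have r2 := reduces_S2 hR hp5.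
rewrite -/S1 in r1; rewrite -/S2 in r2.
move: r1 r2; set s1 := qsum _ _ _; set s2 := \sum_(_ <= _ < _) _ => r1 r2.
have rdiv a b : (b%:R : R) \is a GRing.unit -> reduces p (a%:R / b%:R) (a%:R / b%:R : R).
  by move=> u; exact: (reducesM hR (reduces_nat hR a) (reducesV hR (reduces_nat hR b) u)).
have podd : (p %% 2 = 1)%N.
  by case: (even_prime hp) => [e|o]; [move: hp5; rewrite e|rewrite modn2 o].
set g := gsum _ _; set h := 3 * _ + _ => e1 e2.
have p20 : p%:R ^+ 2 = 0 :> R by case: hR.
split=> pmod.
  (* [p] is odd and 1 modulo 3, so [p = 6 a + 1]; in the other case [p = 6 b + 5]. *)
  move=> x y hxy; pose a := (p %/ 6)%N.
  have hN : (3 * (2 * a) + 1 = p)%N by rewrite /a; clear -podd pmod; lia.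
  have gE : g = ('C(2 * (2 * a), 2 * a))%:R := value_one_mod3 hR hp5 hN hx.
  have [h0 gh] : h ^+ 2 = 0 /\ 3 * (g * h) = p%:R := deriv_one_mod3 hR hp5 hN hx.
  have [A [B [hAB hA]]] := norm_form_binomial hR hz hp5 hN.
  rewrite -gE -(sqr_norm_form_unique hp hxy hAB) in hA.
  split.
    apply: (reduces_cong hR hz r1 (x := s1)).
    have -> : s1 = 3 / 5 * p%:R - 1 / 5 * (x ^+ 2)%:~R.
      apply: (mulrI u5); rewrite e1 hA.
      transitivity (3 * (g * h) - g ^+ 2); first by ring.
      rewrite gh; transitivity ((5 / 5) * (3 * p%:R - (g ^+ 2 + 2 * p%:R)) : R); last by ring.
      by rewrite divrr //; ring.
    apply: (reducesD hR).
      by apply: (reducesM hR); [exact: rdiv|exact: (reduces_nat hR)].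
    by apply: reducesN; apply: (reducesM hR); [exact: (@rdiv 1 5 u5)|exact: (reduces_int hR)].
  apply: (reduces_cong hR hz r2 (x := s2)).
  have -> : s2 = 3 / 2 * (x ^+ 2)%:~R - 4 * p%:R.
    apply: (mulrI u2); rewrite e2 h0 hA.
    transitivity (- 2 * (3 * (g * h)) + 3 * g ^+ 2); first by ring.
    rewrite gh; transitivity (2 / 2 * 3 * (g ^+ 2 + 2 * p%:R) - 8 * p%:R : R); last by ring.
    by rewrite divrr //; ring.
  apply: (reducesD hR).
    by apply: (reducesM hR); [exact: rdiv|exact: (reduces_int hR)].
  by apply: reducesN; apply: (reducesM hR); exact: (reduces_nat hR).
pose b := (p %/ 6)%N; pose n := (2 * b + 1)%N.
have hn : (3 * (2 * b + 1) + 2 = p)%N by rewrite /b; clear -podd pmod; lia.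
have hE : 3 * h = 2 * (1 + p%:R) * ('C(2 * n + 1, n))%:R := deriv_two_mod3 hR hp5 hn hx.
have [g0 gh] : g ^+ 2 = 0 /\ 3 * (g * h) = - p%:R := value_two_mod3 hR hp5 hn hx.
have eC : 'C((2 * p) %/ 3, p %/ 3) = 'C(2 * n + 1, n).
  by congr 'C(_, _); rewrite /n; clear -hn; lia.
split.
  apply: (reduces_cong hR hz r1 (x := s1)).
  have -> : s1 = - (p%:R / 5).
    apply: (mulrI u5); rewrite e1 g0.
    transitivity (3 * (g * h)); first by ring.
    by rewrite gh; transitivity (- (5 / 5 * p%:R) : R); [rewrite divrr // mul1r|ring].
  by apply: reducesN; exact: rdiv.
apply: (reduces_cong hR hz r2 (x := s2)); rewrite eC.
have -> : s2 = 2 * (2 * p + 1)%:R * ('C(2 * n + 1, n) ^ 2)%:R + p%:R.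
  apply: (mulrI u2); rewrite e2 g0 natrX natrD natrM.
  transitivity ((3 * h) ^+ 2 - 2 * (3 * (g * h))); first by ring.
  rewrite hE gh; move: ('C(_, _))%:R => c.
  transitivity (4 * (1 + 2 * p%:R + p%:R ^+ 2) * c ^+ 2 + 2 * p%:R : R); first by ring.
  by rewrite p20; ring.
apply: (reducesD hR); last exact: (reduces_nat hR).
by apply: (reducesM hR); [apply: (reducesM hR)|]; exact: (reduces_nat hR).
Qed.
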